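(* Let $X\subset P^N(\mathbf{C})$ be a submanifold of dimension $n$ with degenerate Gauss map of rank $r$ ($2\le r<n$), with plane generators $L$ of dimension $l=n-r$, satisfying the standing assumptions of the context. Let $m$ be the number of linearly independent second fundamental forms of $X$. Suppose that $l\ge 1$ and $m\ge 2$, and that (for all values of the parameters $u\in M$) the focus hypersurfaces $F_L$ and the focus hypercones $\Phi_L$ do not have multiple components. Then $X$ is foliated into $r$ families of torses with $l$-dimensional plane generators $L$, and each of these families depends on $r-1$ parameters.
   Context: Setting. $X\subset P^N(\mathbf{C})$ is a smooth $n$-dimensional submanifold whose Gauss map $\gamma:X\to G(n,N)$, $\gamma(x)=T_x(X)$ (the tangent subspace, an $n$-dimensional projective subspace), has constant rank $r<n$; $r$ is called the rank of $X$. The leaves of $\gamma$ are (open parts of) projective subspaces $L$ of dimension $l=n-r$. They are extended to full projective subspaces $P^l$, also denoted $L$ and called plane generators of $X$, so that $X=f(P^l\times M^r)$, with $M$ an $r$-dimensional parameter variety with parameters $u=(u^p)$ and $f:P^l\times M\to P^N$ differentiable. $T_L\supset L$ denotes the $n$-dimensional tangent subspace, constant along $L$. Frames and matrices. Index ranges: $i,j=0,\dots,l$; $p,q,s=l+1,\dots,n$; $\alpha=n+1,\dots,N$. Take projective frames $\{A_0,\dots,A_N\}$ with $A_i\in L$ and $A_i,A_p\in T_L$, and write $dA_a=\sum_b\omega_a^bA_b$ for $a,b=0,\dots,N$. Let $\theta^p$ be basis 1-forms on $M$. Then (summation over repeated indices) $\omega_i^\alpha=0$, $\omega_i^p=c^p_{qi}\theta^q$,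 $\omega_p^\alpha=b^\alpha_{qp}\theta^q$. Put $C_i=(c^p_{qi})$ and $B^\alpha=(b^\alpha_{qp})$, $r\times r$ matrices. They satisfy $b^\alpha_{qs}c^s_{pi}=b^\alpha_{ps}c^s_{qi}$, i.e. the products $H^\alpha_i=B^\alpha C_i=(h^\alpha_{ipq})$ are symmetric, and $h_i^\alpha=h^\alpha_{ipq}\theta^p\theta^q$ are the second fundamental forms of $X$. Focal images. The focus hypersurface $F_L\subset L$ is the algebraic hypersurface of degree $r$ given by $\det(c^q_{pi}x^i)=0$ for $x=x^iA_i\in L$. The focus hypercone $\Phi_L$ is the algebraic hypercone of degree $r$ with vertex $T_L$ formed by the hyperplanes $\xi=(\xi_\alpha)\supset T_L$ with $\det(\xi_\alpha B^\alpha)=0$. Osculating subspace. $S_L$ is the osculating subspace of $X$ (constant along $L$); $\dim S_L=n+m$, where $m$ is the number of linearly independent second fundamental forms. Standing assumptions. $r>1$; for all $u\in M$ the system of forms $h_i^\alpha$ is regular, i.e. among them there is at least one nondegenerate quadratic form; all conditions in theorems are assumed to hold for all $u\in M$. Torse. A torse with $l$-dimensional plane generators is the $(l+1)$-dimensional submanifold (of rank $1$) swept by the osculating subspaces of order (and dimension) $l$ of a curve $Y$ of class $C^p$, $l\le p$, where $l\le N'-1$ and $N'$ is the dimension of the smallest projective subspace containing $Y$; in the paper, torses are identified with the submanifolds of rank $1$. *)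

(* Defs.v *)
From mathcomp Require Import all_boot all_order all_algebra.
From mathcomp Require Import all_classical all_reals all_analysis.
From mathcomp Require Import complex.
From mathcomp Require mpoly.
Import (canonicals) mpoly.

Set Implicit Arguments.
Unset Strict Implicit.
Unset Printing Implicit Defensive.

Import Order.TTheory GRing.Theory Num.Theory.
Import numFieldNormedType.Exports.

Local Open Scope classical_set_scope.
Local Open Scope ring_scope.

(* The definitions are stated over a numFieldType K and used at K = R[i], where
   [differentiable] is complex differentiability.  Points of the projective
   space P^N(K) are nonzero vectors of 'rV[K]_N.+1 up to scaling, and a
   d-dimensional projective subspace is the row space of a row-free
   (d + 1) x (N + 1) matrix. *)

Fixpoint class_C (K : numFieldType) (V W : normedModType K) (k : nat)
    (U : set V) (f : V -> W) : Prop :=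
  if k is k'.+1 then
    (forall u, U u -> differentiable f u) /\
    (forall v : V, class_C k' U ('D_v f))
  else forall u, U u -> {for u, continuous f}.

Definition smooth (K : numFieldType) (V W : normedModType K)
    (U : set V) (f : V -> W) : Prop :=
  forall k : nat, class_C k U f.

Section DegenerateGaussMap.
Context {K : numFieldType} {d l N : nat}.

(* A family A of l-planes with d parameters sweeps out the image X of
   f : P^l x M -> P^N, f (x, u) = x *m A u.  The tangent subspace of X at
   f (x, u) is spanned by the image of the differential of (x, u) |-> x *m A u. *)
Definition tangent_space (A : 'rV[K]_d -> 'M[K]_(l.+1, N.+1)) (u : 'rV[K]_d)
    (x : 'rV[K]_l.+1) : 'M[K]_(l.+1 + d, N.+1) :=
  col_mx (A u) (\matrix_(q < d) (x *m 'D_(delta_mx 0 q) A u)).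

Definition smooth_point (A : 'rV[K]_d -> 'M[K]_(l.+1, N.+1)) (u : 'rV[K]_d)
    (x : 'rV[K]_l.+1) : Prop :=
  \rank (tangent_space A u x) = (l.+1 + d)%N.

(* The differential at u of the map u |-> row space of T u into the
   Grassmannian, whose tangent space at the subspace T is Hom(T, K^(N+1) / T);
   the quotient is computed by the cokernel matrix. *)
Definition gauss_differential (m : nat) (T : 'rV[K]_d -> 'M[K]_(m, N.+1))
    (u : 'rV[K]_d) : 'M[K]_(d, m * N.+1) :=
  \matrix_(q < d) mxvec ('D_(delta_mx 0 q) T u *m cokermx (T u)).

(* The planes A u (u in M) sweep out a submanifold of dimension l + d whose
   Gauss map is constant along each of them, with value T u, and has constant
   rank d; they are then its plane generators. *)
Record degenerate_gauss (M : set 'rV[K]_d) (A : 'rV[K]_d -> 'M[K]_(l.+1, N.+1))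
    (T : 'rV[K]_d -> 'M[K]_(l.+1 + d, N.+1)) : Prop := DegenerateGauss {
  dg_open : open M;
  dg_diffA : forall u, M u -> differentiable A u;
  dg_diffT : forall u, M u -> differentiable T u;
  dg_freeA : forall u, M u -> row_free (A u);
  dg_smooth : forall u, M u -> exists x, smooth_point A u x;
  dg_gauss : forall u x, M u -> smooth_point A u x ->
    (tangent_space A u x == T u)%MS;
  dg_rank : forall u, M u -> \rank (gauss_differential T u) = d
}.

End DegenerateGaussMap.

(* Torses are identified with the submanifolds of rank 1, so that cones are
   included. *)
Definition torse (K : numFieldType) (l N : nat) (S : set 'rV[K]_1)
    (A : 'rV[K]_1 -> 'M[K]_(l.+1, N.+1)) : Prop :=
  exists T, degenerate_gauss S A T.

Section Frames.
Context {K : numFieldType} {r l c N : nat}.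

(* A field of frames: the rows of F u are the points A_0, ..., A_l of L, then
   A_(l+1), ..., A_n, completing them to T_L, then A_(n+1), ..., A_N.  Here
   c = N - n. *)
Definition generator (F : 'rV[K]_r -> 'M[K]_(l.+1 + r + c, N.+1))
    (u : 'rV[K]_r) : 'M[K]_(l.+1, N.+1) := usubmx (usubmx (F u)).

Definition tangent_subspace (F : 'rV[K]_r -> 'M[K]_(l.+1 + r + c, N.+1))
    (u : 'rV[K]_r) : 'M[K]_(l.+1 + r, N.+1) := usubmx (F u).

(* The matrix (omega_a^b (v)) of the equations dA_a = sum_b omega_a^b A_b,
   a being the row index. *)
Definition connection (F : 'rV[K]_r -> 'M[K]_(l.+1 + r + c, N.+1))
    (u v : 'rV[K]_r) : 'M[K]_(l.+1 + r + c) :=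
  'D_v F u *m pinvmx (F u).

(* A coframe theta^1, ..., theta^r is given by matrices Theta u, with
   theta^q (v) = (v *m Theta u) 0 q; this is the q-th vector of the dual
   basis. *)
Definition dual_vector (Theta : 'rV[K]_r -> 'M[K]_r) (u : 'rV[K]_r)
    (q : 'I_r) : 'rV[K]_r := row q (invmx (Theta u)).

(* omega_i^p = c^p_(qi) theta^q, with the upper index as row index. *)
Definition mxC (F : 'rV[K]_r -> 'M[K]_(l.+1 + r + c, N.+1))
    (Theta : 'rV[K]_r -> 'M[K]_r) (u : 'rV[K]_r) (i : 'I_l.+1) : 'M[K]_r :=
  \matrix_(p, q) connection F u (dual_vector Theta u q)
    (lshift c (lshift r i)) (lshift c (rshift l.+1 p)).

(* omega_p^alpha = b^alpha_(qp) theta^q. *)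
Definition mxB (F : 'rV[K]_r -> 'M[K]_(l.+1 + r + c, N.+1))
    (Theta : 'rV[K]_r -> 'M[K]_r) (u : 'rV[K]_r) (a : 'I_c) : 'M[K]_r :=
  \matrix_(q, p) connection F u (dual_vector Theta u q)
    (lshift c (rshift l.+1 p)) (rshift (l.+1 + r) a).

(* The matrix of the second fundamental form h_i^alpha. *)
Definition mxH (F : 'rV[K]_r -> 'M[K]_(l.+1 + r + c, N.+1))
    (Theta : 'rV[K]_r -> 'M[K]_r) (u : 'rV[K]_r) (i : 'I_l.+1) (a : 'I_c) :
    'M[K]_r :=
  mxB F Theta u a *m mxC F Theta u i.

Definition regular_system (F : 'rV[K]_r -> 'M[K]_(l.+1 + r + c, N.+1))
    (Theta : 'rV[K]_r -> 'M[K]_r) (u : 'rV[K]_r) : Prop :=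
  exists i a, \det (mxH F Theta u i a) != 0.

(* The second fundamental forms of X at the point x = x^i A_i of L are
   x^i h_i^alpha, alpha = n + 1, ..., N; this is the number of linearly
   independent ones. *)
Definition number_of_forms (F : 'rV[K]_r -> 'M[K]_(l.+1 + r + c, N.+1))
    (Theta : 'rV[K]_r -> 'M[K]_r) (u : 'rV[K]_r) (x : 'rV[K]_l.+1) : nat :=
  \rank (\matrix_(a < c) mxvec (\sum_i x 0 i *: mxH F Theta u i a)).

End Frames.

Section Components.
Context {K : numFieldType} {k : nat}.

Definition mpoly_irreducible (g : mpoly.mpoly k K) : Prop :=
  g \isn't a GRing.unit /\
  forall a b, g = a * b -> a \is a GRing.unit \/ b \is a GRing.unit.

(* The components of the hypersurface P = 0 are the irreducible factors of P. *)
Definition no_multiple_components (P : mpoly.mpoly k K) : Prop :=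
  forall g h, mpoly_irreducible g -> P <> g ^+ 2 * h.

(* det (x^i G_i) as a polynomial in the x^i. *)
Definition pencil_det (r : nat) (G : 'I_k -> 'M[K]_r) : mpoly.mpoly k K :=
  \det (\sum_(i < k)
    mpoly.mpolyX K (mpoly.mnm1 i) *: map_mx (@mpoly.mpolyC k K) (G i)).

End Components.

Definition focus_hypersurface (K : numFieldType) (r l c N : nat)
    (F : 'rV[K]_r -> 'M[K]_(l.+1 + r + c, N.+1))
    (Theta : 'rV[K]_r -> 'M[K]_r) (u : 'rV[K]_r) : mpoly.mpoly l.+1 K :=
  pencil_det (mxC F Theta u).

Definition focus_hypercone (K : numFieldType) (r l c N : nat)
    (F : 'rV[K]_r -> 'M[K]_(l.+1 + r + c, N.+1))
    (Theta : 'rV[K]_r -> 'M[K]_r) (u : 'rV[K]_r) : mpoly.mpoly c K :=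
  pencil_det (mxB F Theta u).

Section Foliation.
Context {K : numFieldType} {r : nat}.

Definition box (S : set 'rV[K]_1) (W : set 'rV[K]_r.-1) :
    set 'rV[K]_(1 + r.-1) :=
  [set z | S (lsubmx z) /\ W (rsubmx z)].

(* A chart around u0 of a foliation of M by curves: the leaves are the curves
   s |-> Phi (row_mx s w), one for each value w of the r - 1 parameters. *)
Record foliation_chart (M : set 'rV[K]_r) (u0 : 'rV[K]_r) (S : set 'rV[K]_1)
    (W : set 'rV[K]_r.-1) (Phi : 'rV[K]_(1 + r.-1) -> 'rV[K]_r) : Prop :=
  FoliationChart {
  fc_openS : open S;
  fc_connectedS : connected S;
  fc_openW : open W;
  fc_open : open (Phi @` box S W);
  fc_sub : Phi @` box S W `<=` M;
  fc_base : (Phi @` box S W) u0;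
  fc_inj : {in box S W &, injective Phi};
  fc_diff : forall z, box S W z -> differentiable Phi z;
  fc_immersion : forall z, box S W z -> row_free ('J Phi z)
}.

Definition leaf_direction (Phi : 'rV[K]_(1 + r.-1) -> 'rV[K]_r)
    (z : 'rV[K]_(1 + r.-1)) : 'rV[K]_r :=
  'D_(delta_mx 0 (lshift r.-1 ord0)) Phi z.

(* Around each generator there are r foliations of the family A by torses, with
   independent tangent directions at every generator where they are defined.
   The statement is local in M, as monodromy may permute the r families. *)
Definition foliated_by_torses (l N : nat) (M : set 'rV[K]_r)
    (A : 'rV[K]_r -> 'M[K]_(l.+1, N.+1)) : Prop :=
  forall u0, M u0 ->
  exists (S : 'I_r -> set 'rV[K]_1) (W : 'I_r -> set 'rV[K]_r.-1)
         (Phi : 'I_r -> 'rV[K]_(1 + r.-1) -> 'rV[K]_r),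
  [/\ forall p, foliation_chart M u0 (S p) (W p) (Phi p),
      forall p w, W p w -> torse (S p) (fun s => A (Phi p (row_mx s w))) &
      forall z : 'I_r -> 'rV[K]_(1 + r.-1),
        (forall p, box (S p) (W p) (z p)) ->
        (forall p q, Phi p (z p) = Phi q (z q)) ->
        row_free (\matrix_(p < r) leaf_direction (Phi p) (z p))].

End Foliation.

(* Main.v *)
Require Import Defs.
From HB Require Import structures.
From mathcomp Require Import all_boot all_order all_algebra all_field.
From mathcomp Require Import all_classical all_reals all_analysis.
From mathcomp Require Import complex.
From mathcomp Require Import ring lra zify.
From mathcomp Require mpoly.
Import (canonicals) mpoly.
Set Implicit Arguments.
Unset Strict Implicit.
Unset Printing Implicit Defensive.
Import Order.TTheory GRing.Theory Num.Theory.
Import numFieldNormedType.Exports.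
Local Open Scope classical_set_scope.
Local Open Scope ring_scope.
Local Open Scope complex_scope.

(** The idea.  Fix a generator L at which some C_0 = C_i and some B_0 = B^alpha are
    invertible, as regularity provides.  Moving L in a direction y of M moves A_i,
    modulo L, by the point of T_L with coordinates y C_i on A_(l+1), ..., A_n, the
    matrix C_i being transposed here so as to act on rows.  The generators along a
    curve therefore form a torse as soon as, for its tangent directions y, all the
    rows y C_i are multiples of z = y C_0, and the span of L and of the point
    z^p A_p, which is then the tangent subspace along L, is not stationary; the
    number y B_0 z^T measures its motion out of T_L ([generator_motion],
    [point_motion], [torse_of_frame]).

    Such directions are eigenvectors.  The focus hypercone being free of multiple
    components, a general combination B_xi of the B^alpha is such that
    B_xi - mu B_0 is singular for r distinct values mu_p ([pencil_eigenvectors]).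
    Indeed, as a polynomial in one distinguished variable, the determinant of the
    pencil would otherwise have a repeated factor over the field of fractions of
    the ring of polynomials in the others, hence by Gauss a repeated irreducible
    factor ([factorial_mpoly], [separable_split_var]).  Let y_p be the left
    eigenvectors: y_p B_xi = mu_p y_p B_0.  The second fundamental forms are
    symmetric, because omega_i^alpha = 0 and second derivatives commute
    ([derive_sym], [matC_matB_sym]); so B_xi - mu_p B_0 annihilates all the columns
    (y_p C_i)^T.  Its kernel is a line, as the eigenvalue is simple, and y_p B_0
    does not vanish on this line ([pencil_kernel]).  Hence the y_p C_i are
    proportional and y_p B_0 (y_p C_0)^T <> 0, which is what a torse requires
    ([direction_proportional], [direction_bent]).

    The r eigenvectors extend to fields of eigenvectors near L, independent at
    each generator ([eigen_fields]); the integral curves of each of them are the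
    leaves of a chart, one leaf for each value of r - 1 transverse coordinates
    ([foliation_of_field]).

    The analysis is over the complex numbers, but by real methods: maps whose
    derivative is Lipschitz, with quadratic Taylor estimates.  Inverse functions
    are found by successive approximations ([c11_local_inverse_id]), which gives
    the fields of eigenvectors, and flows, in complex time, are limits of Euler
    polygons whose Taylor estimates are uniform in the number of steps
    ([local_flow]). *)

(** * The real-valued norm and completeness *)

Section RealNorm.
Context {R : realType}.
Local Notation C := R[i].

(** The norm of a normed module over R[i] takes its values in R[i]; estimates are
    made with this real number instead, on which real arithmetic applies. *)
Definition nr (V : normedZmodType C) (x : V) : R := complex.Re `|x|.

Lemma nrE (V : normedZmodType C) (x : V) : `|x| = (nr x)%:C.
Proof.
have := normr_ge0 x; rewrite /nr; case: `|x| => a b.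
by rewrite lecE /= => /andP[/eqP -> _].
Qed.

Section Norm.
Context {V : normedZmodType C}.
Implicit Types x y z : V.

Lemma nr_ge0 x : 0 <= nr x.
Proof. by rewrite -lecR -nrE normr_ge0. Qed.

Lemma nrD x y : nr (x + y) <= nr x + nr y.
Proof. by rewrite -lecR rmorphD /= -!nrE ler_normD. Qed.

Lemma nrN x : nr (- x) = nr x.
Proof. by rewrite /nr normrN. Qed.

Lemma nrB x y : nr (x - y) = nr (y - x).
Proof. by rewrite -nrN opprB. Qed.

Lemma nr0 : nr (0 : V) = 0.
Proof. by rewrite /nr normr0. Qed.

Lemma nr_eq0 x : (nr x == 0) = (x == 0).
Proof. by rewrite -[RHS]normr_eq0 nrE eq_complex /= eqxx andbT. Qed.

Lemma nr_le0 x : nr x <= 0 -> x = 0.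
Proof. by move=> h; apply/eqP; rewrite -nr_eq0 eq_le h nr_ge0. Qed.

Lemma nrD_le x y (a b : R) : nr x <= a -> nr y <= b -> nr (x + y) <= a + b.
Proof. by move=> h1 h2; apply: (le_trans (nrD x y)); apply: lerD. Qed.

Lemma nr_tri z x y : nr (x - y) <= nr (x - z) + nr (z - y).
Proof. by have := nrD (x - z) (z - y); rewrite addrA subrK. Qed.

Lemma nr_sum (I : Type) (s : seq I) (P : pred I) (f : I -> V) :
  nr (\sum_(i <- s | P i) f i) <= \sum_(i <- s | P i) nr (f i).
Proof.
elim/big_rec2: _ => [|i a b _ h]; first by rewrite nr0.
by apply: (le_trans (nrD _ _)); rewrite lerD2l.
Qed.

End Norm.

Lemma nrZ (V : normedModType C) (a : C) (x : V) : nr (a *: x) = nr a * nr x.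
Proof. by apply: complexI; rewrite rmorphM /= -!nrE normrZ. Qed.

Section Balls.
Context {V : normedModType C}.
Implicit Types x y z : V.

Lemma nbhs_nr (x : V) (P : set V) :
  nbhs x P <-> exists2 e : R, 0 < e & forall y, nr (y - x) < e -> P y.
Proof.
split.
  move=> /nbhs_normP [e /= e0 he]; exists (complex.Re e).
    by move: e0; rewrite ltcE /= => /andP[_].
  move=> y hy; apply: he => /=; rewrite nrE nrB ltcE /= hy andbT.
  by move: e0; rewrite ltcE /= => /andP[/eqP ->].
move=> [e e0 he]; apply/nbhs_normP; exists e%:C => /=; first by rewrite ltcR.
by move=> y /=; rewrite nrE ltcR nrB; apply: he.
Qed.

Lemma open_nr (U : set V) :
  open U <-> forall x, U x -> exists2 e : R, 0 < e & forall y, nr (y - x) < e -> U y.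
Proof.
rewrite openE; split=> h x Ux; first by apply/nbhs_nr/h.
by apply/nbhs_nr/h.
Qed.

Lemma open_nrball (x : V) (e : R) : open [set y | nr (y - x) < e].
Proof.
apply/open_nr => y /= hy; exists (e - nr (y - x)); first by rewrite subr_gt0.
by move=> z hz; apply: (le_lt_trans (nr_tri y z x)); lra.
Qed.

End Balls.

Lemma nrM (a b : C) : nr (a * b) = nr a * nr b.
Proof. by apply: complexI; rewrite rmorphM /= -!nrE normrM. Qed.

Lemma nrR (a : R) : nr a%:C = `|a|.
Proof. by apply: complexI; rewrite -nrE normc_def /= expr0n addr0 sqrtr_sqr. Qed.

Lemma nr1 : nr (1 : C) = 1.
Proof. by rewrite /nr normr1. Qed.

Lemma nr_Re (a : C) : `|complex.Re a| <= nr a.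
Proof.
rewrite /nr normc_def /= -sqrtr_sqr ler_wsqrtr //.
by rewrite lerDl sqr_ge0.
Qed.

Lemma nr_Im (a : C) : `|complex.Im a| <= nr a.
Proof.
rewrite /nr normc_def /= -sqrtr_sqr ler_wsqrtr //.
by rewrite lerDr sqr_ge0.
Qed.

Lemma nr_ReIm (a : C) : nr a <= `|complex.Re a| + `|complex.Im a|.
Proof.
rewrite {1}[a]complexE; apply: nrD_le; rewrite ?nrR // nrM nrR.
suff -> : nr ('i%C : C) = 1 by rewrite mul1r.
by rewrite /nr normc_def /= expr0n add0r expr1n sqrtr1.
Qed.

Section Matrices.
Context {m n : nat}.
Implicit Types x y : 'M[C]_(m, n).

Lemma nr_coord x i j : nr (x i j) <= nr x.
Proof.
rewrite -lecR -!nrE [leRHS]/Num.Def.normr /= mx_normE.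
by rewrite -[leLHS]nngE num_le; exact: (le_bigmax _ _ (i, j)).
Qed.

Lemma nr_mx_le x (a : R) : 0 <= a -> (forall i j, nr (x i j) <= a) -> nr x <= a.
Proof.
move=> a0 h; have [/mx_norm_neq0|] := boolP (mx_norm x != 0).
  by move=> [[i j] hij]; rewrite -lecR -nrE [leLHS]hij nrE lecR.
by rewrite negbK => /eqP /mx_norm_eq0 ->; rewrite nr0.
Qed.

End Matrices.

Lemma nr_sub_mx m n m' n' (x : 'M[C]_(m, n)) (y : 'M[C]_(m', n'))
    (f : 'I_m -> 'I_m') (g : 'I_n -> 'I_n') :
  (forall i j, x i j = y (f i) (g j)) -> nr x <= nr y.
Proof.
by move=> h; apply: nr_mx_le => [|i j]; rewrite ?nr_ge0 // h nr_coord.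
Qed.

Lemma nr_delta n (i : 'I_n) : nr (delta_mx 0 i : 'rV[C]_n) = 1.
Proof.
apply/eqP; rewrite eq_le; apply/andP; split.
  apply: nr_mx_le => // j k; rewrite mxE ord1 /=.
  by case: (k == i); rewrite /= ?nr1 ?nr0.
by rewrite -nr1; have := nr_coord (delta_mx 0 i : 'rV[C]_n) 0 i; rewrite mxE !eqxx.
Qed.

Lemma nr_mulmx m n p (x : 'M[C]_(m, n)) (y : 'M[C]_(n, p)) :
  nr (x *m y) <= n%:R * (nr x * nr y).
Proof.
have h0 : 0 <= nr x * nr y by rewrite mulr_ge0 ?nr_ge0.
apply: nr_mx_le => [|i j]; first by rewrite mulr_ge0.
rewrite mxE; apply: (le_trans (nr_sum _ _ _)).
rewrite -[X in X%:R * _]card_ord mulr_natl -sumr_const.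
apply: ler_sum => k _; rewrite nrM.
by apply: ler_pM; rewrite ?nr_ge0 ?nr_coord.
Qed.

(** Completeness in the only form used below: a sequence whose steps decrease
    geometrically converges, at the rate of the tail of the geometric series.
    The limit is found one real coordinate at a time, as a supremum. *)
Lemma geometric_cvg_real (a : nat -> R) (c : R) :
  (forall n, `|a n.+1 - a n| <= c / 2 ^+ n) ->
  exists b, forall n, `|a n - b| <= 2 * c / 2 ^+ n.
Proof.
move=> h; pose u n := a n - 2 * c / 2 ^+ n; pose v n := a n + 2 * c / 2 ^+ n.
have c0 : 0 <= c by have := h 0%N; rewrite expr0 divr1; apply: le_trans.
have e0 n : 0 <= c / 2 ^+ n by rewrite divr_ge0 // exprn_ge0.
have half n : c / 2 ^+ n.+1 = (c / 2 ^+ n) / 2 by rewrite exprS invfM mulrA mulrAC.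
have uE n : u n = a n - 2 * (c / 2 ^+ n) by rewrite /u mulrA.
have vE n : v n = a n + 2 * (c / 2 ^+ n) by rewrite /v mulrA.
have uS n : u n <= u n.+1.
  by have := h n; rewrite ler_norml => /andP[h1 h2]; rewrite !uE half; lra.
have vS n : v n.+1 <= v n.
  by have := h n; rewrite ler_norml => /andP[h1 h2]; rewrite !vE half; lra.
have um m n : (m <= n)%N -> u m <= u n.
  by move=> /subnK <-; elim: (n - m)%N => // k /le_trans; apply; exact: uS.
have vm m n : (m <= n)%N -> v n <= v m.
  by move=> /subnK <-; elim: (n - m)%N => // k; apply: le_trans; exact: vS.
have uv m n : u m <= v n.
  have [mn|/ltnW nm] := leqP m n.
    by apply: (le_trans (um _ _ mn)); have := e0 n; rewrite uE vE; lra.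
  by apply: (le_trans _ (vm _ _ nm)); have := e0 m; rewrite uE vE; lra.
have ubv n : ubound [set u m | m in [set: nat]] (v n) by move=> _ [m _ <-].
(* The intervals [u n, v n] are nested, and the limit lies in all of them. *)
exists (sup [set u m | m in [set: nat]]) => n.
have h1 : u n <= sup [set u m | m in [set: nat]].
  by apply: ub_le_sup; [exists (v n) | exists n].
have h2 : sup [set u m | m in [set: nat]] <= v n.
  by apply: ge_sup => //; exists (u 0%N), 0%N.
by rewrite ler_norml; rewrite /u /v in h1 h2; lra.
Qed.

Lemma geometric_cvg m n (a : nat -> 'M[C]_(m, n)) (c : R) :
  (forall k, nr (a k.+1 - a k) <= c / 2 ^+ k) ->
  exists b, forall k, nr (a k - b) <= 4 * c / 2 ^+ k.
Proof.
move=> h.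
have c0 : 0 <= c.
  by have := h 0%N; rewrite expr0 divr1; apply: le_trans; exact: nr_ge0.
have hij i j : exists z : C, forall k, nr (a k i j - z) <= 4 * c / 2 ^+ k.
  have hk k : nr (a k.+1 i j - a k i j) <= c / 2 ^+ k.
    by apply: le_trans (h k); have := nr_coord (a k.+1 - a k) i j; rewrite !mxE.
  have [x hx] : exists x, forall k, `|complex.Re (a k i j) - x| <= 2 * c / 2 ^+ k.
    apply: geometric_cvg_real => k; apply: le_trans (hk k).
    by apply: le_trans (nr_Re _); case: (a k.+1 i j); case: (a k i j).
  have [y hy] : exists y, forall k, `|complex.Im (a k i j) - y| <= 2 * c / 2 ^+ k.
    apply: geometric_cvg_real => k; apply: le_trans (hk k).
    by apply: le_trans (nr_Im _); case: (a k.+1 i j); case: (a k i j).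
  exists (x +i* y) => k; apply: (le_trans (nr_ReIm _)).
  move: (hx k) (hy k); case: (a k i j) => p q /=; lra.
have {}hij i : exists z : 'I_n -> C, forall j k, nr (a k i j - z j) <= 4 * c / 2 ^+ k.
  by have [f hf] := choice (hij i); exists f.
have [f hf] := choice hij.
exists (\matrix_(i, j) f i j) => k; apply: nr_mx_le.
  by rewrite divr_ge0 ?exprn_ge0 ?mulr_ge0.
by move=> i j; rewrite !mxE.
Qed.

Lemma pow2_gt (x : R) : exists n, x < 2 ^+ n.
Proof.
have [n hn] : exists n, x < n%:R.
  exists (Num.truncn x).+1; have [x0|x0] := leP 0 x.
    by have /andP[] := truncn_itv x0.
  by apply: (lt_le_trans x0).
exists n; apply: (lt_trans hn); rewrite -natrX ltr_nat; exact: ltn_expl.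
Qed.

Lemma le_geometric (x y c : R) : (forall n, x <= y + c / 2 ^+ n) -> x <= y.
Proof.
move=> h; rewrite leNgt; apply/negP => xy.
have [n hn] := pow2_gt (c / (x - y)).
have p0 : 0 < (2 : R) ^+ n by rewrite exprn_gt0.
have d0 : 0 < x - y by rewrite subr_gt0.
have := h n; rewrite leNgt => /negP; apply.
by rewrite -ltrBrDl ltr_pdivrMr // mulrC -ltr_pdivrMr.
Qed.

(** The mean value inequality for a curve that is only known to be, near each
    point, Lipschitz up to epsilon with respect to that point. *)
Lemma mean_value (V : normedModType C) (phi : R -> V) (a : R) :
  (forall t, 0 <= t <= 1 -> forall e, 0 < e -> exists2 d, 0 < d &
    forall s, 0 <= s <= 1 -> `|s - t| < d ->
    nr (phi s - phi t) <= (a + e) * `|s - t|) ->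
  0 <= a -> nr (phi 1 - phi 0) <= a.
Proof.
move=> h a0; apply/ler_addgt0Pr => e e0.
(* The supremum t of the times at which the bound with slope a + e holds is one
   of them, and can be exceeded unless it is 1. *)
pose S := [set t : R | 0 <= t <= 1 /\ nr (phi t - phi 0) <= (a + e) * t].
have S0 : S 0 by split; [rewrite lexx ler01 | rewrite subrr nr0 mulr0].
have Sub : ubound S 1 by move=> t [/andP[_ ->]].
have hs : has_sup S by split; [exists 0 | exists 1].
pose t := sup S.
have t01 : 0 <= t <= 1.
  by apply/andP; split; [apply: ub_le_sup => //; exists 1 | apply: ge_sup => //; exists 0].
have [d d0 hd] := h t t01 e e0.
have ae : 0 < a + e by rewrite ltr_wpDl.
have St : S t.
  split=> //; have [s Ss ts] : exists2 s, S s & t - d < s by apply: sup_adherent.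
  have st : s <= t by apply: ub_le_sup => //; exists 1.
  have [s01 hs1] := Ss.
  have := hd s s01; rewrite ler0_norm ?subr_le0 // nrB => /(_ ltac:(lra)) h1.
  by apply: (le_trans (nr_tri (phi s) _ _)); nra.
have [t1|t1] := eqVneq t 1; first by case: St => _; rewrite t1 mulr1.
have {}t1 : t < 1 by rewrite lt_neqAle t1; case/andP: t01.
pose s := Num.min 1 (t + d / 2).
have ts : t < s by rewrite /s lt_min t1 /=; lra.
have s01 : 0 <= s <= 1.
  by apply/andP; split; [case/andP: t01; lra | rewrite /s ge_min lexx].
have sd : s <= t + d / 2 by rewrite /s ge_min lexx orbT.
have : S s.
  split=> //; have := hd s s01; rewrite gtr0_norm ?subr_gt0 // => /(_ ltac:(lra)) h1.
  by case: St => _ h2; apply: (le_trans (nr_tri (phi t) _ _)); nra.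
by move=> Ss; have : s <= t by [apply: ub_le_sup => //; exists 1]; rewrite leNgt ts.
Qed.

End RealNorm.

(** * Differentiability read with the real-valued norm *)

(** R[i], as a normed module over itself, is what the instance on matrices asks
    of the entries. *)
HB.instance Definition _ (R : realType) := NormedModule.copy R[i] R[i]^o.

Section Derivatives.
Context {R : realType}.
Local Notation C := R[i].

Lemma differentiable_nr (V W : normedModType C) (f : V -> W) (x : V) :
  differentiable f x -> forall e : R, 0 < e -> exists2 d : R, 0 < d &
    forall y, nr (y - x) < d ->
      nr (f y - f x - 'd f x (y - x)) <= e * nr (y - x).
Proof.
move=> /diff_locally /eqaddoP h e e0.
have /h : 0 < e%:C :> C by rewrite ltcR.
rewrite nearE => /nbhs_nr [d d0 hd]; exists d => // y hy.
have := hd (y - x); rewrite subr0 => /(_ hy) /=.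
rewrite !fctE /= subrK !nrE -rmorphM /= lecR.
by rewrite opprD addrA.
Qed.

Lemma is_diff_nr (V W : normedModType C) (f : V -> W) (x : V)
    (df : {linear V -> W}) : continuous df ->
  (forall e : R, 0 < e -> exists2 d : R, 0 < d &
    forall y, nr (y - x) < d -> nr (f y - f x - df (y - x)) <= e * nr (y - x)) ->
  is_diff x f df.
Proof.
move=> cdf h.
have hf : f \o shift x = cst (f x) + df +o_ 0 id.
  apply/eqaddoP => e e0; rewrite nearE; apply/nbhs_nr.
  have e0' : 0 < complex.Re e by move: e0; rewrite ltcE /= => /andP[].
  have eE : e = (complex.Re e)%:C.
    by move: e0; rewrite ltcE /= => /andP[/eqP]; case: (e) => a b /= ->.
  have [d d0 hd] := h _ e0'; exists d => // y; rewrite subr0 => hy.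
  have := hd (y + x); rewrite addrK => /(_ hy).
  by rewrite eE !fctE /= !nrE -rmorphM /= lecR opprD addrA.
have dE := diff_unique cdf hf; split => //.
by apply/diff_locallyP; rewrite dE.
Qed.

Lemma continuous_mulmxr d m (J : 'M[C]_(d, m)) :
  continuous (mulmxr J : 'rV[C]_d -> 'rV[C]_m).
Proof.
move=> x P /nbhs_nr [e e0 he]; apply/nbhs_nr.
have k0 : 0 < d%:R * nr J + 1 by rewrite ltr_wpDl ?mulr_ge0 ?nr_ge0.
exists (e / (d%:R * nr J + 1)); first by rewrite divr_gt0.
move=> y; rewrite ltr_pdivlMr // => hy; apply: he => /=.
rewrite -mulmxBl; apply: le_lt_trans hy; apply: (le_trans (nr_mulmx _ _)).
by rewrite mulrDr mulr1 mulrCA ler_wpDr ?nr_ge0.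
Qed.

Lemma quadratic_is_diff d m (f : 'rV[C]_d -> 'rV[C]_m) (x : 'rV[C]_d)
    (J : 'M[C]_(d, m)) (k e : R) : 0 < e ->
  (forall y, nr (y - x) < e ->
     nr (f y - f x - (y - x) *m J) <= k * nr (y - x) ^+ 2) ->
  differentiable f x /\ (forall v, 'D_v f x = v *m J).
Proof.
move=> e0 h.
suff [h1 h2] : is_diff x f (mulmxr J).
  by split=> // v; rewrite deriveE // h2.
apply: is_diff_nr; first exact: continuous_mulmxr.
move=> a a0; pose k' := `|k| + 1.
have k0 : 0 < k' by rewrite /k' ltr_wpDl.
exists (Num.min e (a / k')); first by rewrite lt_min e0 divr_gt0.
move=> y; rewrite lt_min ltr_pdivlMr // => /andP[h1 h2] /=.
apply: (le_trans (h _ h1)); have := nr_ge0 (y - x).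
have : k <= k' by rewrite /k'; have := ler_norm k; lra.
set t := nr _ in h2 *; nra.
Qed.

Lemma jacobianE d m (f : 'rV[C]_d -> 'rV[C]_m) x (J : 'M[C]_(d, m)) :
  differentiable f x -> (forall v, 'D_v f x = v *m J) -> 'J f x = J.
Proof.
move=> df h; apply/row_matrixP => i; rewrite !rowE.
by rewrite -deriveEjacobian // h.
Qed.

Lemma derive_coord (V : normedModType C) m n (f : V -> 'M[C]_(m, n)) x v i j :
  differentiable f x -> 'D_v f x i j = 'D_v (fun y => f y i j) x.
Proof.
move=> df; have dc := differentiable_coord (f x) i j.
rewrite !deriveE //; last exact: (differentiable_comp df dc).
rewrite (diff_comp df dc) /=.
have @L : {linear 'M[C]_(m, n) -> C}.
  by exists (fun N : 'M[C]_(_, _) => N i j); do 2![eexists]; do ?[constructor];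
     rewrite ?mxE// => ? *; rewrite ?mxE//; move=> ?; rewrite !mxE.
have hL : continuous L by exact: coord_continuous.
by rewrite (diff_lin (f x) hL).
Qed.

End Derivatives.

(** * The mean value inequality and the symmetry of second derivatives *)

Section Smooth.
Context {R : realType}.
Local Notation C := R[i].

(** A derivative with respect to a real time: the curves are restrictions of maps
    of complex variables to real segments. *)
Definition path_deriv m n (phi : R -> 'M[C]_(m, n)) (t : R) (c : 'M[C]_(m, n)) :=
  forall e : R, 0 < e -> exists2 d : R, 0 < d & forall s, `|s - t| < d ->
    nr (phi s - phi t - (s - t)%:C *: c) <= e * `|s - t|.

Lemma path_deriv_line (V : normedModType C) m n (f : V -> 'M[C]_(m, n)) (p q : V)
    (t : R) : differentiable f (p + t%:C *: q) ->
  path_deriv (fun s => f (p + s%:C *: q)) t ('D_q f (p + t%:C *: q)).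
Proof.
move=> df e e0; have k0 : 0 < nr q + 1 by rewrite ltr_wpDl ?nr_ge0.
have [d d0 hd] := differentiable_nr df (divr_gt0 e0 k0).
exists (d / (nr q + 1)); first by rewrite divr_gt0.
move=> s; rewrite ltr_pdivlMr // => hs.
have dE : p + s%:C *: q - (p + t%:C *: q) = (s - t)%:C *: q.
  by rewrite opprD addrACA subrr add0r -scalerBl rmorphB.
have := hd (p + s%:C *: q); rewrite dE nrZ nrR linearZ deriveE //.
have h0 : `|s - t| * nr q <= `|s - t| * (nr q + 1) by rewrite ler_wpM2l // lerDl.
move=> /(_ (le_lt_trans h0 hs)) h1; apply: (le_trans h1).
have q1 : nr q / (nr q + 1) <= 1 by rewrite ler_pdivrMr // mul1r lerDl.
have -> : e / (nr q + 1) * (`|s - t| * nr q) =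
  e * `|s - t| * (nr q / (nr q + 1)) by ring.
by rewrite ler_piMr // mulr_ge0 // ltW.
Qed.

Lemma path_derivB m n (phi psi : R -> 'M[C]_(m, n)) t c c' :
  path_deriv phi t c -> path_deriv psi t c' ->
  path_deriv (fun s => phi s - psi s) t (c - c').
Proof.
move=> h1 h2 e e0; have e20 : 0 < e / 2 by rewrite divr_gt0.
have [d1 d10 hd1] := h1 _ e20; have [d2 d20 hd2] := h2 _ e20.
exists (Num.min d1 d2); first by rewrite lt_min d10.
move=> s; rewrite lt_min => /andP[/hd1 g1 /hd2 g2].
have -> : phi s - psi s - (phi t - psi t) - (s - t)%:C *: (c - c') =
  (phi s - phi t - (s - t)%:C *: c) - (psi s - psi t - (s - t)%:C *: c').
  by apply/matrixP => i j; rewrite !mxE; ring.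
apply: (@le_trans _ _ (e / 2 * `|s - t| + e / 2 * `|s - t|)).
  by apply: nrD_le => //; rewrite nrN.
by rewrite -mulrDl -splitr.
Qed.

(** The mean value inequality, in the form comparing an increment with a
    prescribed vector b; b = 0 gives Lipschitz bounds, and a derivative at an
    end point gives second order Taylor estimates. *)
Lemma path_mean_value m n (phi : R -> 'M[C]_(m, n)) (b : 'M[C]_(m, n)) (a : R) :
  0 <= a -> (forall t, 0 <= t <= 1 -> exists2 c, path_deriv phi t c & nr (c - b) <= a) ->
  nr (phi 1 - phi 0 - b) <= a.
Proof.
move=> a0 h; pose psi (s : R) := phi s - s%:C *: b.
have -> : phi 1 - phi 0 - b = psi 1 - psi 0.
  by apply/matrixP => i j; rewrite /psi !mxE /= rmorph0 rmorph1; ring.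
apply: mean_value => // t t01 e e0; have [c hc cb] := h t t01.
have [d d0 hd] := hc e e0; exists d => // s _ /hd hs.
have -> : psi s - psi t =
    (s - t)%:C *: (c - b) + (phi s - phi t - (s - t)%:C *: c).
  by apply/matrixP => i j; rewrite /psi !mxE /= rmorphB; ring.
rewrite mulrDl; apply: nrD_le => //.
by rewrite nrZ nrR mulrC ler_wpM2r.
Qed.

Lemma deriveZdir (V W : normedModType C) (f : V -> W) x (a : C) v :
  differentiable f x -> 'D_(a *: v) f x = a *: 'D_v f x.
Proof. by move=> df; rewrite !deriveE // linearZ. Qed.

Lemma derive_sumdir d (W : normedModType C) (f : 'rV[C]_d -> W) x (v : 'rV[C]_d) :
  differentiable f x ->
  'D_v f x = \sum_q v 0 q *: 'D_(delta_mx 0 q) f x.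
Proof.
move=> df; rewrite deriveE // {1}(row_sum_delta v) linear_sum.
by apply: eq_bigr => q _; rewrite linearZ deriveE.
Qed.

Lemma mean_value_diff d m n (f : 'rV[C]_d -> 'M[C]_(m, n)) x y b (a : R) :
  0 <= a ->
  (forall t : R, 0 <= t <= 1 -> differentiable f (x + t%:C *: (y - x)) /\
    nr ('D_(y - x) f (x + t%:C *: (y - x)) - b) <= a) ->
  nr (f y - f x - b) <= a.
Proof.
move=> a0 h; pose phi (t : R) := f (x + t%:C *: (y - x)).
have -> : f y = phi 1 by rewrite /phi rmorph1 scale1r addrC subrK.
have -> : f x = phi 0 by rewrite /phi rmorph0 scale0r addr0.
apply: path_mean_value => // t /h [df hd]; eexists; last exact: hd.
exact: path_deriv_line.
Qed.

(** The second difference of f is approximated by either mixed derivative,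
    whence their equality. *)
Lemma second_difference d m n (f : 'rV[C]_d -> 'M[C]_(m, n)) (x v w : 'rV[C]_d)
    (U : set 'rV[C]_d) : open U -> U x -> (forall z, U z -> differentiable f z) ->
  differentiable ('D_v f) x -> forall e : R, 0 < e -> exists2 d : R, 0 < d &
  forall t : R, 0 < t < d ->
   nr (f (x + t%:C *: w + t%:C *: v) - f (x + t%:C *: v) - f (x + t%:C *: w) + f x
     - (t ^+ 2)%:C *: 'D_w ('D_v f) x) <= e * t ^+ 2.
Proof.
move=> oU Ux dfU dv e e0; set c := 'D_w ('D_v f) x.
have cE : c = 'd ('D_v f) x w by exact: deriveE.
pose k := nr v + nr w + 1.
have v0 := nr_ge0 v; have w0 := nr_ge0 w.
have k0 : 0 < k by rewrite /k; lra.
have e1 : 0 < e / (2 * k) by rewrite divr_gt0 // mulr_gt0.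
have [d1 d10 hd1] := differentiable_nr dv e1.
have [d2 d20 hd2] := (open_nr U).1 oU x Ux.
exists (Num.min d1 d2 / k); first by rewrite divr_gt0 // lt_min d10.
move=> t /andP[t0]; rewrite ltr_pdivlMr // lt_min => /andP[td1 td2].
pose T (b : bool) := if b then t%:C *: w else 0.
pose z (b : bool) (s : R) := (x + T b) + s%:C *: (t%:C *: v).
have zx b s : z b s - x = T b + s%:C *: (t%:C *: v).
  by apply/matrixP => i j; rewrite /z !mxE; ring.
have small s b : 0 <= s <= 1 -> nr (z b s - x) <= t * k.
  move=> /andP[s0 s1]; rewrite zx.
  apply: (@le_trans _ _ (t * nr w + t * nr v)).
    apply: nrD_le; last first.
      by rewrite !nrZ !nrR (ger0_norm s0) (gtr0_norm t0) ler_piMl // mulr_ge0 // ltW.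
    by rewrite /T; case: b; rewrite ?nr0 ?nrZ ?nrR ?gtr0_norm // mulr_ge0 // ltW.
  by rewrite /k; nra.
have Uz b s : 0 <= s <= 1 -> U (z b s).
  by move=> hs; apply: hd2; apply: le_lt_trans td2; apply: small.
have dz b s : 0 <= s <= 1 ->
    nr ('D_v f (z b s) - 'D_v f x - 'd ('D_v f) x (z b s - x)) <= e / 2 * t.
  move=> hs; have h := small s b hs.
  apply: (le_trans (hd1 _ (le_lt_trans h td1))).
  apply: (@le_trans _ _ (e / (2 * k) * (t * k))); first by rewrite ler_wpM2l // ltW.
  rewrite le_eqVlt; apply/orP; left; apply/eqP; field.
  by rewrite gt_eqF.
have aux (A B X Y Z : 'M[C]_(m, n)) : t%:C *: A - t%:C *: B - (t ^+ 2)%:C *: Z =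
    t%:C *: ((A - X - (Y + t%:C *: Z)) - (B - X - Y)).
  by apply/matrixP => i j; rewrite !mxE rmorphXn /=; ring.
(* The second difference is phi 1 - phi 0, and phi' is t^2 c up to e t^2, as the
   difference of two values of the derivative of f along v. *)
pose phi s := f (z true s) - f (z false s).
have -> : f (x + t%:C *: w + t%:C *: v) - f (x + t%:C *: v) - f (x + t%:C *: w) +
    f x - (t ^+ 2)%:C *: c = phi 1 - phi 0 - (t ^+ 2)%:C *: c.
  rewrite /phi /z /T !rmorph1 !rmorph0 !scale1r !scale0r !addr0.
  by apply/matrixP => i j; rewrite !mxE; ring.
apply: path_mean_value; first by rewrite mulr_ge0 ?exprn_ge0 // ltW.
move=> s hs; eexists.
  by apply: path_derivB; apply: path_deriv_line; apply: dfU; apply: Uz.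
rewrite -!/(z _ _) !deriveZdir; try exact/dfU/Uz.
have -> : t%:C *: 'D_v f (z true s) - t%:C *: 'D_v f (z false s) - (t ^+ 2)%:C *: c =
    t%:C *: (('D_v f (z true s) - 'D_v f x - 'd ('D_v f) x (z true s - x)) -
            ('D_v f (z false s) - 'D_v f x - 'd ('D_v f) x (z false s - x))).
  have -> : z true s - x = (z false s - x) + t%:C *: w.
    by rewrite !zx /T add0r addrC.
  have -> : 'd ('D_v f) x (z false s - x + t%:C *: w) =
    'd ('D_v f) x (z false s - x) + t%:C *: c by rewrite cE linearD linearZ.
  exact: aux.
rewrite nrZ nrR gtr0_norm // expr2 mulrCA; apply: ler_wpM2l; first exact: ltW.
have -> : e * t = e / 2 * t + e / 2 * t by rewrite -mulrDl -splitr.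
by apply: nrD_le; rewrite ?nrN; apply: dz.
Qed.

Lemma quadratic_limit_unique m n (q : R -> 'M[C]_(m, n)) a b :
  (forall e : R, 0 < e -> exists2 d : R, 0 < d & forall t : R, 0 < t < d ->
     nr (q t - (t ^+ 2)%:C *: a) <= e * t ^+ 2) ->
  (forall e : R, 0 < e -> exists2 d : R, 0 < d & forall t : R, 0 < t < d ->
     nr (q t - (t ^+ 2)%:C *: b) <= e * t ^+ 2) ->
  a = b.
Proof.
move=> ha hb; apply/eqP; rewrite -subr_eq0 -nr_eq0.
rewrite eq_le nr_ge0 andbT; apply/ler_addgt0Pr => e e0; rewrite add0r.
have e20 : 0 < e / 2 by rewrite divr_gt0.
have [d1 d10 hd1] := ha _ e20; have [d2 d20 hd2] := hb _ e20.
pose t := Num.min d1 d2 / 2.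
have m0 : 0 < Num.min d1 d2 by rewrite lt_min d10.
have t0 : 0 < t by rewrite divr_gt0.
have tm : t < Num.min d1 d2 by rewrite /t; lra.
move: tm; rewrite lt_min => /andP[t1 t2].
have /hd1 h1 : 0 < t < d1 by rewrite t0.
have /hd2 h2 : 0 < t < d2 by rewrite t0.
rewrite nrB in h1.
have := nrD_le h1 h2; rewrite -mulrDl -splitr.
rewrite (_ : _ + _ = (t ^+ 2)%:C *: (a - b)); last first.
  by apply/matrixP => i j; rewrite !mxE; ring.
have t20 : 0 < t ^+ 2 by rewrite exprn_gt0.
by rewrite nrZ nrR (gtr0_norm t20) mulrC (ler_pM2r t20).
Qed.

(** The second difference is symmetric in v and w. *)
Lemma derive_sym d m n (f : 'rV[C]_d -> 'M[C]_(m, n)) (x v w : 'rV[C]_d)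
    (U : set 'rV[C]_d) : open U -> U x -> (forall z, U z -> differentiable f z) ->
  differentiable ('D_v f) x -> differentiable ('D_w f) x ->
  'D_w ('D_v f) x = 'D_v ('D_w f) x.
Proof.
move=> oU Ux dfU dv dw.
apply: (quadratic_limit_unique (second_difference w oU Ux dfU dv)).
have h := second_difference v oU Ux dfU dw.
move=> e /h [d' d'0 hd]; exists d' => // t /hd.
rewrite (addrAC x) (_ : forall A B D E : 'M[C]_(m, n), A - B - D + E = A - D - B + E) //.
by move=> A B D E; rewrite (addrAC A).
Qed.

End Smooth.

(** * Maps with a Lipschitz derivative *)

Section C11.
Context {R : realType}.
Local Notation C := R[i].

Lemma le_eq_trans (a b c : R) : a = b -> b <= c -> a <= c.
Proof. by move->. Qed.

(** Maps with a Lipschitz derivative g, witnessed by quadratic Taylor estimates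
    with uniform constants near x0.  Two continuous derivatives give this
    regularity; it is inherited by sums, products, composites and local inverses,
    and it is enough for vector fields to have differentiable flows. *)
Definition c11_on d (x0 : 'rV[C]_d) (f : 'rV[C]_d -> C) (g : 'rV[C]_d -> 'cV[C]_d)
    (e k : R) : Prop :=
  [/\ 0 < e, 0 <= k & forall x y, nr (x - x0) < e -> nr (y - x0) < e ->
    [/\ nr (f x) <= k, nr (g x) <= k, nr (f y - f x) <= k * nr (y - x),
        nr (f y - f x - ((y - x) *m g x) 0 0) <= k * nr (y - x) ^+ 2 &
        nr (g y - g x) <= k * nr (y - x)]].

Definition c11 d (x0 : 'rV[C]_d) (f : 'rV[C]_d -> C) : Prop :=
  exists g e k, c11_on x0 f g e k.

Lemma c11_onW d (x0 : 'rV[C]_d) f g e k e' k' : c11_on x0 f g e k ->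
  0 < e' -> e' <= e -> k <= k' -> c11_on x0 f g e' k'.
Proof.
move=> [e0 k0 h] e'0 ee kk; split=> //; first exact: le_trans kk.
move=> x y hx hy; have [h1 h2 h3 h4 h5] := h x y (lt_le_trans hx ee) (lt_le_trans hy ee).
have n0 := nr_ge0 (y - x); have n20 : 0 <= nr (y - x) ^+ 2 by rewrite exprn_ge0.
split; [exact: le_trans kk | exact: le_trans kk| | | ];
  by [apply: le_trans h3 _; rewrite ler_wpM2r | apply: le_trans h4 _; rewrite ler_wpM2r
     | apply: le_trans h5 _; rewrite ler_wpM2r].
Qed.

Lemma c11_on2 d (x0 : 'rV[C]_d) f1 f2 : c11 x0 f1 -> c11 x0 f2 ->
  exists g1 g2 e k, c11_on x0 f1 g1 e k /\ c11_on x0 f2 g2 e k.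
Proof.
move=> [g1 [e1 [k1 h1]]] [g2 [e2 [k2 h2]]].
exists g1, g2, (Num.min e1 e2), (Num.max k1 k2).
have m0 : 0 < Num.min e1 e2 by rewrite lt_min; case: h1 => ->; case: h2 => ->.
by split; [apply: (c11_onW h1) | apply: (c11_onW h2)];
  rewrite // ?ge_min ?le_max lexx ?orbT.
Qed.

Lemma c11_cst d (x0 : 'rV[C]_d) (a : C) : c11 x0 (fun=> a).
Proof.
exists (fun=> 0), 1, (nr a); split=> //; first exact: nr_ge0.
move=> x y _ _; have n0 := nr_ge0 (y - x); have a0 := nr_ge0 a.
rewrite mulmx0 mxE !subrr !nr0; split=> //; rewrite ?mulr_ge0 ?exprn_ge0 //.
Qed.

Lemma c11_coord d (x0 : 'rV[C]_d) (j : 'I_d) : c11 x0 (fun x => x 0 j).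
Proof.
pose D := delta_mx j 0 : 'cV[C]_d; have x00 := nr_ge0 x0; have D0 := nr_ge0 D.
exists (fun=> D), 1, (nr x0 + nr D + 1); split=> //; first lra.
move=> x y hx hy; have n0 := nr_ge0 (y - x).
have E z : (z *m D) 0 0 = z 0 j.
  by rewrite -colE mxE.
rewrite E !mxE !subrr !nr0; split=> //; rewrite ?mulr_ge0 ?exprn_ge0 //; try lra.
  have := nr_coord (x - x0) 0 j; have := nr_coord x0 0 j; rewrite !mxE => h1 h2.
  rewrite -(subrK (x0 0 j) (x 0 j)).
  apply: (le_trans (nrD _ _)); lra.
have := nr_coord (y - x) 0 j; rewrite !mxE => h; apply: (le_trans h).
nra.
Qed.

Lemma c11D d (x0 : 'rV[C]_d) f1 f2 : c11 x0 f1 -> c11 x0 f2 ->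
  c11 x0 (fun x => f1 x + f2 x).
Proof.
move=> h1 h2; have [g1 [g2 [e [k [{}h1 {}h2]]]]] := c11_on2 h1 h2.
exists (fun x => g1 x + g2 x), e, (k + k).
case: h1 => e0 k0 h1; case: h2 => _ _ h2; split=> //; first exact: addr_ge0.
move=> x y hx hy; have [a1 a2 a3 a4 a5] := h1 x y hx hy.
have [b1 b2 b3 b4 b5] := h2 x y hx hy.
split; try exact: nrD_le.
- by rewrite mulrDl opprD addrACA; apply: nrD_le.
- rewrite mulmxDr mxE mulrDl (_ : _ - _ = (f1 y - f1 x - ((y - x) *m g1 x) 0 0) +
    (f2 y - f2 x - ((y - x) *m g2 x) 0 0)); first exact: nrD_le.
  by ring.
- by rewrite mulrDl opprD addrACA; apply: nrD_le.
Qed.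

Lemma c11M d (x0 : 'rV[C]_d) f1 f2 : c11 x0 f1 -> c11 x0 f2 ->
  c11 x0 (fun x => f1 x * f2 x).
Proof.
move=> h1 h2; have [g1 [g2 [e [k [{}h1 {}h2]]]]] := c11_on2 h1 h2.
(* 4 counts the products in the increment of the gradient; d comes from the
   matrix product in the Taylor estimate. *)
exists (fun x => f1 x *: g2 x + f2 x *: g1 x), e, ((4 + d%:R) * k ^+ 2).
case: h1 => e0 k0 h1; case: h2 => _ _ h2; split=> //.
  by rewrite mulr_ge0 ?exprn_ge0 ?addr_ge0.
move=> x y hx hy; have [a1 a2 a3 a4 a5] := h1 x y hx hy.
have [b1 b2 b3 b4 b5] := h2 x y hx hy.
have [a1' _ _ _ _] := h1 y y hy hy; have [b1' _ _ _ _] := h2 y y hy hy.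
have n0 := nr_ge0 (y - x); set t := nr (y - x) in n0 a3 a4 a5 b3 b4 b5 *.
have d0 : 0 <= d%:R :> R by [].
have k2 : 0 <= k ^+ 2 by rewrite exprn_ge0.
have dk : 0 <= d%:R * k ^+ 2 by rewrite mulr_ge0.
have mulle (a b : C) (p q : R) : nr a <= p -> nr b <= q -> nr (a * b) <= p * q.
  by move=> ha hb; rewrite nrM ler_pM ?nr_ge0.
have scle (a : C) (b : 'cV[C]_d) (p q : R) : nr a <= p -> nr b <= q -> nr (a *: b) <= p * q.
  by move=> ha hb; rewrite nrZ ler_pM ?nr_ge0.
have rhs p : (4 + d%:R) * k ^+ 2 * p = 4 * (k ^+ 2 * p) + d%:R * k ^+ 2 * p by ring.
split.
- apply: (le_trans (mulle _ _ _ _ a1 b1)); rewrite -expr2; nra.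
- apply: (le_trans (nrD_le (scle _ _ _ _ a1 b2) (scle _ _ _ _ b1 a2))).
  by rewrite -expr2; nra.
- rewrite (_ : _ - _ = f1 y * (f2 y - f2 x) + (f1 y - f1 x) * f2 x); last by ring.
  apply: (le_trans (nrD_le (mulle _ _ _ _ a1' b3) (mulle _ _ _ _ a3 b1))).
  rewrite rhs; apply: (@le_eq_trans _ (2 * (k ^+ 2 * t))); first by ring.
  by have : 0 <= k ^+ 2 * t; [exact: mulr_ge0 | have := mulr_ge0 dk n0; lra].
- rewrite mulmxDr -!scalemxAr !mxE.
  set D1 := \sum_j _; set D2 := \sum_j _.
  have hD2 : nr D2 <= d%:R * k * t.
    have := nr_coord ((y - x) *m g1 x) 0 0; rewrite mxE => h; apply: (le_trans h).
    apply: (le_trans (nr_mulmx _ _)); rewrite -mulrA ler_wpM2l // mulrC.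
    by rewrite ler_wpM2r.
  rewrite !mxE in a4 b4; rewrite -/D1 in b4; rewrite -/D2 in a4.
  rewrite (_ : _ - _ = (f1 y - f1 x - D2) * f2 y + f1 x * (f2 y - f2 x - D1) +
     D2 * (f2 y - f2 x)); last by ring.
  apply: (le_trans (nrD_le (nrD_le (mulle _ _ _ _ a4 b1') (mulle _ _ _ _ a1 b4))
    (mulle _ _ _ _ hD2 b3))).
  rewrite rhs.
  apply: (@le_eq_trans _ (2 * (k ^+ 2 * t ^+ 2) + d%:R * k ^+ 2 * t ^+ 2)); first by ring.
  by have : 0 <= k ^+ 2 * t ^+ 2; [rewrite mulr_ge0 ?exprn_ge0 | lra].
- rewrite (_ : _ - _ = (f1 y *: (g2 y - g2 x) + (f1 y - f1 x) *: g2 x) +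
    (f2 y *: (g1 y - g1 x) + (f2 y - f2 x) *: g1 x)); last first.
    by apply/matrixP => i j; rewrite !mxE; ring.
  apply: (le_trans (nrD_le (nrD_le (scle _ _ _ _ a1' b5) (scle _ _ _ _ a3 b2))
    (nrD_le (scle _ _ _ _ b1' a5) (scle _ _ _ _ b3 a2)))).
  rewrite rhs; apply: (@le_eq_trans _ (4 * (k ^+ 2 * t))); first by ring.
  by rewrite lerDl mulr_ge0.
Qed.

Lemma c11_sum d (x0 : 'rV[C]_d) (I : Type) (s : seq I) (P : pred I) f :
  (forall i, c11 x0 (f i)) -> c11 x0 (fun x => \sum_(i <- s | P i) f i x).
Proof.
move=> h; elim: s => [|i s ih].
  by rewrite (_ : (fun _ => _) = (fun=> 0)); [exact: c11_cst | apply/funext => x; rewrite big_nil].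
rewrite (_ : (fun _ => _) = (fun x => (if P i then f i x else 0) +
   \sum_(i <- s | P i) f i x)); last first.
  by apply/funext => x; rewrite big_cons; case: (P i); rewrite ?add0r.
by apply: c11D => //; case: (P i); [exact: h | exact: c11_cst].
Qed.

Lemma c11_prod d (x0 : 'rV[C]_d) (I : Type) (s : seq I) f :
  (forall i, c11 x0 (f i)) -> c11 x0 (fun x => \prod_(i <- s) f i x).
Proof.
move=> h; elim: s => [|i s ih].
  by rewrite (_ : (fun _ => _) = (fun=> 1)); [exact: c11_cst | apply/funext => x; rewrite big_nil].
rewrite (_ : (fun _ => _) = (fun x => f i x * \prod_(i <- s) f i x)); last first.
  by apply/funext => x; rewrite big_cons.
exact: c11M.
Qed.

Lemma c11N d (x0 : 'rV[C]_d) f : c11 x0 f -> c11 x0 (fun x => - f x).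
Proof.
move=> h; rewrite (_ : (fun _ => _) = (fun x => -1 * f x)).
  by apply: c11M => //; exact: c11_cst.
by apply/funext => x; rewrite mulN1r.
Qed.

Definition c11mx d m n (x0 : 'rV[C]_d) (f : 'rV[C]_d -> 'M[C]_(m, n)) : Prop :=
  forall i j, c11 x0 (fun x => f x i j).

Lemma c11mx_mul d m n p (x0 : 'rV[C]_d) (f : _ -> 'M[C]_(m, n)) (g : _ -> 'M[C]_(n, p)) :
  c11mx x0 f -> c11mx x0 g -> c11mx x0 (fun x => f x *m g x).
Proof.
move=> hf hg i j; rewrite (_ : (fun _ => _) = (fun x => \sum_k f x i k * g x k j)).
  by apply: c11_sum => k; apply: c11M.
by apply/funext => x; rewrite mxE.
Qed.

Lemma c11mx_cst d m n (x0 : 'rV[C]_d) (a : 'M[C]_(m, n)) : c11mx x0 (fun=> a).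
Proof. by move=> i j; exact: c11_cst. Qed.

Lemma c11_det d n (x0 : 'rV[C]_d) (f : _ -> 'M[C]_n) :
  c11mx x0 f -> c11 x0 (fun x => \det (f x)).
Proof.
move=> hf; apply: c11_sum => s; apply: c11M; first exact: c11_cst.
exact: c11_prod.
Qed.

Lemma c11mx_adj d n (x0 : 'rV[C]_d) (f : _ -> 'M[C]_n) :
  c11mx x0 f -> c11mx x0 (fun x => \adj (f x)).
Proof.
move=> hf i j; rewrite (_ : (fun _ => _) =
  (fun x => (-1) ^+ (j + i) * \det (row' j (col' i (f x))))).
  apply: c11M; first exact: c11_cst.
  apply: c11_det => a b; rewrite (_ : (fun _ => _) = fun x => f x (lift j a) (lift i b)) //.
  by apply/funext => x; rewrite !mxE.
by apply/funext => x; rewrite mxE.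
Qed.

(** Row vectors, with the same constants for all their coordinates. *)
Definition c11v_on d m (x0 : 'rV[C]_d) (f : 'rV[C]_d -> 'rV[C]_m)
    (J : 'rV[C]_d -> 'M[C]_(d, m)) (e k : R) : Prop :=
  [/\ 0 < e, 0 <= k & forall x y, nr (x - x0) < e -> nr (y - x0) < e ->
    [/\ nr (f x) <= k, nr (J x) <= k, nr (f y - f x) <= k * nr (y - x),
        nr (f y - f x - (y - x) *m J x) <= k * nr (y - x) ^+ 2 &
        nr (J y - J x) <= k * nr (y - x)]].

Lemma c11v_exists d m (x0 : 'rV[C]_d) (f : 'rV[C]_d -> 'rV[C]_m) :
  c11mx x0 f -> exists J e k, c11v_on x0 f J e k.
Proof.
move=> h; have /choice [g hg] : forall j, exists t : ('rV[C]_d -> 'cV[C]_d) * R * R,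
    c11_on x0 (fun x => f x 0 j) t.1.1 t.1.2 t.2.
  by move=> j; have [g [e [k hk]]] := h 0 j; exists (g, e, k).
pose e := \big[Num.min/1]_j (g j).1.2; pose k := \sum_j (g j).2.
have k0 j : 0 <= (g j).2 by case: (hg j).
have K0 : 0 <= k by apply: sumr_ge0.
have e0 : 0 < e.
  by rewrite /e; elim/big_ind: _ => // [a b a0 b0|j _]; [rewrite lt_min a0 | case: (hg j)].
have {}hg j : c11_on x0 (fun x => f x 0 j) (g j).1.1 e k.
  apply: (c11_onW (hg j)) => //; first by rewrite /e (bigD1 j) //= ge_min lexx.
  by rewrite /k (bigD1 j) //= lerDl sumr_ge0.
exists (fun x => \matrix_(i, j) (g j).1.1 x i 0), e, k; split=> // x y hx hy.
have n0 := nr_ge0 (y - x); have n20 : 0 <= nr (y - x) ^+ 2 by rewrite exprn_ge0.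
have hh j := let: And3 _ _ H := hg j in H x y hx hy.
split; apply: nr_mx_le; rewrite ?mulr_ge0 // => i j;
  have [a1 a2 a3 a4 a5] := hh j; rewrite ?ord1 //.
- by rewrite mxE; apply: le_trans a2; exact: nr_coord.
- by rewrite 2!mxE.
- move: a4; rewrite !mxE (_ : \sum_k _ = \sum_k (y - x) 0 k *
    (\matrix_(i0, j0) (g j0).1.1 x i0 0) k j) //.
  by apply: eq_bigr => l _; congr (_ * _); rewrite mxE.
- by apply: le_trans a5; have := nr_coord ((g j).1.1 y - (g j).1.1 x) i 0; rewrite !mxE.
Qed.

Lemma c11v_onW d m (x0 : 'rV[C]_d) (f : _ -> 'rV[C]_m) J e k e' k' : c11v_on x0 f J e k ->
  0 < e' -> e' <= e -> k <= k' -> c11v_on x0 f J e' k'.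
Proof.
move=> [e0 k0 h] e'0 ee kk; split=> //; first exact: le_trans kk.
move=> x y hx hy; have [h1 h2 h3 h4 h5] := h x y (lt_le_trans hx ee) (lt_le_trans hy ee).
have n0 := nr_ge0 (y - x); have n20 : 0 <= nr (y - x) ^+ 2 by rewrite exprn_ge0.
split; [exact: le_trans kk | exact: le_trans kk| | | ];
  by [apply: le_trans h3 _; rewrite ler_wpM2r | apply: le_trans h4 _; rewrite ler_wpM2r
     | apply: le_trans h5 _; rewrite ler_wpM2r].
Qed.

Lemma c11v_on_c11 d m (x0 : 'rV[C]_d) (f : _ -> 'rV[C]_m) J e k :
  c11v_on x0 f J e k -> c11mx x0 f.
Proof.
move=> [e0 k0 h] i j; rewrite ord1; exists (fun x => col j (J x)), e, k.
split=> // x y hx hy; have [h1 h2 h3 h4 h5] := h x y hx hy; split.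
- by apply: le_trans h1; exact: nr_coord.
- by apply: le_trans h2; apply: nr_sub_mx (fun i => i) (fun=> j) _ => a b; rewrite mxE.
- by apply: le_trans h3; have := nr_coord (f y - f x) 0 j; rewrite !mxE.
- apply: le_trans h4; have := nr_coord (f y - f x - (y - x) *m J x) 0 j.
  rewrite !mxE (_ : \sum_k _ = \sum_k (y - x) 0 k * col j (J x) k 0) //.
  by apply: eq_bigr => l _; congr (_ * _); rewrite mxE.
- apply: le_trans h5; apply: nr_sub_mx (fun i => i) (fun=> j) _ => a b.
  by rewrite !mxE.
Qed.

Lemma c11_comp d m (x0 : 'rV[C]_d) (h : 'rV[C]_d -> 'rV[C]_m) (f : 'rV[C]_m -> C) :
  c11mx x0 h -> c11 (h x0) f -> c11 x0 (fun x => f (h x)).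
Proof.
move=> /c11v_exists [J [e1 [k1 [e10 k10 h1]]]] [g [e2 [k2 [e20 k20 h2]]]].
have k11 : 0 < k1 + 1 by rewrite ltr_wpDl.
pose e := Num.min e1 (e2 / (k1 + 1)).
have e0 : 0 < e by rewrite lt_min e10 divr_gt0.
have x0in : nr (x0 - x0) < e1 by rewrite subrr nr0.
have he x : nr (x - x0) < e -> nr (x - x0) < e1 /\ nr (h x - h x0) < e2.
  rewrite lt_min ltr_pdivlMr // => /andP[a1 a2]; split=> //.
  have [_ _ a3 _ _] := h1 x0 x x0in a1; apply: (le_lt_trans a3).
  by have := nr_ge0 (x - x0); nra.
exists (fun x => J x *m g (h x)), e, (k2 + m%:R * (k1 * k2) + k2 * k1 + k2 * k1 ^+ 2 +
   m%:R * (k1 * k2) + m%:R * (k2 * k1 * k1)).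
have m0 : 0 <= m%:R :> R by [].
have p1 : 0 <= m%:R * (k1 * k2) by rewrite !mulr_ge0.
have p2 : 0 <= k2 * k1 by rewrite !mulr_ge0.
have p3 : 0 <= k2 * k1 ^+ 2 by rewrite !mulr_ge0 ?exprn_ge0.
have p4 : 0 <= m%:R * (k2 * k1 * k1) by rewrite !mulr_ge0.
split=> //; first lra.
move=> x y /he[hx hx'] /he[hy hy'].
have [a1 a2 a3 a4 a5] := h1 x y hx hy; have [b1 b2 b3 b4 b5] := h2 _ _ hx' hy'.
have [_ a2' _ _ _] := h1 y y hy hy; have [_ b2' _ _ _] := h2 _ _ hy' hy'.
have n0 := nr_ge0 (y - x); set t := nr (y - x) in n0 a3 a4 a5 *.
have u0 := nr_ge0 (h y - h x); set u := nr (h y - h x) in u0 a3 b3 b4 b5 *.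
have n20 : 0 <= t ^+ 2 by rewrite exprn_ge0.
have mulle p q (A : 'M[C]_(p, m)) (B : 'M[C]_(m, q)) (a b : R) : nr A <= a -> nr B <= b ->
    nr (A *m B) <= m%:R * (a * b).
  move=> ha hb; apply: (le_trans (nr_mulmx _ _)); rewrite ler_wpM2l //.
  by rewrite ler_pM ?nr_ge0.
split.
- by apply: (le_trans b1); lra.
- by apply: (le_trans (mulle _ _ _ _ _ _ a2 b2)); lra.
- apply: (le_trans b3); apply: (@le_trans _ _ (k2 * k1 * t)).
    by rewrite -mulrA ler_wpM2l.
  by rewrite ler_wpM2r //; lra.
- have -> : f (h y) - f (h x) - ((y - x) *m (J x *m g (h x))) 0 0 =
     (f (h y) - f (h x) - ((h y - h x) *m g (h x)) 0 0) +
     ((h y - h x - (y - x) *m J x) *m g (h x)) 0 0.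
    rewrite mulmxA (mulmxBl (h y - h x)) [X in _ = _ + X]mxE [X in _ = _ + (_ + X)]mxE.
    by ring.
  apply: (@le_trans _ _ (k2 * k1 ^+ 2 * t ^+ 2 + m%:R * (k1 * k2) * t ^+ 2)).
    apply: nrD_le.
      apply: (le_trans b4); rewrite -mulrA -exprMn ler_wpM2l //.
      by rewrite !expr2; apply: ler_pM.
    apply: (le_trans (nr_coord _ _ _)).
    apply: (le_trans (mulle _ _ _ _ _ _ a4 b2)).
    by rewrite le_eqVlt; apply/orP; left; apply/eqP; ring.
  by rewrite -mulrDl ler_wpM2r //; lra.
- rewrite (_ : _ - _ = (J y - J x) *m g (h y) + J x *m (g (h y) - g (h x))); last first.
    by rewrite mulmxBl mulmxBr addrA subrK.
  have b5' : nr (g (h y) - g (h x)) <= k2 * (k1 * t).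
    by apply: (le_trans b5); rewrite ler_wpM2l.
  apply: (le_trans (nrD_le (mulle _ _ _ _ _ _ a5 b2') (mulle _ _ _ _ _ _ a2 b5'))).
  apply: (@le_eq_trans _ ((m%:R * (k1 * k2) + m%:R * (k2 * k1 * k1)) * t)); first by ring.
  by rewrite ler_wpM2r //; lra.
Qed.

Lemma c11v_diff d m (x0 : 'rV[C]_d) (f : _ -> 'rV[C]_m) J e k x :
  c11v_on x0 f J e k -> nr (x - x0) < e ->
  differentiable f x /\ forall v, 'D_v f x = v *m J x.
Proof.
move=> [e0 k0 h] hx.
have ex0 : 0 < e - nr (x - x0) by rewrite subr_gt0.
apply: (@quadratic_is_diff _ _ _ _ _ _ k _ ex0) => y hy.
have hy' : nr (y - x0) < e by apply: (le_lt_trans (nr_tri x _ _)); lra.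
by have [] := h x y hx hy'.
Qed.

Lemma differentiable_mx (V : normedModType C) m n (f : V -> 'M[C]_(m, n)) x :
  (forall i j, differentiable (fun y => f y i j) x) -> differentiable f x.
Proof.
move=> h; rewrite (_ : f = (fun y => \sum_(i < m) (\sum_(j < n) f y i j *: delta_mx i j))).
  have hs k (F : 'I_k -> V -> 'M[C]_(m, n)) :
      (forall i, differentiable (F i) x) -> differentiable (fun y => \sum_i F i y) x.
    move=> hF; rewrite (_ : (fun y => _) = \sum_i F i); first exact: differentiable_sum.
    by apply/funext => y; rewrite fct_sumE.
  by do 2!apply: (hs) => ?; exact: differentiableZl.
by apply/funext => y; rewrite -matrix_sum_delta.
Qed.

Lemma c11_diff d (x0 : 'rV[C]_d) (f : _ -> C) : c11 x0 f ->
  exists2 e : R, 0 < e & forall x, nr (x - x0) < e -> differentiable f x.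
Proof.
move=> h; pose F x : 'rV[C]_1 := const_mx (f x).
have hF : c11mx x0 F.
  by move=> i j; rewrite (_ : (fun _ => _) = f) //; apply/funext => x; rewrite mxE.
have [J [e [k hk]]] := c11v_exists hF; exists e; first by case: hk.
move=> x hx; have [dF _] := c11v_diff hk hx.
rewrite (_ : f = (fun N : 'rV[C]_1 => N 0 0) \o F); last by apply/funext => y; rewrite /= mxE.
by apply: differentiable_comp => //; exact: differentiable_coord.
Qed.

Lemma finite_nearness (I : finType) (P : I -> R -> Prop) :
  (forall i (a b : R), 0 < a -> a <= b -> P i b -> P i a) ->
  (forall i, exists2 e : R, 0 < e & P i e) -> exists2 e : R, 0 < e & forall i, P i e.
Proof.
move=> mono h; have [e he] := choice (fun i => let: ex_intro2 e a b := h i in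
  ex_intro (fun e => 0 < e /\ P i e) e (conj a b)).
have m0 : 0 < \big[Num.min/1]_i e i.
  by elim/big_ind: _ => // [a b a0 b0|j _]; [rewrite lt_min a0 | case: (he j)].
exists (\big[Num.min/1]_i e i) => // i.
by apply: (mono i _ (e i)); [ | rewrite (bigD1 i) //= ge_min lexx | case: (he i)].
Qed.

Lemma c11mx_diff d m n (x0 : 'rV[C]_d) (f : _ -> 'M[C]_(m, n)) : c11mx x0 f ->
  exists2 e : R, 0 < e & forall x, nr (x - x0) < e -> differentiable f x.
Proof.
move=> h; have [||e e0 he] := @finite_nearness ('I_m * 'I_n)%type (fun ij e => forall x,
    nr (x - x0) < e -> differentiable (fun y => f y ij.1 ij.2) x).
- by move=> ij a b a0 ab hb x hx; apply: hb; apply: lt_le_trans hx ab.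
- by move=> [i j]; exact: c11_diff (h i j).
- by exists e => // x hx; apply: differentiable_mx => i j; exact: (he (i, j)).
Qed.

Lemma c11_neq0 d (x0 : 'rV[C]_d) (f : _ -> C) : c11 x0 f -> f x0 != 0 ->
  exists2 e : R, 0 < e & forall x, nr (x - x0) < e -> f x != 0.
Proof.
move=> [g [e [k [e0 k0 h]]]] f0.
have n0 : 0 < nr (f x0) by rewrite lt_neqAle nr_ge0 eq_sym nr_eq0 f0.
have k10 : 0 < k + 1 by rewrite ltr_wpDl.
exists (Num.min e (nr (f x0) / (k + 1))); first by rewrite lt_min e0 divr_gt0.
move=> x; rewrite lt_min ltr_pdivlMr // => /andP[h1 h2].
have [] := h x0 x _ h1; first by rewrite subrr nr0.
move=> _ _ h3 _ _; apply/eqP => fx; move: h3; rewrite fx sub0r nrN.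
by have := nr_ge0 (x - x0); nra.
Qed.

End C11.

Section SmoothC11.
Context {R : realType}.
Local Notation C := R[i].

Lemma nr_combination d m n (v : 'rV[C]_d) (G : 'I_d -> 'M[C]_(m, n)) (b : R) :
  0 <= b -> (forall q, nr (G q) <= b) -> nr (\sum_q v 0 q *: G q) <= d%:R * (b * nr v).
Proof.
move=> b0 h; apply: (le_trans (nr_sum _ _ _)).
rewrite -[X in X%:R * _]card_ord mulr_natl -sumr_const.
apply: ler_sum => q _; rewrite nrZ mulrC.
by apply: ler_pM; rewrite ?nr_ge0 ?nr_coord.
Qed.

Lemma ball_convex d (x0 x y : 'rV[C]_d) (e t : R) : nr (x - x0) < e -> nr (y - x0) < e ->
  0 <= t <= 1 -> nr (x + t%:C *: (y - x) - x0) < e.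
Proof.
move=> hx hy /andP[t0 t1].
rewrite (_ : _ - x0 = (1 - t)%:C *: (x - x0) + t%:C *: (y - x0)); last first.
  by apply/matrixP => i j; rewrite !mxE rmorphB rmorph1; ring.
apply: (le_lt_trans (nrD _ _)); rewrite !nrZ !nrR !ger0_norm ?subr_ge0 //.
by have [t2|t2] := leP t (1 / 2); nra.
Qed.

Lemma nr_dist d (x0 x y : 'rV[C]_d) (e : R) : nr (x - x0) < e -> nr (y - x0) < e ->
  nr (y - x) <= 2 * e.
Proof.
move=> hx hy; rewrite nrB in hx; have := nr_tri x0 y x; lra.
Qed.

Lemma c11v_intro d m (x0 : 'rV[C]_d) (f : _ -> 'rV[C]_m) J (e k : R) : 0 < e -> 0 <= k ->
  (forall x y, nr (x - x0) < e -> nr (y - x0) < e ->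
    nr (f y - f x - (y - x) *m J x) <= k * nr (y - x) ^+ 2 /\
    nr (J y - J x) <= k * nr (y - x)) ->
  exists k', c11v_on x0 f J e k'.
Proof.
move=> e0 k0 h.
have x0in : nr (x0 - x0) < e by rewrite subrr nr0.
pose G := nr (J x0) + k * e; pose L := d%:R * G + k * (2 * e).
have G0 : 0 <= G by rewrite addr_ge0 ?nr_ge0 // mulr_ge0 // ltW.
have d0 : 0 <= d%:R :> R by [].
have ke : 0 <= k * (2 * e) by rewrite !mulr_ge0 // ltW.
have dG : 0 <= d%:R * G by exact: mulr_ge0.
have L0 : 0 <= L by rewrite addr_ge0.
have hG x : nr (x - x0) < e -> nr (J x) <= G.
  move=> hx; rewrite -(subrK (J x0) (J x)) addrC; apply: nrD_le => //.
  by have [_ h2] := h x0 x x0in hx; apply: (le_trans h2); rewrite ler_wpM2l // ltW.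
have hL x y : nr (x - x0) < e -> nr (y - x0) < e -> nr (f y - f x) <= L * nr (y - x).
  move=> hx hy; rewrite -(subrK ((y - x) *m J x) (f y - f x)) /L mulrDl addrC.
  apply: nrD_le.
    apply: (le_trans (nr_mulmx _ _)); rewrite -mulrA ler_wpM2l // mulrC.
    by rewrite ler_wpM2r ?nr_ge0 // hG.
  have [h1 _] := h x y hx hy; apply: (le_trans h1); rewrite -mulrA ler_wpM2l //.
  by rewrite expr2 ler_wpM2r ?nr_ge0 // (nr_dist hx hy).
have F0 := nr_ge0 (f x0); have Le : 0 <= L * e by rewrite mulr_ge0 // ltW.
exists (nr (f x0) + L * e + G + L + k); split=> //; first lra.
move=> x y hx hy; have [h1 h2] := h x y hx hy; have n0 := nr_ge0 (y - x).
split.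
- apply: (@le_trans _ _ (nr (f x0) + L * e)); last lra.
  rewrite -(subrK (f x0) (f x)) addrC; apply: nrD_le => //.
  by apply: (le_trans (hL _ _ x0in hx)); rewrite ler_wpM2l // ltW.
- by apply: (le_trans (hG x hx)); lra.
- by apply: (le_trans (hL _ _ hx hy)); rewrite ler_wpM2r //; lra.
- by apply: (le_trans h1); rewrite ler_wpM2r ?exprn_ge0 //; lra.
- by apply: (le_trans h2); rewrite ler_wpM2r //; lra.
Qed.

(** Two continuous derivatives bound the first derivatives Lipschitz, hence
    give the second order estimate, through the mean value inequality. *)
Lemma class_C_c11 d m n (U : set 'rV[C]_d) (f : 'rV[C]_d -> 'M[C]_(m, n)) x0 :
  open U -> U x0 -> class_C 2 U f -> c11mx x0 f.
Proof.
move=> oU Ux0 [df h2]; pose D q := 'D_(delta_mx 0 q) f.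
have dD q u : U u -> differentiable (D q) u by case: (h2 (delta_mx 0 q)) => + _; apply.
pose E p := 'D_(delta_mx 0 p.2) (D p.1).
(* By continuity, b bounds all the second partial derivatives near x0. *)
pose b := 1 + \sum_(p : 'I_d * 'I_d) nr (E p x0).
have b0 : 0 <= b by rewrite addr_ge0 // sumr_ge0 // => p _; exact: nr_ge0.
have [||e1 e10 he1] := @finite_nearness R ('I_d * 'I_d)%type (fun p e => forall x,
    nr (x - x0) < e -> nr (E p x) <= b).
- by move=> p a c a0 ac hc x hx; apply: hc; apply: lt_le_trans hx ac.
- move=> [p q]; have [_ /(_ (delta_mx 0 q)) /(_ x0 Ux0) cE] := h2 (delta_mx 0 p).
  have [|e e0 he] := (nbhs_nr x0 [set x | nr (E (p, q) x - E (p, q) x0) < 1]).1.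
    by apply: (cE [set w | nr (w - E (p, q) x0) < 1]); apply/nbhs_nr; exists 1.
  exists e => // x /he /= hx; rewrite -(subrK (E (p, q) x0) (E (p, q) x)).
  apply: nrD_le; first exact: ltW.
  by rewrite (bigD1 (p, q)) //= lerDl sumr_ge0 // => ? _; exact: nr_ge0.
have [e2 e20 he2] := (open_nr U).1 oU x0 Ux0.
pose e := Num.min e1 e2; have e0 : 0 < e by rewrite lt_min e10.
have eU x : nr (x - x0) < e -> U x by rewrite lt_min => /andP[_ /he2].
have eE p x : nr (x - x0) < e -> nr (E p x) <= b by rewrite lt_min => /andP[/he1].
have d0 : 0 <= d%:R :> R by [].
have lip q x y : nr (x - x0) < e -> nr (y - x0) < e ->
    nr (D q y - D q x) <= d%:R * (b * nr (y - x)).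
  move=> hx hy; rewrite -(subr0 (_ - _)).
  apply: mean_value_diff; first by rewrite !mulr_ge0 ?nr_ge0.
  move=> t t01; have hz := ball_convex hx hy t01; split; first exact/dD/eU.
  rewrite subr0 derive_sumdir; last exact/dD/eU.
  by apply: nr_combination => // p; exact: (eE (q, p)).
have quad x y : nr (x - x0) < e -> nr (y - x0) < e ->
    nr (f y - f x - 'D_(y - x) f x) <= d%:R * (d%:R * b) * nr (y - x) ^+ 2.
  move=> hx hy; apply: mean_value_diff; first by rewrite !mulr_ge0 ?exprn_ge0 ?nr_ge0.
  move=> t t01; have hz := ball_convex hx hy t01; split; first exact/df/eU.
  rewrite (derive_sumdir _ (df _ (eU _ hz))) (derive_sumdir _ (df _ (eU _ hx))).
  rewrite -sumrB.
  have -> : \sum_q ((y - x) 0 q *: 'D_(delta_mx 0 q) f (x + t%:C *: (y - x)) -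
      (y - x) 0 q *: 'D_(delta_mx 0 q) f x) =
    \sum_q (y - x) 0 q *: (D q (x + t%:C *: (y - x)) - D q x).
    by apply: eq_bigr => q _; exact/esym/scalerBr.
  rewrite (_ : _ * _ * _ = d%:R * (d%:R * (b * nr (y - x)) * nr (y - x))); last by ring.
  apply: nr_combination; first by rewrite !mulr_ge0 ?nr_ge0.
  move=> q; apply: (le_trans (lip q _ _ hx hz)); rewrite !ler_wpM2l //.
  rewrite addrC addKr nrZ nrR; case/andP: t01 => t0 t1.
  by rewrite ger0_norm // ler_piMl ?nr_ge0.
move=> i j; pose F x : 'rV[C]_1 := const_mx (f x i j).
rewrite (_ : (fun x => f x i j) = (fun x => F x 0 0)); last by apply/funext => x; rewrite mxE.
pose J x : 'M[C]_(d, 1) := \matrix_(q, _) D q x i j.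
have k1 : 0 <= d%:R * (d%:R * b) by rewrite !mulr_ge0.
have k2 : 0 <= d%:R * b by rewrite mulr_ge0.
have [||x y hx hy|k hk] := @c11v_intro _ _ x0 F J e (d%:R * (d%:R * b) + d%:R * b).
- exact: e0.
- exact: addr_ge0.
- split.
    apply: (@le_trans _ _ (d%:R * (d%:R * b) * nr (y - x) ^+ 2)); last first.
      by rewrite ler_wpM2r ?exprn_ge0 ?nr_ge0 // lerDl.
    apply: le_trans (quad x y hx hy); apply: nr_sub_mx (fun=> i) (fun=> j) _ => a c.
    rewrite (derive_sumdir _ (df _ (eU _ hx))) !ord1 !mxE summxE; congr (_ - _).
    by apply: eq_bigr => q _; rewrite !mxE.
  apply: nr_mx_le => [|q c]; first by rewrite mulr_ge0 ?nr_ge0 // addr_ge0.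
  apply: (@le_trans _ _ (nr (D q y - D q x))).
    by have := nr_coord (D q y - D q x) i j; rewrite !mxE.
  by apply: (le_trans (lip q x y hx hy)); rewrite mulrA ler_wpM2r ?nr_ge0 // lerDr.
by have := c11v_on_c11 hk; move=> h; exact: (h 0 0).
Qed.

End SmoothC11.

(** * Local inverses *)

Section LocalInverse.
Context {R : realType}.
Local Notation C := R[i].

(** A perturbation of the identity with Lipschitz constant 1/2 is injective and
    maps every ball onto a neighbourhood of the image of its centre: the
    equation f x = y is solved by the iteration x <- x + (y - f x). *)
Definition half_close d (f : 'rV[C]_d -> 'rV[C]_d) (x0 : 'rV[C]_d) (e : R) : Prop :=
  forall x y, nr (x - x0) < e -> nr (y - x0) < e ->
    nr (f y - f x - (y - x)) <= 2^-1 * nr (y - x).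

Lemma half_close_expand d (f : 'rV[C]_d -> 'rV[C]_d) x0 e x y : half_close f x0 e ->
  nr (x - x0) < e -> nr (y - x0) < e -> nr (y - x) <= 2 * nr (f y - f x).
Proof.
move=> h hx hy; have := h x y hx hy; rewrite nrB => h1.
have := nrD (y - x - (f y - f x)) (f y - f x); rewrite subrK; lra.
Qed.

Lemma half_close_inj d (f : 'rV[C]_d -> 'rV[C]_d) x0 e x y : half_close f x0 e ->
  nr (x - x0) < e -> nr (y - x0) < e -> f x = f y -> x = y.
Proof.
move=> h hx hy fxy; have := half_close_expand h hx hy.
rewrite fxy subrr nr0 mulr0 => /nr_le0 /eqP; rewrite subr_eq0 => /eqP -> //.
Qed.

Lemma half_close_surj d (f : 'rV[C]_d -> 'rV[C]_d) x0 e a c y : half_close f x0 e ->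
  0 < c -> (forall x, nr (x - a) < c -> nr (x - x0) < e) ->
  2 * nr (y - f a) < c -> exists2 x, nr (x - a) < c & f x = y.
Proof.
move=> h c0 hc hy; set D := nr (y - f a) in hy.
have D0 : 0 <= D by exact: nr_ge0.
(* The iterates move by halves of D, so they stay in the ball of radius 2 D. *)
pose x n := iter n (fun x => x + (y - f x)) a.
have hx n : nr (x n - a) <= 2 * D - 2 * D / 2 ^+ n /\ nr (x n.+1 - x n) <= D / 2 ^+ n.
  elim: n => [|n [ih1 ih2]].
    rewrite /x /= subrr nr0 expr0 !divr1 subrr; split=> //.
    by rewrite addrC addKr.
  have p0 : 0 < (2 : R) ^+ n by rewrite exprn_gt0.
  have q0 : 0 <= D / 2 ^+ n by rewrite divr_ge0 // ltW.
  have half : D / 2 ^+ n.+1 = (D / 2 ^+ n) / 2 by rewrite exprS; field; rewrite gt_eqF.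
  have half2 : 2 * D / 2 ^+ n.+1 = D / 2 ^+ n by rewrite exprS; field; rewrite gt_eqF.
  have tw : 2 * D / 2 ^+ n = 2 * (D / 2 ^+ n) by rewrite mulrA.
  have h1 : nr (x n.+1 - a) <= 2 * D - 2 * D / 2 ^+ n.+1.
    by apply: (le_trans (nr_tri (x n) _ _)); rewrite half2; rewrite tw in ih1; lra.
  split=> //; rewrite half.
  have -> : x n.+2 - x n.+1 = - (f (x n.+1) - f (x n) - (x n.+1 - x n)).
    have E k : x k.+1 = x k + (y - f (x k)) by [].
    by rewrite (E n.+1) (E n); apply/matrixP => i j; rewrite !mxE; ring.
  rewrite nrN; apply: (le_trans (h _ _ _ _)).
  - by apply: hc; rewrite tw in ih1; lra.
  - by apply: hc; rewrite half2 in h1; lra.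
  - by rewrite mulrC ler_wpM2r.
have [z hz] := geometric_cvg (fun n => (hx n).2).
have za : nr (z - a) <= 2 * D.
  apply: (@le_geometric _ _ _ (4 * D)) => n; have := nr_tri (x n) z a.
  rewrite (nrB z (x n)); have := hz n; have [h1 _] := hx n.
  have : 0 <= 2 * D / 2 ^+ n by rewrite divr_ge0 ?mulr_ge0 // exprn_ge0.
  lra.
exists z; first exact: le_lt_trans hy.
apply/eqP; rewrite eq_sym -subr_eq0 -nr_eq0 eq_le nr_ge0 andbT.
apply: (@le_geometric _ _ _ (D + 3 / 2 * (4 * D))) => n; rewrite add0r.
have xin : nr (x n - x0) < e.
  apply: hc; have [h1 _] := hx n.
  have : 0 <= 2 * D / 2 ^+ n by rewrite divr_ge0 ?mulr_ge0 // exprn_ge0.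
  lra.
have zin : nr (z - x0) < e by apply: hc; apply: le_lt_trans hy.
have -> : y - f z = (x n.+1 - x n) + ((f (x n) - f z - (x n - z)) + (x n - z)).
  have -> : x n.+1 = x n + (y - f (x n)) by [].
  by apply/matrixP => i j; rewrite !mxE; ring.
rewrite mulrDl; apply: nrD_le; first by have [] := hx n.
have hh := h _ _ zin xin; have hzn := hz n; have := nrD_le hh hzn.
move=> /le_trans; apply.
by rewrite -!mulrA; rewrite -!mulrA in hzn; lra.
Qed.

Lemma half_close_open d (f : 'rV[C]_d -> 'rV[C]_d) x0 e (U : set 'rV[C]_d) :
  half_close f x0 e -> open U -> (forall x, U x -> nr (x - x0) < e) -> open (f @` U).
Proof.
move=> h oU Ue; apply/open_nr => _ [a Ua <-].
have [c c0 hc] := (open_nr U).1 oU a Ua.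
exists (c / 2); first by rewrite divr_gt0.
move=> y hy; have [||x hx <-] := half_close_surj (y := y) h c0 (a := a).
- by move=> x /hc /Ue.
- by lra.
by exists x => //; apply: hc.
Qed.

(** A map that expands distances, up to a factor 2, has a Jacobian without
    kernel. *)
Lemma half_close_free d (f : 'rV[C]_d -> 'rV[C]_d) x0 e x : half_close f x0 e ->
  nr (x - x0) < e -> differentiable f x -> row_free ('J f x).
Proof.
move=> h hx df; apply/row_freeP.
have inj (v : 'rV[C]_d) : v *m 'J f x = 0 -> v = 0.
  rewrite -deriveEjacobian // => hv; apply: nr_le0.
  have [->|v0] := eqVneq v 0; first by rewrite nr0.
  have nv : 0 < nr v by rewrite lt_neqAle nr_ge0 eq_sym nr_eq0 v0.
  have e40 : (0 : R) < 4^-1 by [].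
  have [c c0 hc] := differentiable_nr df e40.
  pose m := Num.min c (e - nr (x - x0)) / 2.
  have m0' : 0 < Num.min c (e - nr (x - x0)) by rewrite lt_min c0 subr_gt0.
  have m0 : 0 < m by rewrite divr_gt0.
  have mlt : m < Num.min c (e - nr (x - x0)) by rewrite /m; lra.
  move: mlt; rewrite lt_min => /andP[m1 m2].
  pose t := m / nr v; have t0 : 0 < t by rewrite divr_gt0.
  have nt : nr (x + t%:C *: v - x) = m.
    by rewrite addrC addKr nrZ nrR gtr0_norm // divfK ?gt_eqF.
  have hy : nr (x + t%:C *: v - x0) < e.
    by apply: (le_lt_trans (nr_tri x _ _)); rewrite nt; lra.
  have := half_close_expand h hx hy; rewrite nt => h1.
  have := hc (x + t%:C *: v); rewrite nt => /(_ m1).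
  rewrite -deriveE // (_ : x + t%:C *: v - x = t%:C *: v); last by rewrite addrC addKr.
  by rewrite deriveZdir // hv scaler0 subr0; lra.
have /row_freeP // : row_free ('J f x).
by rewrite -kermx_eq0; apply/rowV0P => v /sub_kermxP /inj.
Qed.

(** Near x0 the Jacobian is within 1/2 of the identity, so f is a perturbation of
    the identity; the inverse inherits the Taylor estimate of f, multiplied by
    the inverse Jacobian. *)
Lemma c11_local_inverse_id d (f : 'rV[C]_d -> 'rV[C]_d) x0 :
  c11mx x0 f -> (forall v, 'D_v f x0 = v) ->
  exists g e, [/\ c11mx (f x0) g, 0 < e, g (f x0) = x0 &
    forall y, nr (y - f x0) < e -> f (g y) = y].
Proof.
move=> cf dfx; have [J [e1 [k h1]]] := c11v_exists cf.
have [e10 k0 hf] := h1; have x0in1 : nr (x0 - x0) < e1 by rewrite subrr nr0.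
have J1 : J x0 = 1%:M.
  apply/row_matrixP => i; rewrite !rowE; have [_ hD] := c11v_diff h1 x0in1.
  by rewrite -hD dfx mulmx1.
have kk0 : 0 < 2 * (d%:R * k + 2 * k) + 1 by rewrite ltr_wpDl // !(mulr_ge0, addr_ge0).
(* On this radius, the variation of J and the Taylor remainder together are at
   most 1/2. *)
pose e := Num.min e1 (2 * (d%:R * k + 2 * k) + 1)^-1.
have e0 : 0 < e by rewrite lt_min e10 invr_gt0.
have ee1 x : nr (x - x0) < e -> nr (x - x0) < e1 by rewrite lt_min => /andP[].
have x0in : nr (x0 - x0) < e by rewrite subrr nr0.
have eb : (d%:R * k + 2 * k) * e <= 2^-1.
  have : e <= (2 * (d%:R * k + 2 * k) + 1)^-1 by rewrite /e ge_min lexx orbT.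
  rewrite -[X in _ <= X]mul1r ler_pdivlMr // => h2.
  have : 0 <= d%:R * k by rewrite mulr_ge0.
  by move: (ltW e0) h2; set K := d%:R * k + 2 * k; lra.
have hc : half_close f x0 e.
  move=> x y hx hy; have [_ _ _ h4 _] := hf x y (ee1 _ hx) (ee1 _ hy).
  have [_ _ _ _ h5] := hf x0 x x0in1 (ee1 _ hx).
  rewrite (_ : _ - _ = (y - x) *m (J x - J x0) + (f y - f x - (y - x) *m J x)); last first.
    by rewrite J1 mulmxBr mulmx1; apply/matrixP => i j; rewrite !mxE; ring.
  apply: (le_trans (nrD_le (nr_mulmx _ _) h4)).
  have n0 := nr_ge0 (y - x); set t := nr (y - x) in n0 *.
  have t2 : t <= 2 * e by exact: nr_dist hx hy.
  have h6 : nr (J x - J x0) <= k * e.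
    by apply: (le_trans h5); rewrite ler_wpM2l // ltW.
  apply: (@le_trans _ _ ((d%:R * k + 2 * k) * e * t)); last by rewrite ler_wpM2r.
  rewrite mulrDl mulrDl; apply: lerD.
    rewrite -!mulrA ler_wpM2l // mulrC mulrA ler_wpM2r //.
  rewrite expr2 mulrA ler_wpM2r // (_ : 2 * k * e = k * (2 * e)); last by ring.
  by rewrite ler_wpM2l.
pose c := e / 2; have c0 : 0 < c by rewrite divr_gt0.
have surj y : nr (y - f x0) < c -> exists x, nr (x - x0) < e /\ f x = y.
  move=> hy; have [||x hx1 hx2] := half_close_surj (y := y) hc e0 (a := x0); last by exists x.
  - by [].
  - by rewrite /c in hy; lra.
pose g y := if pselect (exists x, nr (x - x0) < e /\ f x = y) is left p
  then projT1 (cid p) else x0.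
have hg y : nr (y - f x0) < c -> nr (g y - x0) < e /\ f (g y) = y.
  by move=> /surj; rewrite /g; case: pselect => // p _; exact: (projT2 (cid p)).
have y0in : nr (f x0 - f x0) < c by rewrite subrr nr0.
have inj := half_close_inj hc; have expd := half_close_expand hc.
have Jfree x : nr (x - x0) < e -> J x \in unitmx.
  move=> hx; rewrite -row_free_unit; have [dx hD] := c11v_diff h1 (ee1 _ hx).
  by rewrite -(jacobianE dx hD); exact: half_close_free hc hx dx.
have Jlow x (v : 'rV[C]_d) : nr (x - x0) < e -> nr (v *m invmx (J x)) <= 2 * nr v.
  move=> hx; have [_ _ _ _ h5] := hf x0 x x0in1 (ee1 _ hx).
  set w := v *m invmx (J x); have vE : v = w *m J x by rewrite mulmxKV // Jfree.
  have : w = v - w *m (J x - J x0) by rewrite mulmxBr -vE J1 mulmx1 opprB addrC subrK.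
  move=> /(congr1 (@nr R _)) wE; have := nrD v (- (w *m (J x - J x0))); rewrite -wE nrN.
  have := nr_mulmx w (J x - J x0).
  have h6 : nr (J x - J x0) <= k * e by apply: (le_trans h5); rewrite ler_wpM2l // ltW.
  have w0 := nr_ge0 w; have d0 : 0 <= d%:R :> R by [].
  have : d%:R * (nr w * nr (J x - J x0)) <= 2^-1 * nr w.
    rewrite mulrCA mulrC ler_wpM2r //; apply: le_trans eb.
    rewrite mulrDl (le_trans (ler_wpM2l d0 h6)) // mulrA lerDl.
    by rewrite !mulr_ge0 // ltW.
  lra.
have JlowM x m (A : 'M[C]_(m, d)) : nr (x - x0) < e -> nr (A *m invmx (J x)) <= 2 * nr A.
  move=> hx; apply: nr_mx_le => [|i j]; first by rewrite mulr_ge0 ?nr_ge0.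
  apply: (@le_trans _ _ (nr (row i A *m invmx (J x)))).
    by rewrite -row_mul; have := nr_coord (row i (A *m invmx (J x))) 0 j; rewrite mxE.
  apply: (le_trans (Jlow _ _ hx)); rewrite ler_wpM2l //.
  by apply: nr_sub_mx (fun=> i) id _ => a b; rewrite mxE.
exists g, c; split=> //; last 2 first.
- have [g1 g2] := hg _ y0in; exact: inj g1 x0in g2.
- by move=> y /hg[].
have K0 : 0 <= 2 * (k * 4) + d%:R * (2 * (2 * (k * 2))) by rewrite !(mulr_ge0, addr_ge0).
have [k' hk'] : exists k', c11v_on (f x0) g (fun y => invmx (J (g y))) c k'.
  apply: c11v_intro K0 _ => // x y hx hy.
  have [gx gx'] := hg x hx; have [gy gy'] := hg y hy.
  have [_ _ _ h4 h5] := hf _ _ (ee1 _ gx) (ee1 _ gy).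
  rewrite gx' gy' in h4; have ex := expd _ _ gx gy; rewrite gx' gy' in ex.
  have n0 := nr_ge0 (y - x); have n1 := nr_ge0 (g y - g x).
  set t := nr (y - x) in n0 ex *.
  have t20 : 0 <= t ^+ 2 by rewrite exprn_ge0.
  have sq : nr (g y - g x) ^+ 2 <= 4 * t ^+ 2.
    by rewrite (_ : 4 * t ^+ 2 = (2 * t) ^+ 2); [rewrite !expr2 ler_pM | ring].
  have A0 : 0 <= d%:R * (2 * (2 * (k * 2))) by rewrite !mulr_ge0.
  have B0 : 0 <= 2 * (k * 4) by rewrite !mulr_ge0.
  split.
    rewrite -nrN.
    have -> : - (g y - g x - (y - x) *m invmx (J (g x))) =
        (y - x - (g y - g x) *m J (g x)) *m invmx (J (g x)).
      by rewrite [RHS]mulmxBl (mulmxK (Jfree _ gx)) opprB.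
    apply: (le_trans (Jlow _ _ gx)).
    apply: (@le_trans _ _ (2 * (k * 4) * t ^+ 2)); last by rewrite ler_wpM2r // lerDl.
    rewrite -!mulrA ler_wpM2l // (le_trans h4) // ler_wpM2l //.
  rewrite (_ : _ - _ = invmx (J (g y)) *m ((J (g x) - J (g y)) *m invmx (J (g x)))); last first.
    by rewrite mulmxBl mulmxBr mulmxV ?Jfree // mulmx1 mulKmx ?Jfree.
  apply: (le_trans (nr_mulmx _ _)).
  apply: (@le_trans _ _ (d%:R * (2 * (2 * (k * 2))) * t)); last by rewrite ler_wpM2r // lerDr.
  rewrite -!mulrA ler_wpM2l //; apply: ler_pM; rewrite ?nr_ge0 //.
    rewrite -[X in nr X]mul1mx; apply: (le_trans (JlowM _ _ _ gy)).
    rewrite -[leRHS]mulr1 ler_wpM2l //; apply: nr_mx_le => // i j; rewrite mxE.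
    by case: (i == j); rewrite ?nr1 ?nr0.
  apply: (le_trans (JlowM _ _ _ gx)); rewrite nrB ler_wpM2l //.
  by apply: (le_trans h5); rewrite ler_wpM2l.
exact: c11v_on_c11 hk'.
Qed.

End LocalInverse.

(** * Flows of vector fields *)

Section Flow.
Context {R : realType}.
Local Notation C := R[i].

(** A discrete Gronwall inequality, for total times so short that the
    exponential can be replaced by 2. *)
Lemma discrete_gronwall (r : nat -> R) (N : nat) (b : R) :
  (0 < N)%N -> 0 <= b -> r 0%N <= 0 ->
  (forall j, (j < N)%N -> r j.+1 <= r j + (2^-1 * r j + b) / N%:R) ->
  forall j, (j <= N)%N -> r j <= 2 * b.
Proof.
move=> N0 b0 r0 h j jN.
have N0' : 0 < N%:R :> R by rewrite ltr0n.
suff H : r j <= 2 * b * (j%:R / N%:R).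
  apply: (le_trans H); rewrite -[leRHS]mulr1 ler_wpM2l ?mulr_ge0 //.
  by rewrite ler_pdivrMr // mul1r ler_nat.
elim: j jN => [|j ih] jN; first by rewrite mul0r mulr0.
have {}ih := ih (ltnW jN); apply: (le_trans (h j jN)).
have jN1 : j%:R / N%:R <= 1 :> R by rewrite ler_pdivrMr // mul1r ler_nat ltnW.
have : 2^-1 * r j <= b.
  by have : 2 * b * (j%:R / N%:R) <= 2 * b * 1 by [rewrite ler_wpM2l ?mulr_ge0]; lra.
move=> h1.
have -> : j.+1%:R / N%:R = j%:R / N%:R + N%:R^-1 :> R by rewrite -natr1 mulrDl mul1r.
rewrite mulrDr; apply: lerD => //; rewrite ler_wpM2r ?invr_ge0 //; lra.
Qed.

(** The flow is the limit of Euler polygons.  As the time is complex, it is one of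
    the variables: z stands for the time z_0 and the initial value base z.  All
    the estimates are uniform in the number N of steps. *)
Section Euler.
Variables (d : nat) (v : 'rV[C]_d.+1 -> 'rV[C]_d.+1)
  (J : 'rV[C]_d.+1 -> 'M[C]_d.+1) (e k dl : R).
Hypothesis k1 : 1 <= k.
Hypothesis v0 : v 0 = delta_mx 0 0.
Hypothesis hv : forall x y, nr x < e -> nr y < e ->
  [/\ nr (v x) <= k, nr (J x) <= k, nr (v y - v x) <= k * nr (y - x),
      nr (v y - v x - (y - x) *m J x) <= k * nr (y - x) ^+ 2 &
      nr (J y - J x) <= k * nr (y - x)].
Hypothesis dl0 : 0 < dl.
Hypothesis dle : 4 * (k * dl) < e.
Hypothesis dlk : 10 * (k * k * dl) <= 1.
Hypothesis dld : 2 * (d.+1%:R * k * dl) <= 1.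

(* The axis of the first coordinate is the time axis, and its complement the
   hyperplane of initial values. *)
Let e0 : 'rV[C]_d.+1 := delta_mx 0 0.
Let base (z : 'rV[C]_d.+1) := z - z 0 0 *: e0.

(* The j-th vertex of the polygon with N steps of complex length z_0 / N. *)
Variable euler : nat -> 'rV[C]_d.+1 -> nat -> 'rV[C]_d.+1.
Hypothesis euler0 : forall N z, euler N z 0 = base z.
Hypothesis eulerS : forall N z j, euler N z j.+1 =
  euler N z j + (N%:R^-1)%:C *: (z 0 0 *: v (euler N z j)).

(* The derivative of the vertex with respect to z, by the recursion obtained on
   differentiating that of the vertices. *)
Variable euler_jac : nat -> 'rV[C]_d.+1 -> nat -> 'M[C]_d.+1.
Hypothesis jac0 : forall N z,
  euler_jac N z 0 = 1%:M - (delta_mx 0 0 : 'cV[C]_d.+1) *m e0.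
Hypothesis jacS : forall N z j, euler_jac N z j.+1 =
  euler_jac N z j + (N%:R^-1)%:C *:
    ((delta_mx 0 0 : 'cV[C]_d.+1) *m v (euler N z j) +
     z 0 0 *: (euler_jac N z j *m J (euler N z j))).

Let k0 : 0 < k. Proof. exact: lt_le_trans k1. Qed.
Let k0w : 0 <= k. Proof. exact: ltW. Qed.
Let kk : k <= k * k. Proof. by rewrite ler_peMl // ltW. Qed.
Let kdl : 10 * (k * dl) <= 1.
Proof. by apply: le_trans dlk; rewrite ler_pM2l // ler_pM2r. Qed.
Let dl1 : 10 * dl <= 1.
Proof. by apply: le_trans kdl; rewrite ler_pM2l // ler_peMl // ltW. Qed.

Let dldk : d.+1%:R * k * dl <= 2^-1.
Proof. by move: dld; set a := _ * dl; lra. Qed.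

Let nrNV N (x : 'rV[C]_d.+1) : nr ((N%:R^-1)%:C *: x) = nr x / N%:R.
Proof. by rewrite nrZ nrR ger0_norm ?invr_ge0 // mulrC. Qed.

Let nr_time (z : 'rV[C]_d.+1) : nr (z 0 0) <= nr z. Proof. exact: nr_coord. Qed.

Let nr_base z : nr (base z) <= nr z.
Proof.
apply: nr_mx_le => [|i j]; first exact: nr_ge0.
rewrite !mxE ord1 /=; case: (j =P 0) => [->|_].
  by rewrite mulr1 subrr nr0 nr_ge0.
by rewrite mulr0 subr0 nr_coord.
Qed.

Let baseB z z' : base z' - base z = base (z' - z).
Proof. by apply/matrixP => i j; rewrite !mxE; ring. Qed.

Let euler_bound N z j : (0 < N)%N -> nr z < dl -> (j <= N)%N ->
  nr (euler N z j) <= 2 * (k * dl).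
Proof.
move=> N0 hz jN; have N0' : 0 < N%:R :> R by rewrite ltr0n.
suff H : nr (euler N z j) <= dl + k * dl * (j%:R / N%:R).
  have jN1 : j%:R / N%:R <= 1 :> R by rewrite ler_pdivrMr // mul1r ler_nat.
  have : k * dl * (j%:R / N%:R) <= k * dl by rewrite ler_piMr // mulr_ge0 // ltW.
  have : dl <= k * dl by rewrite ler_peMl // ltW.
  lra.
elim: j jN => [|j ih] jN.
  by rewrite euler0 mul0r mulr0 addr0 (le_trans (nr_base z)) // ltW.
have {}ih := ih (ltnW jN).
have jN1 : j%:R / N%:R <= 1 :> R by rewrite ler_pdivrMr // mul1r ler_nat ltnW.
have xe : nr (euler N z j) < e.
  have : k * dl * (j%:R / N%:R) <= k * dl by rewrite ler_piMr // mulr_ge0 // ltW.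
  have : dl <= k * dl by rewrite ler_peMl // ltW.
  by move: dle (mulr_gt0 k0 dl0); lra.
rewrite eulerS -[j.+1%:R]natr1 mulrDl mulrDr addrA mul1r; apply: nrD_le => //.
rewrite nrNV ler_wpM2r ?invr_ge0 // nrZ mulrC.
have [h1 _ _ _ _] := hv xe xe.
by apply: ler_pM; rewrite ?nr_ge0 // (le_trans (nr_time z)) // ltW.
Qed.

Let euler_in N z j : (0 < N)%N -> nr z < dl -> (j <= N)%N -> nr (euler N z j) < e.
Proof.
move=> N0 hz jN; have := euler_bound N0 hz jN.
by move: dle (mulr_gt0 k0 dl0); lra.
Qed.

Let v_near0 x : nr x < e -> nr (v x - e0) <= k * nr x.
Proof.
move=> hx; have z0 : nr (0 : 'rV[C]_d.+1) < e by rewrite nr0; apply: le_lt_trans hx; exact: nr_ge0.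
by have [_ _ + _ _] := hv z0 hx; rewrite v0 subr0.
Qed.

(* The polygon compared with the one of the constant field e0, which is z when
   j = N. *)
Let defect N z j := euler N z j - base z - (j%:R / N%:R)%:C *: (z 0 0 *: e0).

Let defectS N z j : defect N z j.+1 =
  defect N z j + (N%:R^-1)%:C *: (z 0 0 *: (v (euler N z j) - e0)).
Proof.
rewrite /defect eulerS -[j.+1%:R]natr1 mulrDl mul1r rmorphD /=.
by apply/matrixP => i i'; rewrite !mxE; ring.
Qed.

Let euler_defect N z z' j : (0 < N)%N -> nr z < dl -> nr z' < dl -> (j <= N)%N ->
  nr (defect N z' j - defect N z j) <= 2^-1 * nr (z' - z) /\
  nr (euler N z' j - euler N z j) <= 3 * nr (z' - z).
Proof.
move=> N0 hz hz' jN; have N0' : 0 < N%:R :> R by rewrite ltr0n.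
set D := nr (z' - z); have D0 : 0 <= D by exact: nr_ge0.
have dist i : (i <= N)%N -> nr (defect N z' i - defect N z i) <= 2^-1 * D ->
    nr (euler N z' i - euler N z i) <= 3 * D.
  move=> iN h.
  have -> : euler N z' i - euler N z i = (defect N z' i - defect N z i) +
     (base (z' - z) + (i%:R / N%:R)%:C *: ((z' - z) 0 0 *: e0)).
    by rewrite -baseB /defect; apply/matrixP => a b; rewrite !mxE; ring.
  have h1 : nr ((i%:R / N%:R)%:C *: ((z' - z) 0 0 *: e0)) <= D.
    rewrite !nrZ nrR nr_delta mulr1 ger0_norm ?divr_ge0 //.
    have iN1 : i%:R / N%:R <= 1 :> R by rewrite ler_pdivrMr // mul1r ler_nat.
    by apply: le_trans (nr_time (z' - z)); rewrite ler_piMl ?nr_ge0.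
  have := nrD_le h (nrD_le (nr_base (z' - z)) h1); rewrite -/D; lra.
suff H i : (i <= N)%N -> nr (defect N z' i - defect N z i) <= 2^-1 * D * (i%:R / N%:R).
  have h : nr (defect N z' j - defect N z j) <= 2^-1 * D.
    apply: (le_trans (H j jN)); rewrite ler_piMr ?mulr_ge0 //.
    by rewrite ler_pdivrMr // mul1r ler_nat.
  by split=> //; exact: dist.
elim: i => [|i ih] iN.
  have dz y : defect N y 0 = 0.
    by rewrite /defect euler0 mul0r rmorph0 scale0r subr0 subrr.
  by rewrite !dz subr0 nr0 mul0r mulr0.
have {}ih := ih (ltnW iN).
have hi : nr (defect N z' i - defect N z i) <= 2^-1 * D.
  apply: (le_trans ih); rewrite ler_piMr ?mulr_ge0 //.
  by rewrite ler_pdivrMr // mul1r ler_nat ltnW.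
have hd := dist i (ltnW iN) hi.
rewrite !defectS -[i.+1%:R]natr1 mulrDl mulrDr mul1r.
have xe := euler_in N0 hz (ltnW iN); have xe' := euler_in N0 hz' (ltnW iN).
have [_ _ h3 _ _] := hv xe xe'; have h4 := v_near0 xe'.
have h5 := euler_bound N0 hz' (ltnW iN).
set x := euler N z i in xe h3 hd *; set x' := euler N z' i in xe' h3 h4 h5 hd *.
have -> : defect N z' i + (N%:R^-1)%:C *: (z' 0 0 *: (v x' - e0)) -
   (defect N z i + (N%:R^-1)%:C *: (z 0 0 *: (v x - e0))) =
   (defect N z' i - defect N z i) + (N%:R^-1)%:C *: ((z' - z) 0 0 *: (v x' - e0) +
     z 0 0 *: (v x' - v x)).
  have gen (A B P Q E : 'rV[C]_d.+1) (h s s' : C) :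
      A + h *: (s' *: (P - E)) - (B + h *: (s *: (Q - E))) =
      (A - B) + h *: ((s' - s) *: (P - E) + s *: (P - Q)).
    by apply/matrixP => a b; rewrite !mxE; ring.
  have -> : (z' - z) 0 0 = z' 0 0 - z 0 0 by rewrite !mxE.
  exact: gen.
apply: nrD_le => //; rewrite nrNV ler_wpM2r ?invr_ge0 //.
have g1 : nr ((z' - z) 0 0 *: (v x' - e0)) <= D * (k * (2 * (k * dl))).
  rewrite nrZ; apply: ler_pM; rewrite ?nr_ge0 ?nr_time //.
  by apply: (le_trans h4); rewrite ler_wpM2l // ltW.
have g2 : nr (z 0 0 *: (v x' - v x)) <= dl * (k * (3 * D)).
  rewrite nrZ; apply: ler_pM; rewrite ?nr_ge0 //.
    by apply: (le_trans (nr_time z)); exact: ltW.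
  by apply: (le_trans h3); rewrite ler_wpM2l // ltW.
apply: (le_trans (nrD_le g1 g2)).
rewrite (_ : _ + _ = (2 * (k * k * dl) + 3 * (k * dl)) * D); last by ring.
by rewrite ler_wpM2r //; move: (k * k * dl) (k * dl) dlk kdl => A B; lra.
Qed.

Lemma euler_half_close N z z' : (0 < N)%N -> nr z < dl -> nr z' < dl ->
  nr (euler N z' N - euler N z N - (z' - z)) <= 2^-1 * nr (z' - z).
Proof.
move=> N0 hz hz'; have [+ _] := euler_defect N0 hz hz' (leqnn N).
have E w : defect N w N = euler N w N - w.
  rewrite /defect divff ?pnatr_eq0 -?lt0n // rmorph1 scale1r /base.
  by apply/matrixP => i j; rewrite !mxE; ring.
rewrite !E (_ : _ - _ - (_ - _) = euler N z' N - euler N z N - (z' - z)) //.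
by apply/matrixP => i j; rewrite !mxE; ring.
Qed.

(** Two half steps differ from one step by O(1/N^2). *)
Lemma euler_double N z : (0 < N)%N -> nr z < dl ->
  nr (euler (2 * N) z (2 * N) - euler N z N) <= 2 / N%:R.
Proof.
move=> N0 hz; have N0' : 0 < N%:R :> R by rewrite ltr0n.
have NN0 : (0 < 2 * N)%N by rewrite muln_gt0.
have b0 : 0 <= N%:R^-1 :> R by rewrite invr_ge0 ltW.
apply: (@discrete_gronwall (fun j => nr (euler (2 * N) z (2 * j) - euler N z j)) N
  N%:R^-1 N0 b0 _ _ N (leqnn N)); first by rewrite muln0 !euler0 subrr nr0.
move=> j jN; have jN2 : (2 * j <= 2 * N)%N by rewrite leq_pmul2l // ltnW.
have jN3 : ((2 * j).+1 <= 2 * N)%N by rewrite ltn_pmul2l.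
have -> : (2 * j.+1 = (2 * j).+2)%N by rewrite mulnS.
have Xe := euler_in NN0 hz jN2; have Ye := euler_in NN0 hz jN3.
have xe := euler_in N0 hz (ltnW jN).
rewrite (eulerS (2 * N) z (2 * j).+1) (eulerS N z j).
have YE := eulerS (2 * N) z (2 * j).
have [a1 _ a3 _ _] := hv Xe Ye; have [_ _ b3 _ _] := hv xe Xe.
move: YE a3; set X := euler _ z (2 * j) in Xe b3 a1 *; set Y := euler _ z (2 * j).+1 in Ye *.
set x := euler N z j in xe b3 * => YE a3.
have NE : ((2 * N)%:R^-1)%:C = 2^-1 * (N%:R^-1)%:C :> C.
  by rewrite natrM invfM rmorphM fmorphV rmorphMn rmorph1.
have h1 : Y + ((2 * N)%:R^-1)%:C *: (z 0 0 *: v Y) -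
    (x + (N%:R^-1)%:C *: (z 0 0 *: v x)) =
    (X - x) + (N%:R^-1)%:C *: (z 0 0 *: ((v X - v x) + 2^-1 *: (v Y - v X))).
  have gen (x1 X1 V1 V2 V3 : 'rV[C]_d.+1) (h s : C) :
      X1 + (2^-1 * h) *: (s *: V1) + (2^-1 * h) *: (s *: V2) - (x1 + h *: (s *: V3)) =
      (X1 - x1) + h *: (s *: ((V1 - V3) + 2^-1 *: (V2 - V1))).
    by apply/matrixP => a b; rewrite !mxE; field.
  by rewrite [X in X + _ - _]YE NE; exact: gen.
rewrite h1; apply: nrD_le => //; rewrite nrNV ler_wpM2r ?invr_ge0 //.
have zd : nr (z 0 0) <= dl by rewrite (le_trans (nr_time z)) // ltW.
have hX0 := nr_ge0 (X - x).
have hY : nr (Y - X) <= dl * k / N%:R.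
  rewrite YE addrC addKr nrZ nrR nrZ ger0_norm ?invr_ge0 // mulrC natrM invfM.
  apply: ler_pM; rewrite ?mulr_ge0 ?nr_ge0 ?invr_ge0 //; first by apply: ler_pM; rewrite ?nr_ge0.
  by rewrite ler_piMl //; lra.
have h2 : nr (2^-1 *: (v Y - v X)) <= k * (dl * k / N%:R).
  have -> : 2^-1 = (2^-1 : R)%:C :> C by rewrite fmorphV rmorphMn rmorph1.
  rewrite nrZ nrR ger0_norm // (@le_trans _ _ (1 * nr (v Y - v X))) //.
    by rewrite ler_wpM2r ?nr_ge0 //; lra.
  by rewrite mul1r (le_trans a3) // ler_wpM2l // ltW.
rewrite nrZ; apply: (@le_trans _ _ (dl * (k * nr (X - x) + k * (dl * k / N%:R)))).
  by apply: ler_pM; rewrite ?nr_ge0 //; apply: nrD_le.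
rewrite mulrDr mulrA; apply: lerD.
  by rewrite ler_wpM2r // (mulrC dl); move: kdl; lra.
rewrite (_ : _ * _ = (k * dl) * (k * dl) / N%:R); last by ring.
rewrite -[leRHS]mul1r ler_wpM2r // -[leRHS]mulr1.
have : 0 <= k * dl by rewrite mulr_ge0 // ltW.
by move=> q; apply: ler_pM => //; move: kdl; lra.
Qed.

(** The remainder of the Taylor estimate of v enters at each step with weight 1/N,
    and is propagated with a bounded factor. *)
Lemma euler_taylor N z z' : (0 < N)%N -> nr z < dl -> nr z' < dl ->
  nr (euler N z' N - euler N z N - (z' - z) *m euler_jac N z N) <=
    2 * (12 * k * nr (z' - z) ^+ 2).
Proof.
move=> N0 hz hz'; have N0' : 0 < N%:R :> R by rewrite ltr0n.
set D := nr (z' - z); have D0 : 0 <= D by exact: nr_ge0.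
have D20 : 0 <= D ^+ 2 by rewrite exprn_ge0.
pose r j := nr (euler N z' j - euler N z j - (z' - z) *m euler_jac N z j).
apply: (@discrete_gronwall r N) => //; first by rewrite !mulr_ge0 // ltW.
  rewrite /r !euler0 jac0 mulmxBr mulmx1 mulmxA -colE.
  rewrite (_ : _ - _ = 0) ?nr0 // /base; apply/matrixP => a b.
  by rewrite !mxE big_ord1 !mxE ord1; ring.
move=> j jN; rewrite /r.
have xe := euler_in N0 hz (ltnW jN); have xe' := euler_in N0 hz' (ltnW jN).
have [_ h2 h3 h4 _] := hv xe xe'.
have [_ hd] := euler_defect N0 hz hz' (ltnW jN); rewrite -/D in hd.
rewrite !eulerS jacS; set x := euler N z j in xe h2 h3 h4 hd *.
set x' := euler N z' j in xe' h3 h4 hd *; set K := euler_jac N z j.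
set S := (z' - z) *m K; set rr := x' - x - S.
have h1 : x' + (N%:R^-1)%:C *: (z' 0 0 *: v x') - (x + (N%:R^-1)%:C *: (z 0 0 *: v x)) -
    (z' - z) *m (K + (N%:R^-1)%:C *: ((delta_mx 0 0 : 'cV_d.+1) *m v x + z 0 0 *: (K *m J x))) =
    rr + (N%:R^-1)%:C *: (z 0 0 *: (rr *m J x) + ((z' - z) 0 0 *: (v x' - v x) +
      z 0 0 *: (v x' - v x - (x' - x) *m J x))).
  have e1 : (z' - z) *m ((delta_mx 0 0 : 'cV_d.+1) *m v x) = (z' - z) 0 0 *: v x.
    rewrite mulmxA -colE; apply/matrixP => a b; rewrite !mxE big_ord1 !mxE ord1.
    by [].
  have e2 : (z' - z) *m (K *m J x) = S *m J x by rewrite mulmxA.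
  have e3 : rr *m J x = (x' - x) *m J x - S *m J x by exact: mulmxBl.
  rewrite e3 mulmxDr -!scalemxAr mulmxDr e1 -scalemxAr e2 -/S /rr.
  have gen (X X' V V' P Q S0 : 'rV[C]_d.+1) (h s s' : C) : X' + h *: (s' *: V') -
      (X + h *: (s *: V)) - (S0 + h *: ((s' - s) *: V + s *: Q)) =
      X' - X - S0 + h *: (s *: (P - Q) + ((s' - s) *: (V' - V) + s *: (V' - V - P))).
    by apply/matrixP => a b; rewrite !mxE; ring.
  have -> : (z' - z) 0 0 = z' 0 0 - z 0 0 by rewrite !mxE.
  exact: gen.
rewrite h1; apply: nrD_le => //; rewrite nrNV ler_wpM2r ?invr_ge0 //.
have zd : nr (z 0 0) <= dl by rewrite (le_trans (nr_time z)) // ltW.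
apply: nrD_le.
  rewrite nrZ; apply: (@le_trans _ _ (dl * (d.+1%:R * (nr rr * k)))).
    apply: ler_pM; rewrite ?nr_ge0 // (le_trans (nr_mulmx _ _)) // ler_wpM2l //.
    by rewrite ler_wpM2l ?nr_ge0.
  rewrite (_ : _ * _ = d.+1%:R * k * dl * nr rr); last by ring.
  by rewrite ler_wpM2r ?nr_ge0.
have g1 : nr ((z' - z) 0 0 *: (v x' - v x)) <= D * (k * (3 * D)).
  rewrite nrZ; apply: ler_pM; rewrite ?nr_ge0 ?nr_time //.
  by apply: (le_trans h3); rewrite ler_wpM2l // ltW.
have g2 : nr (z 0 0 *: (v x' - v x - (x' - x) *m J x)) <= dl * (k * (3 * D) ^+ 2).
  rewrite nrZ; apply: ler_pM; rewrite ?nr_ge0 //.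
  apply: (le_trans h4); rewrite ler_wpM2l ?k0w // !expr2.
  by apply: ler_pM; rewrite ?nr_ge0.
apply: (le_trans (nrD_le g1 g2)).
rewrite (_ : _ + _ = (3 * k + 9 * (k * dl)) * D ^+ 2); last by ring.
by rewrite ler_wpM2r //; move: kdl k1; lra.
Qed.

(** Lengthening the time lengthens each of the N steps, so that the time
    derivative of the j-th vertex is j/N times the velocity there, up to O(1/N). *)
Lemma euler_jac_time N z : (0 < N)%N -> nr z < dl ->
  nr (e0 *m euler_jac N z N - v (euler N z N)) <= 2 * (2 * (k * k) / N%:R).
Proof.
move=> N0 hz; have N0' : 0 < N%:R :> R by rewrite ltr0n.
pose w j := e0 *m euler_jac N z j - (j%:R / N%:R)%:C *: v (euler N z j).
have -> : e0 *m euler_jac N z N - v (euler N z N) = w N.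
  by rewrite /w divff ?pnatr_eq0 -?lt0n // rmorph1 scale1r.
have kk0 : 0 <= k * k by rewrite mulr_ge0 ?ltW.
have b0 : 0 <= 2 * (k * k) / N%:R by rewrite divr_ge0 ?mulr_ge0 // ltW.
apply: (@discrete_gronwall (fun j => nr (w j)) N) => //.
  rewrite /w mul0r rmorph0 scale0r subr0 jac0 mulmxBr mulmx1 mulmxA.
  rewrite (_ : e0 *m (delta_mx 0 0 : 'cV_d.+1) = 1%:M) ?mul1mx ?subrr ?nr0 //.
  by rewrite /e0 mul_delta_mx; apply/matrixP => a b; rewrite !mxE !ord1.
move=> j jN; have xe := euler_in N0 hz (ltnW jN); have ye := euler_in N0 hz jN.
have [h1 h2 h3 h4 _] := hv xe ye; rewrite /w.
have yE := eulerS N z j; rewrite jacS.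
move: yE h3 h4; set x := euler N z j in xe h1 h2 *; set y := euler N z j.+1 in ye *.
set K := euler_jac N z j => yE h3 h4.
have zd : nr (z 0 0) <= dl by rewrite (le_trans (nr_time z)) // ltW.
have yx : y - x = (N%:R^-1)%:C *: (z 0 0 *: v x) by rewrite yE addrC addKr.
have yxn : nr (y - x) <= k * dl / N%:R.
  rewrite yx nrNV ler_wpM2r ?invr_ge0 // nrZ mulrC.
  by apply: ler_pM; rewrite ?nr_ge0.
have e0e0 : e0 *m ((delta_mx 0 0 : 'cV_d.+1) *m v x) = v x.
  rewrite mulmxA (_ : e0 *m (delta_mx 0 0 : 'cV_d.+1) = 1%:M) ?mul1mx //.
  by rewrite /e0 mul_delta_mx; apply/matrixP => a b; rewrite !mxE !ord1.
pose u := e0 *m K - (j%:R / N%:R)%:C *: v x.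
have -> : e0 *m (K + (N%:R^-1)%:C *: ((delta_mx 0 0 : 'cV_d.+1) *m v x + z 0 0 *: (K *m J x)))
    - (j.+1%:R / N%:R)%:C *: v y =
    u + (N%:R^-1)%:C *: (z 0 0 *: (u *m J x) -
      (j%:R%:C *: (v y - v x - (y - x) *m J x) + (v y - v x))).
  have e2 : e0 *m (K *m J x) = e0 *m K *m J x by rewrite mulmxA.
  rewrite mulmxDr -!scalemxAr mulmxDr e0e0 -scalemxAr e2 /u (mulmxBl (e0 *m K)) yx.
  rewrite -!scalemxAl -[j.+1%:R]natr1 mulrDl mul1r !rmorphD !rmorphM /=.
  have gen (P Q S V W : 'rV[C]_d.+1) (t h s : C) :
      S + h *: (V + s *: P) - (t * h + h) *: W =
      S - (t * h) *: V + h *: (s *: (P - (t * h) *: Q) -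
        (t *: (W - V - h *: (s *: Q)) + (W - V))).
    by apply/matrixP => a b; rewrite !mxE; ring.
  exact: gen.
rewrite -/u; apply: nrD_le => //; rewrite nrNV ler_wpM2r ?invr_ge0 //.
apply: nrD_le.
  rewrite nrZ; apply: (@le_trans _ _ (dl * (d.+1%:R * (nr u * k)))).
    apply: ler_pM; rewrite ?nr_ge0 // (le_trans (nr_mulmx _ _)) // ler_wpM2l //.
    by rewrite ler_wpM2l ?nr_ge0.
  rewrite (_ : _ * _ = d.+1%:R * k * dl * nr u); last by ring.
  by rewrite ler_wpM2r ?nr_ge0.
have n0 : 0 <= k * dl / N%:R by rewrite divr_ge0 ?mulr_ge0 ?ltW.
have kd1 : 0 <= k * dl by rewrite mulr_ge0 ?ltW.
rewrite nrN (_ : 2 * (k * k) / N%:R = k * k / N%:R + k * k / N%:R); last by ring.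
apply: nrD_le.
  rewrite nrZ nrR ger0_norm //.
  apply: (@le_trans _ _ (N%:R * (k * (k * dl / N%:R) ^+ 2))).
    apply: ler_pM; rewrite ?nr_ge0 ?ler_nat ?(ltnW jN) //.
    apply: (le_trans h4); rewrite ler_wpM2l ?k0w // !expr2.
    by apply: ler_pM; rewrite ?nr_ge0.
  rewrite (_ : _ * _ = (k * dl) * (k * dl) * k / N%:R); last first.
    by field; rewrite gt_eqF.
  rewrite ler_wpM2r ?invr_ge0 // (le_trans _ kk) //.
  rewrite -[leRHS]mul1r ler_wpM2r ?k0w // -[leRHS]mulr1.
  by apply: ler_pM => //; move: kdl; lra.
apply: (le_trans h3); apply: (@le_trans _ _ (k * (k * dl / N%:R))).
  by rewrite ler_wpM2l // ltW.
rewrite !mulrA ler_wpM2r ?invr_ge0 // -[leRHS]mulr1 ler_wpM2l //.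
have := dl1; lra.
Qed.

(* Doubling N twice at each stage makes the polygons converge like 4^-n, which
   leaves 2^-n for difference quotients with step 2^-n. *)
Let approx n z := euler (4 ^ n) z (4 ^ n).

Let p4 n : (0 < 4 ^ n)%N. Proof. by rewrite expn_gt0. Qed.

Let approx_step n z : nr z < dl -> nr (approx n.+1 z - approx n z) <= 3 / 4 ^+ n.
Proof.
move=> hz; rewrite /approx.
have := euler_double (p4 n) hz; have p2 : (0 < 2 * 4 ^ n)%N by rewrite muln_gt0 p4.
have := euler_double p2 hz.
have -> : (2 * (2 * 4 ^ n) = 4 ^ n.+1)%N by rewrite mulnA expnS.
move=> h1 h2; apply: (le_trans (nr_tri (euler (2 * 4 ^ n) z (2 * 4 ^ n)) _ _)).
apply: (le_trans (lerD h1 h2)); rewrite natrM natrX invfM mulrA divff //.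
by rewrite -mulrDl ler_wpM2r // ?invr_ge0 ?exprn_ge0 //; lra.
Qed.

Lemma euler_limit : exists Phi : 'rV[C]_d.+1 -> 'rV[C]_d.+1,
  forall z n, nr z < dl -> nr (approx n z - Phi z) <= 12 / 2 ^+ n.
Proof.
have /choice [Phi hPhi] z : exists y, forall n, nr z < dl ->
    nr (approx n z - y) <= 12 / 2 ^+ n.
  have [hz|hz] := boolP (nr z < dl); last by exists 0.
  have [n|y hy] := @geometric_cvg R _ _ (approx^~ z) 3.
    apply: (le_trans (approx_step n hz)); rewrite ler_wpM2l //.
    by rewrite lef_pV2 ?posrE ?exprn_gt0 // lerXn2r ?nnegrE // ler_nat.
  by exists y => n _; apply: le_trans (hy n) _; rewrite -natrM.
by exists Phi.
Qed.

Section Limit.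
Variable Phi : 'rV[C]_d.+1 -> 'rV[C]_d.+1.
Hypothesis hPhi : forall z n, nr z < dl -> nr (approx n z - Phi z) <= 12 / 2 ^+ n.

Lemma flow_half_close z z' : nr z < dl -> nr z' < dl ->
  nr (Phi z' - Phi z - (z' - z)) <= 2^-1 * nr (z' - z).
Proof.
move=> hz hz'; apply: (@le_geometric _ _ _ 24) => n.
have -> : Phi z' - Phi z - (z' - z) = (approx n z' - approx n z - (z' - z)) +
    ((approx n z - Phi z) - (approx n z' - Phi z')).
  by apply/matrixP => i j; rewrite !mxE; ring.
apply: nrD_le; first exact: euler_half_close.
rewrite (_ : 24 / 2 ^+ n = 12 / 2 ^+ n + 12 / 2 ^+ n); last by rewrite -mulrDl -natrD.
by apply: nrD_le; rewrite ?nrN; exact: hPhi.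
Qed.

Lemma flow_bound z : nr z < dl -> nr (Phi z) <= 2 * (k * dl).
Proof.
move=> hz; apply: (@le_geometric _ _ _ 12) => n.
rewrite -(subrK (approx n z) (Phi z)) addrC; apply: nrD_le.
  exact: (euler_bound (p4 n) hz (leqnn _)).
by rewrite nrB; exact: hPhi.
Qed.

Lemma flow0 : Phi 0 = 0.
Proof.
have h0 : nr (0 : 'rV[C]_d.+1) < dl by rewrite nr0.
apply: nr_le0; apply: (@le_geometric _ _ _ 12) => n; rewrite add0r.
have a0 N j : euler N 0 j = 0.
  elim: j => [|j ih]; first by rewrite euler0 /base mxE scale0r subrr.
  by rewrite eulerS ih mxE scale0r scaler0 addr0.
by have := hPhi n h0; rewrite /approx a0 sub0r nrN.
Qed.

(** The Jacobians of the polygons converge because the polygons do and their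
    Taylor estimates are uniform: a difference quotient with step 2^-n tells
    the Jacobians apart up to O(2^-n). *)
Lemma flow_jacobian z : nr z < dl -> exists2 K : 'M[C]_d.+1,
  (forall z', nr z' < dl ->
     nr (Phi z' - Phi z - (z' - z) *m K) <= 24 * k * nr (z' - z) ^+ 2) &
  e0 *m K = v (Phi z).
Proof.
move=> hz; pose Jn n := euler_jac (4 ^ n) z (4 ^ n).
pose T n z' := approx n z' - approx n z - (z' - z) *m Jn n.
have hT n z' : nr z' < dl -> nr (T n z') <= 24 * k * nr (z' - z) ^+ 2.
  move=> hz'; apply: (le_trans (euler_taylor (p4 n) hz hz')).
  by rewrite le_eqVlt; apply/orP; left; apply/eqP; ring.
(* Half the distance from z to the boundary of the ball, so that the difference
   quotients stay in it. *)
pose eta := (dl - nr z) / 2; have eta0 : 0 < eta by rewrite divr_gt0 // subr_gt0.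
pose c := 48 * k * eta + 6 / eta.
have eta1 := ltW eta0; have c0 : 0 <= c.
  by apply: addr_ge0; [exact: (mulr_ge0 (mulr_ge0 _ k0w) eta1) | exact: divr_ge0].
have [n|K hK] := @geometric_cvg R _ _ Jn c.
  have cn : 0 <= c / 2 ^+ n by rewrite divr_ge0 // exprn_ge0.
  have p2 : 0 < (2 : R) ^+ n by rewrite exprn_gt0.
  pose t := eta / 2 ^+ n; have t0 : 0 < t by rewrite divr_gt0.
  have te : t <= eta.
    by rewrite ler_pdivrMr //; apply: ler_peMr => //; rewrite exprn_ege1 // ler1n.
  apply: nr_mx_le => // i j.
  pose z' := z + t%:C *: delta_mx 0 i.
  have zz : z' - z = t%:C *: delta_mx 0 i by rewrite addrC addKr.
  have nzz : nr (z' - z) = t by rewrite zz nrZ nrR nr_delta mulr1 gtr0_norm.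
  have hz' : nr z' < dl.
    rewrite /z'; apply: (le_lt_trans (nrD _ _)).
    rewrite nrZ nrR nr_delta mulr1 gtr0_norm //.
    by apply: (@le_lt_trans _ _ (nr z + eta)); [rewrite lerD2l | rewrite /eta; move: hz; lra].
  have key : t * nr (row i (Jn n.+1 - Jn n)) <= t * (c / 2 ^+ n).
    rewrite -[X in X * _]gtr0_norm // -nrR -nrZ rowE scalemxAl -zz.
    rewrite (_ : _ *m _ = ((T n z' - T n.+1 z') + ((approx n.+1 z' - approx n z') -
       (approx n.+1 z - approx n z)))); last first.
      rewrite /T mulmxBr; move: ((z' - z) *m Jn n.+1) ((z' - z) *m Jn n) => P Q.
      by move: (approx n.+1 z') (approx n z') (approx n.+1 z) (approx n z) => A B D E;
         apply/matrixP => a b; rewrite !mxE; ring.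
    have h1 := hT n z' hz'; have h2 := hT n.+1 z' hz'; rewrite nzz in h1 h2.
    rewrite -nrN in h2; have h3 := approx_step n hz'; have h4 := approx_step n hz.
    rewrite -nrN in h4; apply: (le_trans (nrD_le (nrD_le h1 h2) (nrD_le h3 h4))).
    have -> : (4 : R) ^+ n = 2 ^+ n * 2 ^+ n by rewrite -exprMn -natrM.
    rewrite le_eqVlt; apply/orP; left; apply/eqP; rewrite /t /c; field.
    by rewrite !gt_eqF.
  move: key; rewrite ler_pM2l // => key; apply: le_trans key.
  by have := nr_coord (row i (Jn n.+1 - Jn n)) 0 j; rewrite !mxE.
have [d0 kd0 kk0] : [/\ 0 <= d.+1%:R :> R, 0 <= 24 * k & 0 <= 4 * (k * k)].
  by split=> //; [exact: (mulr_ge0 _ k0w) | exact: (mulr_ge0 _ (mulr_ge0 k0w k0w))].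
exists K => [z' hz'|].
  apply: (@le_geometric _ _ _ (24 + d.+1%:R * (nr (z' - z) * (4 * c)))) => n.
  have -> : Phi z' - Phi z - (z' - z) *m K = T n z' +
      (((approx n z - Phi z) - (approx n z' - Phi z')) + (z' - z) *m (Jn n - K)).
    rewrite /T mulmxBr; move: ((z' - z) *m Jn n) ((z' - z) *m K) => P Q.
    by move: (approx n z') (approx n z) => A B; apply/matrixP => a b; rewrite !mxE; ring.
  apply: nrD_le; first exact: hT.
  rewrite mulrDl; apply: nrD_le.
    rewrite (_ : 24 / 2 ^+ n = 12 / 2 ^+ n + 12 / 2 ^+ n); last by rewrite -mulrDl -natrD.
    by apply: nrD_le; rewrite ?nrN; exact: hPhi.
  apply: (le_trans (nr_mulmx _ _)); rewrite -!mulrA ler_wpM2l // ler_wpM2l ?nr_ge0 //.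
  by rewrite mulrA; exact: hK.
apply/eqP; rewrite -subr_eq0 -nr_eq0 eq_le nr_ge0 andbT.
apply: (@le_geometric _ _ _ (d.+1%:R * (1 * (4 * c)) + (4 * (k * k) + k * 12))) => n.
rewrite add0r.
have -> : e0 *m K - v (Phi z) = e0 *m (K - Jn n) + ((e0 *m Jn n - v (approx n z)) +
    (v (approx n z) - v (Phi z))).
  by rewrite mulmxBr -!addrA; congr (_ + _); rewrite !addrA subrK addNr add0r.
rewrite mulrDl; apply: nrD_le.
  apply: (le_trans (nr_mulmx _ _)); rewrite -!mulrA ler_wpM2l //.
  rewrite /e0 nr_delta ler_wpM2l // mulrA nrB; exact: hK.
have pw : ((4 ^ n)%:R : R)^-1 <= (2 ^+ n)^-1.
  by rewrite natrX lef_pV2 ?posrE ?exprn_gt0 // lerXn2r ?nnegrE // ler_nat.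
rewrite mulrDl; apply: nrD_le.
  apply: (le_trans (euler_jac_time (p4 n) hz)).
  rewrite !mulrA (_ : 2 * 2 = 4) -?natrM // -!mulrA !ler_wpM2l //.
have ae : nr (approx n z) < e by exact: (euler_in (p4 n) hz (leqnn _)).
have pe : nr (Phi z) < e.
  by apply: (le_lt_trans (flow_bound hz)); move: dle (mulr_gt0 k0 dl0); lra.
have [_ _ h3 _ _] := hv pe ae; apply: (le_trans h3).
by rewrite -mulrA ler_wpM2l //; exact: hPhi.
Qed.

End Limit.

End Euler.

(** The coordinate z_0 is the time, and the others are an initial value on the
    hyperplane transverse to v; as v is e_0 at the origin, z is the flow up to
    terms of second order. *)
Lemma local_flow d (v : 'rV[C]_d.+1 -> 'rV[C]_d.+1) (e1 : R) :
  c11mx 0 v -> v 0 = delta_mx 0 0 -> 0 < e1 ->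
  exists Phi dl, [/\ 0 < dl, Phi 0 = 0, half_close Phi 0 dl,
    forall z, nr z < dl -> nr (Phi z) < e1 &
    forall z, nr z < dl -> differentiable Phi z /\
      'D_(delta_mx 0 0) Phi z = v (Phi z)].
Proof.
move=> /c11v_exists [J [e2 [k2 h2]]] v0 e10.
have e20 : 0 < e2 by case: h2.
pose e := Num.min e1 e2; pose k := Num.max 1 k2.
have e0 : 0 < e by rewrite lt_min e10.
have k1 : 1 <= k by rewrite le_max lexx.
have [_ _ hv0] : c11v_on 0 v J e k.
  by apply: (c11v_onW h2); rewrite // ?ge_min ?le_max lexx orbT.
have hv x y : nr x < e -> nr y < e ->
  [/\ nr (v x) <= k, nr (J x) <= k, nr (v y - v x) <= k * nr (y - x),
      nr (v y - v x - (y - x) *m J x) <= k * nr (y - x) ^+ 2 &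
      nr (J y - J x) <= k * nr (y - x)].
  by move=> hx hy; apply: hv0; rewrite subr0.
have k0 : 0 < k by apply: lt_le_trans k1.
(* The radius dl is the inverse of a sum, so that each of its terms bounds it. *)
pose A := 5 * k / e; pose B := 10 * (k * k); pose D := 2 * (d.+1%:R * k) : R.
have A0 : 0 < A by rewrite divr_gt0 ?mulr_gt0.
have B0 : 0 < B by rewrite !mulr_gt0.
have D0 : 0 < D by rewrite !mulr_gt0 // ltr0n.
pose dl := (A + B + D)^-1.
have S0 : 0 < A + B + D by rewrite !addr_gt0.
have dl0 : 0 < dl by rewrite invr_gt0.
have frac X : X <= A + B + D -> X * dl <= 1 by move=> h; rewrite ler_pdivrMr // mul1r.
have dle : 4 * (k * dl) < e.
  have /frac : A <= A + B + D by rewrite -addrA lerDl addr_ge0 // ltW.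
  rewrite /A mulrAC ler_pdivrMr // mul1r => h.
  by have := mulr_gt0 k0 dl0; rewrite -mulrA in h; lra.
have dlk : 10 * (k * k * dl) <= 1.
  rewrite mulrA; apply: (frac B); rewrite (addrC A) -addrA lerDl addr_ge0 // ltW //.
have dld : 2 * (d.+1%:R * k * dl) <= 1.
  by rewrite mulrA; apply: (frac D); rewrite lerDr addr_ge0 // ltW.
pose E (N : nat) (z : 'rV[C]_d.+1) : nat -> 'rV[C]_d.+1 := fix E j := if j is i.+1 then
  E i + (N%:R^-1)%:C *: (z 0 0 *: v (E i)) else z - z 0 0 *: delta_mx 0 0.
pose F (N : nat) (z : 'rV[C]_d.+1) : nat -> 'M[C]_d.+1 := fix F j := if j is i.+1 then
  F i + (N%:R^-1)%:C *: ((delta_mx 0 0 : 'cV[C]_d.+1) *m v (E N z i) +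
     z 0 0 *: (F i *m J (E N z i)))
  else 1%:M - (delta_mx 0 0 : 'cV[C]_d.+1) *m (delta_mx 0 0 : 'rV[C]_d.+1).
have E0 (N : nat) (z : 'rV[C]_d.+1) : E N z 0%N = z - z 0 0 *: delta_mx 0 0 by [].
have ES (N : nat) (z : 'rV[C]_d.+1) j :
  E N z j.+1 = E N z j + (N%:R^-1)%:C *: (z 0 0 *: v (E N z j)) by [].
have F0 (N : nat) (z : 'rV[C]_d.+1) :
  F N z 0%N = 1%:M - (delta_mx 0 0 : 'cV[C]_d.+1) *m (delta_mx 0 0 : 'rV[C]_d.+1) by [].
have FS (N : nat) (z : 'rV[C]_d.+1) j : F N z j.+1 = F N z j + (N%:R^-1)%:C *:
  ((delta_mx 0 0 : 'cV[C]_d.+1) *m v (E N z j) + z 0 0 *: (F N z j *m J (E N z j))) by [].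
have [Phi hPhi] := euler_limit k1 hv dl0 dle dlk E0 ES.
exists Phi, dl; split=> //.
- exact: (flow0 dl0 E0 ES hPhi).
- move=> x y; rewrite !subr0 => hx hy.
  exact: (flow_half_close k1 v0 hv dl0 dle dlk E0 ES hPhi hx hy).
- move=> z hz; apply: (@le_lt_trans _ _ (2 * (k * dl))).
    exact: (flow_bound k1 hv dl0 dle E0 ES hPhi hz).
  apply: (@lt_le_trans _ _ e); last by rewrite ge_min lexx.
  by have := mulr_gt0 k0 dl0; lra.
- move=> z hz.
  have [K hK hK0] := flow_jacobian k1 v0 hv dl0 dle dlk dld E0 ES F0 FS hPhi hz.
  have r0 : 0 < dl - nr z by rewrite subr_gt0.
  have [|dP DP] := @quadratic_is_diff _ _ _ Phi z K (24 * k) _ r0.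
    move=> y hy; apply: hK; have := nrD (y - z) z; rewrite subrK; lra.
  by split=> //; rewrite DP.
Qed.

End Flow.

(** * Foliations by integral curves *)

Section Foliation.
Context {R : realType}.
Local Notation C := R[i].

Lemma connected_nrball n (e : R) : connected [set s : 'rV[C]_n | nr s < e].
Proof.
have [e0|e0] := ltP 0 e; last first.
  rewrite (_ : [set s | _] = set0); first exact: connected0.
  by apply/seteqP; split=> // s /=; rewrite ltNge (le_trans e0) ?nr_ge0.
pose A (s : 'rV[C]_n) := (fun t : R => t%:C *: s) @` `[0, 1]%classic.
rewrite (_ : [set s | _] = \bigcup_(s in [set s : 'rV[C]_n | nr s < e]) A s).
  apply: bigcup_connected.
    by exists 0 => s _; exists 0; rewrite ?rmorph0 ?scale0r //= in_itv /= lexx ler01.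
  move=> s _; apply: connected_continuous_connected.
    exact: segment_connected.
  apply: continuous_subspaceT => t P /nbhs_nr [d d0 hd].
  have k0 : 0 < nr s + 1 by rewrite ltr_wpDl ?nr_ge0.
  apply/nbhs_normP; exists (d / (nr s + 1)) => /=; first by rewrite divr_gt0.
  move=> t' /=; rewrite ltr_pdivlMr // => ht; apply: hd.
  rewrite -scalerBl -rmorphB nrZ nrR distrC.
  by apply: le_lt_trans ht; rewrite ler_wpM2l // lerDl.
apply/seteqP; split=> [s hs|_ [s hs [t t01 <-]]] /=.
  by exists s => //; exists 1; rewrite ?rmorph1 ?scale1r //= in_itv /= lexx ler01.
move: t01; rewrite /= in_itv /= => /andP[t0 t1]; rewrite nrZ nrR ger0_norm //.
by apply: le_lt_trans hs; rewrite ler_piMl ?nr_ge0.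
Qed.

Lemma derive_affine k m n (f : 'rV[C]_k -> 'rV[C]_m) (a : 'rV[C]_n)
    (P : 'M[C]_(m, n)) x : differentiable f x ->
  differentiable (fun y => a + f y *m P) x /\
  forall v, 'D_v (fun y => a + f y *m P) x = 'D_v f x *m P.
Proof.
move=> df; suff [h1 h2] : is_diff x (fun y => a + f y *m P) (mulmxr ('J f x *m P)).
  by split=> // v; rewrite (deriveE v h1) h2 /= mulmxA -deriveEjacobian.
apply: is_diff_nr; first exact: continuous_mulmxr.
move=> e e0; have k0 : 0 < m%:R * nr P + 1 by rewrite ltr_wpDl ?mulr_ge0 ?nr_ge0.
have [d d0 hd] := differentiable_nr df (divr_gt0 e0 k0).
exists d => // y /hd; rewrite -deriveE // deriveEjacobian // => h.
rewrite /= (_ : _ - _ = (f y - f x - (y - x) *m 'J f x) *m P); last first.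
  rewrite [RHS]mulmxBl (mulmxBl (f y)) mulmxA opprD addrACA subrr add0r.
  by [].
apply: (le_trans (nr_mulmx _ _)).
apply: (@le_trans _ _ (e / (m%:R * nr P + 1) * nr (y - x) * (m%:R * nr P + 1))).
  rewrite mulrCA; apply: ler_pM; rewrite ?nr_ge0 ?mulr_ge0 ?nr_ge0 ?lerDl //.
by rewrite mulrAC divfK // gt_eqF.
Qed.

Lemma complete_row n (w : 'rV[C]_n.+1) : w != 0 ->
  exists2 P : 'M[C]_n.+1, P \in unitmx & delta_mx 0 0 *m P = w.
Proof.
move=> w0; have rw : \rank w = 1%N by rewrite rank_rV w0.
have c0 : col_ebase w 0 0 != 0.
  have := col_ebase_unit w; rewrite unitmxE unitfE.
  by rewrite [col_ebase w]mx11_scalar det_scalar1 mxE eqxx.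
exists (col_ebase w 0 0 *: row_ebase w).
  by rewrite unitmxZ ?unitfE // row_ebase_unit.
rewrite -[RHS]mulmx_ebase rw -scalemxAr [col_ebase w in RHS]mx11_scalar.
rewrite mul_scalar_mx -scalemxAl; congr (_ *: (_ *m _)).
by apply/matrixP => i j; rewrite !mxE !ord1 /=; case: j => -[].
Qed.

(** Linear coordinates P take v u0 to the first axis; the flow, being close to the
    identity in these coordinates, is a chart, and its leaves are the integral
    curves of v. *)
Lemma foliation_of_field n (M : set 'rV[C]_n.+1) u0 (v : 'rV[C]_n.+1 -> 'rV[C]_n.+1)
    (e : R) : c11mx u0 v -> v u0 != 0 -> 0 < e ->
  (forall u, nr (u - u0) < e -> M u) ->
  exists (S : set 'rV[C]_1) (W : set 'rV[C]_n.+1.-1)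
         (Phi : 'rV[C]_(1 + n.+1.-1) -> 'rV[C]_n.+1),
    foliation_chart M u0 S W Phi /\
    forall z, box S W z -> leaf_direction Phi z = v (Phi z).
Proof.
move=> cv v0 e0 hM; have [P uP hP] := complete_row v0.
pose w x := v (u0 + x *m P) *m invmx P.
have caff : c11mx 0 (fun x : 'rV[C]_n.+1 => u0 + x *m P).
  move=> i j; rewrite (_ : (fun _ => _) = (fun x => u0 i j + (x *m P) i j)).
    apply: c11D; first exact: c11_cst.
    apply: (c11mx_mul (f := fun x => x)) => [a b|]; last exact: c11mx_cst.
    by rewrite ord1; exact: c11_coord.
  by apply/funext => x; rewrite mxE.
have cw : c11mx 0 w.
  apply: c11mx_mul; last exact: c11mx_cst.
  by move=> i j; apply: (c11_comp caff (f := fun x => v x i j)); rewrite mul0mx addr0.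
have w0 : w 0 = delta_mx 0 0 by rewrite /w mul0mx addr0 -hP mulmxK.
have k0 : 0 < n.+1%:R * nr P + 1 by rewrite ltr_wpDl ?mulr_ge0 ?nr_ge0.
have [F [dl [dl0 F0 hF Fe dF]]] := local_flow cw w0 (divr_gt0 e0 k0).
pose Phi (z : 'rV[C]_(1 + n)) : 'rV[C]_n.+1 := u0 + F z *m P.
pose S := [set s : 'rV[C]_1 | nr s < dl]; pose W := [set w : 'rV[C]_n | nr w < dl].
have boxE (z : 'rV[C]_(1 + n)) : box (r := n.+1) S W z <-> nr z < dl.
  split=> [[/= h1 h2]|h].
    rewrite -(hsubmxK z); pose m := Num.max (nr (lsubmx z)) (nr (rsubmx z)).
    apply: (@le_lt_trans _ _ m); last by rewrite gt_max h1.
    apply: nr_mx_le => [|i j]; first by rewrite le_max nr_ge0.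
    rewrite mxE; case: splitP => k _; rewrite le_max nr_coord ?orbT //.
  by split=> /=; apply: le_lt_trans h;
    [apply: (nr_sub_mx (f := id) (g := lshift n)) => i j; rewrite mxE
    | apply: (nr_sub_mx (f := id) (g := @rshift 1 n)) => i j; rewrite mxE].
have PhiM z : nr z < dl -> nr (Phi z - u0) < e.
  move=> /Fe; rewrite ltr_pdivlMr // => h; rewrite /Phi addrC addKr.
  apply: le_lt_trans h; apply: (le_trans (nr_mulmx _ _)).
  by rewrite mulrDr mulr1 mulrCA ler_wpDr ?nr_ge0.
have dPhi z : nr z < dl -> differentiable Phi z /\ forall x, 'D_x Phi z = 'D_x F z *m P.
  by move=> /dF[dFz _]; exact: derive_affine.
exists S, W, Phi; split; last first.
  move=> z /boxE hz; rewrite /leaf_direction.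
  have [_ ->] := dPhi z hz; have [_ hD] := dF z hz.
  rewrite (_ : delta_mx 0 (lshift n ord0) = delta_mx 0 0); last first.
    by congr delta_mx; apply/val_inj.
  by rewrite hD /w mulmxKV.
have oB : open [set z : 'rV[C]_n.+1 | nr (z - 0) < dl] by exact: open_nrball.
split.
- by have := @open_nrball _ _ (0 : 'rV[C]_1) dl; rewrite /S; under eq_set do rewrite subr0.
- exact: connected_nrball.
- by have := @open_nrball _ _ (0 : 'rV[C]_n) dl; rewrite /W; under eq_set do rewrite subr0.
- have oF := half_close_open hF oB (fun x hx => hx).
  apply/open_nr => _ [z /boxE hz <-].
  have Fz : (F @` [set z | nr (z - 0) < dl]) (F z) by exists z; rewrite //= subr0.
  have [c c0 hc] := (open_nr _).1 oF _ Fz.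
  have q0 : 0 < n.+1%:R * nr (invmx P) + 1 by rewrite ltr_wpDl ?mulr_ge0 ?nr_ge0.
  exists (c / (n.+1%:R * nr (invmx P) + 1)); first by rewrite divr_gt0.
  move=> y; rewrite ltr_pdivlMr // => hy.
  have [|z' /= hz' hF'] := hc ((y - u0) *m invmx P).
    have -> : F z = (Phi z - u0) *m invmx P by rewrite /Phi addrC addKr mulmxK.
    rewrite -mulmxBl opprB addrA subrK.
    apply: le_lt_trans hy; apply: (le_trans (nr_mulmx _ _)).
    by rewrite mulrDr mulr1 mulrCA ler_wpDr ?nr_ge0.
  exists z'; first by apply/boxE; rewrite subr0 in hz'.
  by rewrite /Phi hF' mulmxKV // addrC subrK.
- by move=> _ [z /boxE hz <-]; apply: hM; exact: PhiM.
- by exists 0; [apply/boxE; rewrite nr0 | rewrite /Phi F0 mul0mx addr0].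
- move=> x y; rewrite !inE => /boxE hx /boxE hy /addrI /(congr1 (mulmx^~ (invmx P))).
  rewrite !mulmxK // => hxy; apply: (half_close_inj hF) => //; by rewrite subr0.
- by move=> z /boxE /dPhi[].
- move=> z /boxE hz; have [dp dP] := dPhi z hz; have [df _] := dF z hz.
  have -> : 'J Phi z = 'J F z *m P.
    by apply: jacobianE => // x; rewrite dP deriveEjacobian // mulmxA.
  have := half_close_free hF (x := z); rewrite subr0 => /(_ hz df).
  by rewrite /row_free mxrankMfree // row_free_unit.
Qed.

End Foliation.

(** * Fields of eigenvectors *)

Section Eigenvectors.
Context {R : realType}.
Local Notation C := R[i].

(** Composition with the inverse Jacobian reduces to Jacobian 1. *)
Lemma c11_local_inverse d (f : 'rV[C]_d -> 'rV[C]_d) x0 J e k :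
  c11v_on x0 f J e k -> J x0 \in unitmx ->
  exists g e', [/\ c11mx (f x0) g, 0 < e', g (f x0) = x0 &
    forall y, nr (y - f x0) < e' -> f (g y) = y].
Proof.
move=> hf uJ; have x0in : nr (x0 - x0) < e by rewrite subrr nr0; case: hf.
have cf := c11v_on_c11 hf; have [df Df] := c11v_diff hf x0in.
pose f1 x := f x *m invmx (J x0).
have cf1 : c11mx x0 f1 by apply: c11mx_mul => //; exact: c11mx_cst.
have Df1 v : 'D_v f1 x0 = v.
  have [_ h] := derive_affine 0 (invmx (J x0)) df.
  rewrite (_ : f1 = (fun y => 0 + f y *m invmx (J x0))).
    by rewrite h Df mulmxK.
  by apply/funext => y; rewrite add0r.
have [g [e1 [cg e10 gx0 fg]]] := c11_local_inverse_id cf1 Df1.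
have k0 : 0 < d%:R * nr (invmx (J x0)) + 1 by rewrite ltr_wpDl ?mulr_ge0 ?nr_ge0.
exists (fun y => g (y *m invmx (J x0))), (e1 / (d%:R * nr (invmx (J x0)) + 1)).
split=> //; last 2 first.
- by rewrite divr_gt0.
- move=> y; rewrite ltr_pdivlMr // => hy.
  have := fg (y *m invmx (J x0)); rewrite /f1 -mulmxBl => /(_ _) h.
  have := h (le_lt_trans (nr_mulmx _ _) (le_lt_trans _ hy)).
  rewrite mulrDr mulr1 mulrCA => /(_ (ler_wpDr (nr_ge0 _) (lexx _))).
  by move=> /(congr1 (mulmx^~ (J x0))); rewrite !mulmxKV.
move=> i j; apply: (c11_comp (f := fun x => g x i j)); last exact: cg.
apply: (c11mx_mul (f := id)); last exact: c11mx_cst.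
by move=> a b; rewrite ord1; exact: c11_coord.
Qed.

(** Division by t, which then tends to 0. *)
Lemma linear_le_quadratic (a K e : R) : 0 < e -> 0 <= a ->
  (forall t, 0 < t < e -> t * a <= K * t ^+ 2) -> a = 0.
Proof.
move=> e0 a0 h; apply/eqP; rewrite eq_le a0 andbT leNgt; apply/negP => a1.
have k0 : 0 < 2 * (`|K| + 1) by rewrite mulr_gt0 // ltr_wpDl.
pose t := Num.min e (a / (2 * (`|K| + 1))) / 2.
have m0 : 0 < Num.min e (a / (2 * (`|K| + 1))) by rewrite lt_min e0 divr_gt0.
have t0 : 0 < t by rewrite divr_gt0.
have : t < Num.min e (a / (2 * (`|K| + 1))) by rewrite /t; lra.
rewrite lt_min ltr_pdivlMr // => /andP[te tK].
have := h t; rewrite t0 te => /(_ isT); rewrite expr2 mulrCA ler_pM2l // => h1.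
have := ler_norm K; have := normr_ge0 K; nra.
Qed.

Section OneEigenvector.
Variables (d n : nat) (u0 : 'rV[C]_d) (Q : 'rV[C]_d -> 'M[C]_n) (mu : 'I_n -> C)
  (p : 'I_n).
Hypothesis cQ : c11mx u0 Q.
Hypothesis Q0 : Q u0 = \matrix_(i, j) (mu i *+ (i == j)).
Hypothesis mu_inj : injective mu.

(* The zeros of eqn near (u0, e_p) are the pairs of u and an eigenvector of Q u
   normalised to have p-th coordinate 1; its eigenvalue is then (y Q u)_p. *)
Let eqn (u : 'rV[C]_d) (y : 'rV[C]_n) : 'rV[C]_n := \row_q
  ((y *m Q u) 0 q - (y *m Q u) 0 p * y 0 q + (mu p + 1) * (y 0 p - 1) *+ (q == p)).

Let eqnE u y q : eqn u y 0 q = (y *m Q u) 0 q - (y *m Q u) 0 p * y 0 q +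
  (mu p + 1) * (y 0 p - 1) *+ (q == p).
Proof. exact: mxE. Qed.

Let F (x : 'rV[C]_(d + n)) : 'rV[C]_(d + n) :=
  row_mx (lsubmx x) (eqn (lsubmx x) (rsubmx x)).

Let x0 : 'rV[C]_(d + n) := row_mx u0 (delta_mx 0 p).

Let cl : c11mx x0 (fun x : 'rV[C]_(d + n) => lsubmx x).
Proof.
move=> i j; rewrite (_ : (fun _ => _) = (fun x : 'rV[C]_(d + n) => x 0 (lshift n j))).
  exact: c11_coord.
by apply/funext => x; rewrite mxE ord1.
Qed.

Let cr : c11mx x0 (fun x : 'rV[C]_(d + n) => rsubmx x).
Proof.
move=> i j; rewrite (_ : (fun _ => _) = (fun x : 'rV[C]_(d + n) => x 0 (rshift d j))).
  exact: c11_coord.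
by apply/funext => x; rewrite mxE ord1.
Qed.

Let cyQ : c11mx x0 (fun x : 'rV[C]_(d + n) => rsubmx x *m Q (lsubmx x)).
Proof.
apply: c11mx_mul => // i j.
apply: (c11_comp (f := fun u => Q u i j) cl).
by rewrite row_mxKl; exact: cQ.
Qed.

Let cF : c11mx x0 F.
Proof.
move=> i j; rewrite ord1; rewrite /F.
rewrite (_ : (fun _ => _) = (fun x => match fintype.split j with inl a => lsubmx x 0 a
   | inr b => eqn (lsubmx x) (rsubmx x) 0 b end)); last by apply/funext => x; rewrite mxE.
case: (fintype.split j) => [a|b]; first exact: cl.
rewrite (_ : (fun _ => _) = (fun x : 'rV[C]_(d + n) => (rsubmx x *m Q (lsubmx x)) 0 b +
   (- ((rsubmx x *m Q (lsubmx x)) 0 p * rsubmx x 0 b) +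
    (mu p + 1) *+ (b == p) * (rsubmx x 0 p + -1)))).
  apply: c11D; first exact: cyQ.
  apply: c11D; first by apply: c11N; apply: c11M; [exact: cyQ | exact: cr].
  by apply: c11M; [exact: c11_cst | apply: c11D; [exact: cr | exact: c11_cst]].
by apply/funext => x; rewrite eqnE; case: (b == p); rewrite ?mulr1n ?mulr0n; ring.
Qed.

Let mulQ0 (y : 'rV[C]_n) q : (y *m Q u0) 0 q = y 0 q * mu q.
Proof.
rewrite mxE (bigD1 q) //= Q0 mxE eqxx mulr1n big1 ?addr0 // => i iq.
by rewrite mxE (negPf iq) mulr0n mulr0.
Qed.

Let Fx0 : F x0 = row_mx u0 0.
Proof.
rewrite /F /x0 row_mxKl row_mxKr; congr row_mx; apply/rowP => q.
rewrite eqnE !mulQ0 !mxE !eqxx /= mulr1n subrr mulr0 mul0rn addr0.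
by case: (q =P p) => [->|_] /=; rewrite ?mul1r ?mulr1 ?subrr // !mul0r mulr0 subrr.
Qed.

Let FJ J e k : c11v_on x0 F J e k -> J x0 \in unitmx.
Proof.
move=> [e0 k0 h]; rewrite -row_free_unit -kermx_eq0.
apply/rowV0P => v /sub_kermxP vJ.
have x0in : nr (x0 - x0) < e by rewrite subrr nr0.
have n1 : 0 < nr v + 1 by rewrite ltr_wpDl ?nr_ge0.
pose e' := e / (nr v + 1); have e'0 : 0 < e' by rewrite divr_gt0.
(* Along a kernel vector v of the Jacobian F varies quadratically, so the linear
   part in t of each of its coordinates vanishes. *)
have small (t : R) : 0 < t < e' -> nr (F (x0 + t%:C *: v) - F x0) <= k * nr v ^+ 2 * t ^+ 2.
  move=> /andP[t0]; rewrite ltr_pdivlMr // => te.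
  have E : x0 + t%:C *: v - x0 = t%:C *: v by rewrite addrC addKr.
  have := h x0 (x0 + t%:C *: v) x0in; rewrite E nrZ nrR gtr0_norm //.
  have te' : t * nr v < e by apply: le_lt_trans te; rewrite ler_pM2l // lerDl.
  move=> /(_ te') [_ _ _ + _]; rewrite -scalemxAl vJ scaler0 subr0 exprMn.
  by rewrite -mulrA (mulrC (nr v ^+ 2)).
have Fc (t : R) j : 0 < t < e' -> nr (F (x0 + t%:C *: v) 0 j - F x0 0 j) <=
    k * nr v ^+ 2 * t ^+ 2.
  move=> /small; apply: le_trans.
  by have := nr_coord (F (x0 + t%:C *: v) - F x0) 0 j; rewrite !mxE.
have vl : lsubmx v = 0.
  apply/rowP => a; rewrite [RHS]mxE; apply: nr_le0; rewrite le_eqVlt; apply/orP; left.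
  apply/eqP; apply: (linear_le_quadratic (K := k * nr v ^+ 2) e'0 (nr_ge0 _)) => t te.
  apply: le_trans (Fc t (lshift n a) te); rewrite !row_mxEl.
  have -> : lsubmx (x0 + t%:C *: v) 0 a - lsubmx x0 0 a = t%:C * lsubmx v 0 a.
    by rewrite !mxE; ring.
  by case/andP: te => t0 _; rewrite nrM nrR gtr0_norm.
pose y := rsubmx v.
have vE : v = row_mx 0 y by rewrite -vl hsubmxK.
have xE (t : R) : x0 + t%:C *: v = row_mx u0 (delta_mx 0 p + t%:C *: y).
  by rewrite vE scale_row_mx scaler0 add_row_mx addr0.
have comp (t : R) q : F (x0 + t%:C *: v) 0 (rshift d q) - F x0 0 (rshift d q) =
  eqn u0 (delta_mx 0 p + t%:C *: y) 0 q.
  by rewrite Fx0 xE /F row_mxKl row_mxKr !row_mxEr [X in _ - X]mxE subr0.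
suff y0 q : y 0 q = 0.
  by rewrite vE (_ : y = 0) ?row_mx0 //; apply/rowP => q; rewrite y0 mxE.
pose a := if q == p then 1 else mu q - mu p.
have a0 : a != 0.
  rewrite /a; case: (q =P p) => [_|qp]; first exact: oner_neq0.
  by rewrite subr_eq0; apply/eqP => /mu_inj.
suff : nr (a * y 0 q) = 0.
  by move/eqP; rewrite nr_eq0 mulf_eq0 (negPf a0) => /eqP.
pose K := k * nr v ^+ 2 + nr (mu p * y 0 p * y 0 q).
apply: (linear_le_quadratic (K := K) e'0 (nr_ge0 _)) => t te.
have := Fc t (rshift d q) te; rewrite comp; case/andP: te => t0 _.
have -> : eqn u0 (delta_mx 0 p + t%:C *: y) 0 q =
   t%:C * (a * y 0 q) - (t ^+ 2)%:C * (mu p * y 0 p * y 0 q).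
  rewrite eqnE !mulQ0 !mxE eqxx /= rmorphXn /= /a.
  by case: (q =P p) => [->|_] /=; rewrite ?mulr1n ?mulr0n ?eqxx /=; ring.
set A := t%:C * _; set B := _ * (mu p * _ * _) => h1.
have h2 : nr B <= nr (mu p * y 0 p * y 0 q) * t ^+ 2.
  by rewrite /B nrM nrR (ger0_norm (exprn_ge0 2 (ltW t0))) mulrC.
have := nrD_le h1 h2; rewrite subrK /A nrM nrR gtr0_norm // /K mulrDl //.
Qed.

(** The implicit equation eqn u y = 0 is solved by the local inverse of F: its
    Jacobian at (u0, e_p) is diagonal in y, with entries mu_q - mu_p, and 1 at
    q = p. *)
Lemma diagonal_eigen_field : exists (y : 'rV[C]_d -> 'rV[C]_n) (lam : 'rV[C]_d -> C) (e : R),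
  [/\ c11mx u0 y, c11 u0 lam, 0 < e, y u0 = delta_mx 0 p /\ lam u0 = mu p &
    forall u, nr (u - u0) < e -> y u *m Q u = lam u *: y u].
Proof.
have [J [e [k hF]]] := c11v_exists cF.
have [g [e1 [cg e10 g0 Fg]]] := c11_local_inverse hF (FJ hF).
rewrite Fx0 in cg g0 Fg.
have czero : c11mx u0 (fun u : 'rV[C]_d => row_mx u (0 : 'rV[C]_n)).
  move=> i j; rewrite (_ : (fun _ => _) = (fun u : 'rV[C]_d => match fintype.split j with
    inl a => u 0 a | inr b => 0 end)).
    by case: (fintype.split j) => a; [exact: c11_coord | exact: c11_cst].
  by apply/funext => u; rewrite mxE ord1; case: (fintype.split j) => // b; rewrite mxE.
pose y (u : 'rV[C]_d) := rsubmx (g (row_mx u 0)).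
have cy : c11mx u0 y.
  move=> i j; rewrite (_ : (fun _ => _) = (fun u => g (row_mx u 0) i (rshift d j))).
    exact: (c11_comp (f := fun x => g x i (rshift d j)) czero).
  by apply/funext => u; rewrite mxE.
have cyq : c11mx u0 (fun u => y u *m Q u) by apply: c11mx_mul.
pose lam u := (y u *m Q u) 0 p.
have y0 : y u0 = delta_mx 0 p by rewrite /y g0 row_mxKr.
have lam0 : lam u0 = mu p by rewrite /lam mulQ0 y0 mxE !eqxx mul1r.
have cl' : c11 u0 lam by exact: cyq.
have [||e2 e20 hne] := @c11_neq0 _ _ u0 (fun u => mu p + 1 + - lam u).
- by apply: c11D; [exact: c11_cst | exact: c11N].
- by rewrite lam0 addrC addKr oner_eq0.
exists y, lam, (Num.min e1 e2); split=> //; first by rewrite lt_min e10.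
move=> u; rewrite lt_min => /andP[h1 h2].
have gu : F (g (row_mx u 0)) = row_mx u 0.
  apply: Fg; rewrite opp_row_mx add_row_mx subrr.
  apply: le_lt_trans h1; apply: nr_mx_le => [|i j]; first exact: nr_ge0.
  by rewrite mxE; case: (fintype.split j) => a; rewrite ?nr_coord // mxE nr0 nr_ge0.
have [gl gr] := eq_row_mx gu.
rewrite gl -/(y u) in gr.
(* The p-th equation is (mu_p + 1 - lam) (y_p - 1) = 0. *)
have yp : y u 0 p = 1.
  have := congr1 (fun m : 'rV[C]_n => m 0 p) gr; rewrite eqnE [RHS]mxE eqxx mulr1n -/(lam u).
  move=> h3; have : (mu p + 1 + - lam u) * (y u 0 p - 1) = 0.
    by rewrite -[RHS]h3; ring.
  move/eqP; rewrite mulf_eq0 (negPf (hne u h2)) subr_eq0 => /eqP //.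
apply/rowP => q; rewrite [RHS]mxE.
have := congr1 (fun m : 'rV[C]_n => m 0 q) gr; rewrite eqnE [RHS]mxE yp subrr mulr0 mul0rn addr0.
by move/eqP; rewrite subr_eq0 => /eqP.
Qed.

End OneEigenvector.

(** The rows of V are a basis in which Q u0 is diagonal; the eigenvalues remain
    distinct nearby by continuity. *)
Lemma eigen_fields d n (u0 : 'rV[C]_d) (Q : 'rV[C]_d -> 'M[C]_n) (mu : 'I_n -> C)
    (V : 'M[C]_n) : c11mx u0 Q -> V \in unitmx -> injective mu ->
  (forall p, row p V *m Q u0 = mu p *: row p V) ->
  exists (y : 'I_n -> 'rV[C]_d -> 'rV[C]_n) (lam : 'I_n -> 'rV[C]_d -> C) (e : R),
  0 < e /\
  forall p, [/\ c11mx u0 (y p), y p u0 = row p V, forall u, nr (u - u0) < e ->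
      y p u *m Q u = lam p u *: y p u &
    forall q u, nr (u - u0) < e -> p != q -> lam p u != lam q u].
Proof.
move=> cQ uV mu_inj hV; pose Q1 u := V *m Q u *m invmx V.
have cQ1 : c11mx u0 Q1.
  by apply: c11mx_mul; [apply: c11mx_mul => //; exact: c11mx_cst | exact: c11mx_cst].
have Q10 : Q1 u0 = \matrix_(i, j) (mu i *+ (i == j)).
  apply/row_matrixP => i; rewrite /Q1 !row_mul hV -scalemxAl -row_mul mulmxV //.
  by apply/rowP => j; rewrite !mxE; case: (i == j); rewrite ?mulr1 ?mulr0.
have /choice [t ht] p : exists t : ('rV[C]_d -> 'rV[C]_n) * ('rV[C]_d -> C) * R,
  [/\ c11mx u0 t.1.1, c11 u0 t.1.2, 0 < t.2, t.1.1 u0 = delta_mx 0 p /\ t.1.2 u0 = mu p &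
    forall u, nr (u - u0) < t.2 -> t.1.1 u *m Q1 u = t.1.2 u *: t.1.1 u].
  have [y [lam [e h]]] := diagonal_eigen_field p cQ1 Q10 mu_inj.
  by exists (y, lam, e).
pose lam p := (t p).1.2.
have [||e1 e10 he1] := @finite_nearness R 'I_n (fun p e => forall u, nr (u - u0) < e ->
    (t p).1.1 u *m Q1 u = lam p u *: (t p).1.1 u).
- by move=> p a b a0 ab h u hu; apply: h; apply: lt_le_trans hu ab.
- by move=> p; have [_ _ e0 _ h] := ht p; exists (t p).2.
have [||e2 e20 he2] := @finite_nearness R ('I_n * 'I_n)%type (fun pq e => forall u,
    nr (u - u0) < e -> pq.1 != pq.2 -> lam pq.1 u != lam pq.2 u).
- by move=> p a b a0 ab h u hu; apply: h; apply: lt_le_trans hu ab.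
- move=> [p q]; have [pq|pq] := eqVneq p q.
    by exists 1 => // u _ /=; rewrite pq eqxx.
  have [_ cp _ [_ lp] _] := ht p; have [_ cq _ [_ lq] _] := ht q.
  have [||e e0 he] := @c11_neq0 _ _ u0 (fun u => lam p u + - lam q u).
  - by apply: c11D => //; exact: c11N.
  - by rewrite /lam lp lq subr_eq0; apply/eqP => /mu_inj /eqP; exact/negP.
  by exists e => // u /he; rewrite subr_eq0.
exists (fun p u => (t p).1.1 u *m V), lam, (Num.min e1 e2).
split; first by rewrite lt_min e10.
move=> p; have [cp _ _ [tp _] _] := ht p; split.
- by apply: c11mx_mul => //; exact: c11mx_cst.
- by rewrite tp -rowE.
- move=> u; rewrite lt_min => /andP[/he1 h _]; have := h p.
  rewrite /Q1 !mulmxA => /(congr1 (mulmx^~ V)); rewrite mulmxKV // => ->.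
  by rewrite scalemxAl.
- by move=> q u; rewrite lt_min => /andP[_ /he2 h] pq; exact: (h (p, q)).
Qed.

End Eigenvectors.

(** * Unique factorisation of polynomials *)

Definition divides (A : idomainType) (a b : A) : Prop := exists c, b = c * a.

Definition prime_element (A : idomainType) (p : A) : Prop :=
  [/\ p != 0, p \isn't a GRing.unit &
      forall a b, divides p (a * b) -> divides p a \/ divides p b].

Definition factors (A : idomainType) (a : A) : Prop := exists (u : A) (s : seq A),
  [/\ u \is a GRing.unit, forall p, p \in s -> prime_element p & a = u * \prod_(p <- s) p].

(** A unique factorisation domain: uniqueness follows from the factors being
    primes rather than irreducible elements. *)
Definition factorial (A : idomainType) : Prop := forall a : A, a != 0 -> factors a.

Section Divides.
Context {A : idomainType}.
Implicit Types a b c p : A.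

Lemma divides_mulr a b c : divides a b -> divides a (c * b).
Proof. by move=> [d ->]; exists (c * d); rewrite mulrA. Qed.

Lemma divides_mull a b c : divides a b -> divides a (b * c).
Proof. by rewrite mulrC; exact: divides_mulr. Qed.

Lemma dividesD a b c : divides a b -> divides a c -> divides a (b + c).
Proof. by move=> [d ->] [e ->]; exists (d + e); rewrite mulrDl. Qed.

Lemma dividesBr a b c : divides a (b + c) -> divides a c -> divides a b.
Proof. by move=> [d dE] [e eE]; exists (d - e); rewrite mulrBl -dE -eE addrK. Qed.

Lemma divides0 a : divides a 0.
Proof. by exists 0; rewrite mul0r. Qed.

Lemma divides_sum (I : Type) (s : seq I) (P : pred I) (f : I -> A) a :
  (forall i, P i -> divides a (f i)) -> divides a (\sum_(i <- s | P i) f i).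
Proof.
move=> h; elim/big_ind: _ => //; first exact: divides0.
exact: dividesD.
Qed.

Lemma prime_divides_prod p (s : seq A) : prime_element p ->
  divides p (\prod_(q <- s) q) -> exists2 q, q \in s & divides p q.
Proof.
move=> hp; have [_ pu hM] := hp; elim: s => [|q s ih].
  rewrite big_nil => -[c cE]; case/negP: pu; apply/unitrP.
  by exists c; rewrite -cE mulrC -cE.
rewrite big_cons => /hM [h|/ih [q' q's h]]; first by exists q; rewrite ?mem_head.
by exists q'; rewrite // inE q's orbT.
Qed.

Lemma prime_irreducible p a b : prime_element p -> p = a * b ->
  a \is a GRing.unit \/ b \is a GRing.unit.
Proof.
move=> [p0 pu hM] pE.
have aux x y : p = x * y -> divides p x -> y \is a GRing.unit.
  move=> pxy [c cE]; apply/unitrP; exists c.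
  have : p * (c * y) = p * 1 by rewrite mulr1 [in RHS]pxy cE; ring.
  by move/(mulfI p0) => h; rewrite h mulrC h.
have [|h|h] := hM a b; first by exists 1; rewrite mul1r pE.
  by right; exact: aux pE h.
by left; apply: (aux b a) => //; rewrite mulrC.
Qed.

End Divides.

Section Gauss.
Context {A : idomainType}.
Implicit Types (f g d k : {poly A}).

Lemma divides_polyC (p : A) f : divides p%:P f <-> forall i, divides p f`_i.
Proof.
split=> [[g ->] i|h]; first by exists g`_i; rewrite coefMC.
have [c hc] := choice h; exists (\poly_(i < size f) c i).
apply/polyP => i; rewrite coefMC coef_poly; case: ltnP => hi; first exact: hc.
by rewrite nth_default // mul0r.
Qed.

(** Gauss: look at the lowest coefficients that p does not divide. *)
Lemma prime_polyC (p : A) : prime_element p -> prime_element p%:P.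
Proof.
move=> [p0 pu hM]; split; first by rewrite polyC_eq0.
  apply/negP => /unitrP [g [h _]]; case/negP: pu; apply/unitrP.
  exists g`_0; have := congr1 (fun q : {poly A} => q`_0) h.
  by rewrite coefMC coef1 eqxx mulr1n => h1; split; rewrite // mulrC.
move=> f g hfg; apply: contrapT => /not_orP [nf ng].
have ex q : ~ divides p%:P q -> exists i, `[< ~ divides p q`_i >].
  by rewrite divides_polyC => /existsNP [i hi]; exists i; apply/asboolP.
have [i /asboolP fi imin] := ex_minnP (ex f nf).
have [j /asboolP gj jmin] := ex_minnP (ex g ng).
have fl a : (a < i)%N -> divides p f`_a.
  by move=> ai; apply: contrapT => h; have := imin a (asboolT h); rewrite leqNgt ai.
have gl a : (a < j)%N -> divides p g`_a.
  by move=> ai; apply: contrapT => h; have := jmin a (asboolT h); rewrite leqNgt ai.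
have := (divides_polyC p (f * g)).1 hfg (i + j)%N; rewrite coefM.
have ij : (i < (i + j).+1)%N by rewrite ltnS leq_addr.
rewrite (bigD1 (Ordinal ij)) //= addKn => h.
have /hM [] // : divides p (f`_i * g`_j).
apply: dividesBr h _; apply: divides_sum => a; rewrite -val_eqE /= => ai.
have [lt|ge] := ltnP a i; first exact/divides_mull/fl.
apply/divides_mulr/gl; have : (i < a)%N by rewrite ltn_neqAle eq_sym ai.
by move=> ia; rewrite ltn_subLR ?ltn_add2r // -ltnS ltn_ord.
Qed.

(** Cancelling a constant from a factorisation, one prime at a time. *)
Lemma strip_constant (c : A) f d k : factorial A -> c != 0 -> c%:P * f = d * k ->
  exists (a b : A) d' k', [/\ f = d' * k', a != 0, b != 0, d = a%:P * d' & k = b%:P * k'].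
Proof.
move=> ufd c0; have [u [s [uu hs ->]]] := ufd c c0.
elim: s d k hs => [|p s ih] d k hs.
  rewrite big_nil mulr1 => h; exists 1, u, d, (u^-1%:P * k); split.
  - by rewrite mulrCA -h mulrA -polyCM mulVr // mul1r.
  - exact: oner_neq0.
  - by apply: contraTneq uu => ->; rewrite unitr0.
  - by rewrite mul1r.
  - by rewrite mulrA -polyCM divrr // mul1r.
have ps : prime_element p by apply: hs; rewrite mem_head.
have hs' q : q \in s -> prime_element q by move=> qs; apply: hs; rewrite inE qs orbT.
have pP := prime_polyC ps; have [p0 _ hM] := pP; have [p0' _ _] := ps.
rewrite big_cons mulrCA polyCM -mulrA => h.
have /hM [[e eE]|[e eE]] : divides p%:P (d * k).
- by rewrite -h mulrC; eexists.
- have h2 : (u * \prod_(q <- s) q)%:P * f = e * k.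
    by apply: (mulfI p0); rewrite h eE; ring.
  have [a [b [d' [k' [h3 a0 b0 h4 h5]]]]] := ih _ _ hs' h2.
  exists (p * a), b, d', k'; split=> //; first by rewrite mulf_neq0.
  by rewrite eE h4 polyCM; ring.
- have h2 : (u * \prod_(q <- s) q)%:P * f = d * e.
    by apply: (mulfI p0); rewrite h eE; ring.
  have [a [b [d' [k' [h3 a0 b0 h4 h5]]]]] := ih _ _ hs' h2.
  exists a, (p * b), d', k'; split=> //; first by rewrite mulf_neq0.
  by rewrite eE h5 polyCM; ring.
Qed.

Definition primitive f := forall c : A, divides c%:P f -> c \is a GRing.unit.

(** Irreducibility over the field of fractions, for factors with coefficients in
    A. *)
Definition no_proper_factor f := forall d k, f = d * k -> (size d <= 1)%N \/ (size k <= 1)%N.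

Lemma size_polyC_mul (a : A) f : a != 0 -> size (a%:P * f) = size f.
Proof. by move=> a0; rewrite mul_polyC size_scale. Qed.

(** A primitive polynomial that does not factor into polynomials of positive
    degree is prime: it divides a, or is coprime to a over the field of
    fractions, and Bezout coefficients then show that it divides b. *)
Lemma prime_primitive f : factorial A -> (1 < size f)%N -> primitive f ->
  no_proper_factor f -> prime_element f.
Proof.
move=> ufd sf prim irr.
have f0 : f != 0 by rewrite -size_poly_gt0 (ltn_trans _ sf).
have strip c e w : c != 0 -> c *: e = w * f -> divides f e.
  move=> c0; rewrite -mul_polyC => h.
  have [a [b [d' [k' [eE a0 b0 dE kE]]]]] := strip_constant ufd c0 h.
  have ub : b \is a GRing.unit by apply: prim; rewrite kE mulrC; eexists.
  have -> : e = (b%:P * b^-1%:P) * (d' * k') by rewrite -polyCM divrr // mul1r.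
  by exists (b^-1%:P * d'); rewrite kE; ring.
split=> //.
  by apply: contraL sf; rewrite poly_unitE => /andP[/eqP ->].
move=> a b [q qE].
have [/Pdiv.Idomain.dvdpP [[c w] /= c0 cw]|nfa] := boolP (Pdiv.Idomain.dvdp f a).
  by left; exact: strip c0 cw.
right; have /Pdiv.Idomain.dvdpP [[c w] /= c0 cw] := Pdiv.Idomain.dvdp_gcdl f a.
have g0 : Pdiv.Idomain.gcdp f a != 0 by rewrite Pdiv.Idomain.gcdp_eq0 (negPf f0).
have sg : (size (Pdiv.Idomain.gcdp f a) <= 1)%N.
  have cw' := cw; rewrite -mul_polyC in cw'.
  have [x [y [d' [k' [fE x0 y0 dE kE]]]]] := strip_constant ufd c0 cw'.
  have [sd|sk] := irr _ _ fE; last by rewrite kE size_polyC_mul.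
  have sw : (size w <= 1)%N by rewrite dE size_polyC_mul.
  have w0 : w`_0 != 0.
    rewrite -polyC_eq0 -size1_polyC //; apply: contraNneq f0 => wz.
    have : c%:P * f == 0 by rewrite cw' wz mul0r.
    by rewrite mulf_eq0 polyC_eq0 (negPf c0).
  case/negP: nfa; apply: Pdiv.Idomain.dvdp_trans (Pdiv.Idomain.dvdp_gcdr f a).
  apply/Pdiv.Idomain.dvdpP; exists (w`_0, c%:P) => //=.
  by rewrite mul_polyC cw -mul_polyC -size1_polyC.
have [[u v] /= /Pdiv.Idomain.eqpP [[c1 c2] /= /andP[c10 c20] E]] := Pdiv.Idomain.Bezoutp f a.
rewrite (size1_polyC sg) in E g0; set e := _`_0 in E g0.
have e0 : e != 0 by rewrite -polyC_eq0.
apply: (strip (c2 * e) _ (c1%:P * (u * b + v * q))); first by rewrite mulf_neq0.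
have : (c1 *: (u * f + v * a)) * b = (c2 *: e%:P) * b by rewrite E.
rewrite -!mul_polyC polyCM => <-.
by rewrite -[RHS]mulrA [in RHS]mulrDl -(mulrA v) -qE; ring.
Qed.

End Gauss.

Lemma factorsM (A : idomainType) (a b : A) : factors a -> factors b -> factors (a * b).
Proof.
move=> [u [s [uu hs ->]]] [v [t [vv ht ->]]]; exists (u * v), (s ++ t); split.
- by rewrite unitrMl.
- by move=> p; rewrite mem_cat => /orP[/hs|/ht].
- by rewrite big_cat /=; ring.
Qed.

Lemma factors_prime (A : idomainType) (a : A) : prime_element a -> factors a.
Proof.
move=> ha; exists 1, [:: a]; split; [exact: unitr1| |by rewrite big_seq1 mul1r].
by move=> p; rewrite inE => /eqP ->.
Qed.

Section FactorialPoly.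
Context {A : idomainType}.
Implicit Types (f g : {poly A}).

Lemma factors_polyC (c : A) : factorial A -> c != 0 -> factors c%:P.
Proof.
move=> ufd /ufd [u [s [uu hs ->]]]; exists u%:P, [seq p%:P | p <- s]; split.
- exact: rmorph_unit.
- by move=> p /mapP [q /hs hq ->]; exact: prime_polyC.
- by rewrite polyCM big_map rmorph_prod.
Qed.

(** The number of prime factors of the leading coefficient bounds the number
    of primes that can be extracted from f. *)
Lemma primitive_part f : factorial A -> f != 0 ->
  exists (c : A) g, [/\ c != 0, f = c%:P * g & primitive g].
Proof.
move=> ufd f0; have [|u [s [uu hs]]] := ufd (lead_coef f); first by rewrite lead_coef_eq0.
elim: {s}(size s).+1 {-2}s (ltnSn (size s)) u uu hs f f0 => // k ih s sk u uu hs f f0 fE.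
have [pf|] := pselect (primitive f).
  by exists 1, f; rewrite oner_eq0 mul1r.
move=> /existsNP [c /not_implyP [[g gE] /negP nc]].
have c0 : c != 0 by apply: contraNneq f0 => c0; rewrite gE c0 mulr0.
have [v [[|p t] [vv ht cE]]] := ufd c c0.
  by rewrite cE big_nil mulr1 vv in nc.
have hp : prime_element p by apply: ht; rewrite mem_head.
pose f1 := g * (v * \prod_(q <- t) q)%:P.
have fp : f = p%:P * f1.
  by rewrite gE cE big_cons /f1 mulrCA polyCM; ring.
have f10 : f1 != 0 by apply: contraNneq f0 => z; rewrite fp z mulr0.
have lf : lead_coef f = p * lead_coef f1 by rewrite fp lead_coefM lead_coefC.
have [p0 pu hM] := hp.
have /hM [[e eE]|/(prime_divides_prod hp) [q qs [d dE]]] : divides p (u * \prod_(q <- s) q).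
- by rewrite -fE lf; exists (lead_coef f1); rewrite mulrC.
- by case/negP: pu; have := uu; rewrite eE unitrM => /andP[].
have du : d \is a GRing.unit.
  by have [//|] := prime_irreducible (hs _ qs) dE; rewrite (negPf pu).
have l1 : lead_coef f1 = (u * d) * \prod_(x <- rem q s) x.
  apply: (mulfI p0); rewrite -lf fE (perm_big _ (perm_to_rem qs)) big_cons /= dE.
  by ring.
have [||x xs|c' [g' [c'0 f1E pg]]] := ih _ _ (u * d) _ _ f1 f10 l1.
- by rewrite size_rem // -ltnS prednK //; case: (s) qs.
- by rewrite unitrMl.
- exact/hs/(mem_rem xs).
by exists (p * c'), g'; split; [rewrite mulf_neq0| rewrite fp f1E polyCM mulrA|].
Qed.

(** Constants factor in A; a primitive polynomial either is prime or splits into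
    factors of smaller degree. *)
Theorem factorial_poly : factorial A -> factorial {poly A}.
Proof.
move=> ufd f; move: {2}(size f).+1 (ltnSn (size f)) => k.
elim: k f => // k ih f sf f0.
have [c [g [c0 fE pg]]] := primitive_part ufd f0.
rewrite fE; apply: factorsM; first exact: factors_polyC.
have g0 : g != 0 by apply: contraNneq f0 => g0; rewrite fE g0 mulr0.
have sg : (size g <= k)%N by move: sf; rewrite fE size_polyC_mul.
have [sg1|sg1] := leqP (size g) 1.
  rewrite (size1_polyC sg1); apply: factors_polyC => //.
  by rewrite -polyC_eq0 -size1_polyC.
have [irr|/existsNP [d /existsNP [h /not_implyP [gE /not_orP [/negP sd /negP sh]]]]] :=
  pselect (no_proper_factor g).
  by apply: factors_prime; exact: prime_primitive.
rewrite -!ltnNge in sd sh.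
have d0 : d != 0 by rewrite -size_poly_gt0 (ltn_trans _ sd).
have h0 : h != 0 by rewrite -size_poly_gt0 (ltn_trans _ sh).
have := sg; rewrite gE size_mul // => sdh.
by apply: factorsM; apply: ih => //; move: sdh sd sh; lia.
Qed.

End FactorialPoly.

Lemma divides_rmorph (A B : idomainType) (f : {rmorphism A -> B}) a b :
  divides a b -> divides (f a) (f b).
Proof. by move=> [c ->]; exists (f c); rewrite rmorphM. Qed.

Section Transport.
Context {A B : idomainType} (f : {rmorphism A -> B}) (g : {rmorphism B -> A}).
Hypotheses (fK : cancel f g) (gK : cancel g f).

Lemma prime_rmorph p : prime_element p -> prime_element (f p).
Proof.
move=> [p0 pu hM]; split.
- by apply: contraNneq p0 => h; rewrite -(fK p) h rmorph0.
- by apply: contraNN pu => h; rewrite -(fK p) rmorph_unit.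
- move=> a b /(divides_rmorph g); rewrite rmorphM fK => /hM [] /(divides_rmorph f).
    by rewrite gK; left.
  by rewrite gK; right.
Qed.

Lemma factorial_rmorph : factorial A -> factorial B.
Proof.
move=> ufd b b0; have [|u [s [uu hs bE]]] := ufd (g b).
  by apply: contraNneq b0 => h; rewrite -(gK b) h rmorph0.
exists (f u), (map f s); split; first exact: rmorph_unit.
  by move=> q /mapP [p /hs hp ->]; exact: prime_rmorph.
by rewrite big_map -rmorph_prod -rmorphM -bE gK.
Qed.

End Transport.

Local Notation Xv K i := (mpoly.mpolyX K (mpoly.mnm1 i)).

Section Variables.
Context {K : fieldType}.

Lemma mpoly_rmorph_eq n (S : nzRingType) (f g : {rmorphism mpoly.mpoly n K -> S}) :
  (forall c, f (mpoly.mpolyC n c) = g (mpoly.mpolyC n c)) ->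
  (forall i, f (Xv K i) = g (Xv K i)) -> f =1 g.
Proof.
move=> hc hX p; rewrite (mpoly.mpolyE p) !rmorph_sum; apply: eq_bigr => m _.
rewrite -mpoly.mul_mpolyC !rmorphM /= hc mpoly.mpolyXE_id !rmorph_prod.
by congr (_ * _); apply: eq_bigr => i _; rewrite !rmorphXn hX.
Qed.

Context {n : nat} (a0 : 'I_n.+1).

(** Polynomials in n + 1 variables are polynomials in the variable a0 whose
    coefficients are polynomials in the others; join_var is the inverse
    isomorphism. *)
Definition split_var : {rmorphism mpoly.mpoly n.+1 K -> {poly mpoly.mpoly n K}} :=
  mpoly.mmap (polyC \o @mpoly.mpolyC n K)
    (fun i => if unlift a0 i is Some j then (Xv K j)%:P else 'X).

Definition join_coef : {rmorphism mpoly.mpoly n K -> mpoly.mpoly n.+1 K} :=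
  mpoly.mmap (@mpoly.mpolyC n.+1 K) (fun j => Xv K (lift a0 j)).

Definition join_var : {rmorphism {poly mpoly.mpoly n K} -> mpoly.mpoly n.+1 K} :=
  horner_eval (Xv K a0) \o map_poly join_coef.

Arguments split_var : simpl never.
Arguments join_coef : simpl never.
Arguments join_var : simpl never.

Lemma split_varC c : split_var (mpoly.mpolyC n.+1 c) = (mpoly.mpolyC n c)%:P.
Proof. by rewrite /split_var /= mpoly.mmapC. Qed.

Lemma split_varX i :
  split_var (Xv K i) = if unlift a0 i is Some j then (Xv K j)%:P else 'X.
Proof. by rewrite /split_var /= mpoly.mmapX mpoly.mmap1U. Qed.

Lemma join_coefC c : join_coef (mpoly.mpolyC n c) = mpoly.mpolyC n.+1 c.
Proof. by rewrite /join_coef /= mpoly.mmapC. Qed.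

Lemma join_coefX j : join_coef (Xv K j) = Xv K (lift a0 j).
Proof. by rewrite /join_coef /= mpoly.mmapX mpoly.mmap1U. Qed.

Lemma join_varC c : join_var c%:P = join_coef c.
Proof. by rewrite /join_var /= map_polyC /horner_eval hornerC. Qed.

Lemma join_varX : join_var 'X = Xv K a0.
Proof. by rewrite /join_var /= map_polyX /horner_eval hornerX. Qed.

Lemma split_varK : cancel split_var join_var.
Proof.
apply: (@mpoly_rmorph_eq _ _ (join_var \o split_var : {rmorphism _ -> _}) idfun) => [c|i].
  by have := congr1 join_var (split_varC c); rewrite join_varC join_coefC.
apply: (etrans (congr1 join_var (split_varX i))).
case: unliftP => [j ->|->]; last exact: join_varX.
by rewrite join_varC join_coefX.
Qed.

Lemma join_varK : cancel join_var split_var.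
Proof.
have hc c : split_var (join_coef c) = c%:P.
  apply: (@mpoly_rmorph_eq _ _ (split_var \o join_coef : {rmorphism _ -> _}) polyC) => [d|i] /=.
    by rewrite join_coefC split_varC.
  by rewrite join_coefX split_varX liftK.
elim/poly_ind => [|f c ih]; first by rewrite !rmorph0.
rewrite (rmorphD join_var) (rmorphM join_var) join_varX join_varC.
by rewrite (rmorphD split_var) (rmorphM split_var) ih split_varX unlift_none hc.
Qed.

Definition insert_var (xi : 'I_n -> K) (t : K) (i : 'I_n.+1) : K :=
  if unlift a0 i is Some j then xi j else t.

Lemma meval_split_var xi t p :
  (map_poly (mpoly.meval xi) (split_var p)).[t] = mpoly.meval (insert_var xi t) p.
Proof.
pose F : {rmorphism mpoly.mpoly n.+1 K -> K} :=
  horner_eval t \o map_poly (mpoly.meval xi) \o split_var.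
apply: (@mpoly_rmorph_eq _ _ F (mpoly.meval (insert_var xi t))) p => [c|i] /=.
  by rewrite split_varC map_polyC /horner_eval hornerC /= !mpoly.mevalC.
rewrite split_varX mpoly.mevalXU /insert_var; case: unliftP => [j _|_].
  by rewrite map_polyC /horner_eval hornerC /= mpoly.mevalXU.
by rewrite map_polyX /horner_eval hornerX.
Qed.

End Variables.

Lemma mpoly0E (K : fieldType) (p : mpoly.mpoly 0 K) :
  mpoly.mpolyC 0 (mpoly.meval (fun=> 0) p) = p.
Proof.
pose f : {rmorphism mpoly.mpoly 0 K -> mpoly.mpoly 0 K} :=
  @mpoly.mpolyC 0 K \o mpoly.meval (fun=> 0).
apply: (@mpoly_rmorph_eq K 0 _ f idfun) => [c|[] //] /=.
by rewrite mpoly.mevalC.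
Qed.

(** Induction on the number of variables. *)
Theorem factorial_mpoly (K : fieldType) n : factorial (mpoly.mpoly n K).
Proof.
elim: n => [|n ih].
  move=> p p0; exists p, [::]; split=> //; last by rewrite big_nil mulr1.
  rewrite -(mpoly0E p) in p0 *; apply: rmorph_unit; rewrite unitfE.
  by apply: contraNneq p0 => ->; rewrite rmorph0.
exact: (@factorial_rmorph _ _ (join_var ord0) (split_var ord0)
  (join_varK ord0) (split_varK ord0) (factorial_poly ih)).
Qed.

Lemma nonroot_exists (K : numFieldType) (p : {poly K}) : p != 0 -> exists t, p.[t] != 0.
Proof.
move=> p0; apply: contrapT => /forallNP h.
have : (size [seq i%:R : K | i <- iota 0 (size p)] < size p)%N; last first.
  by rewrite size_map size_iota ltnn.
apply: max_poly_roots p0 _ _.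
- by apply/allP => x _; apply/rootP; have /negP := h x; rewrite negbK => /eqP.
- by rewrite map_inj_uniq ?iota_uniq // => i j /eqP; rewrite eqr_nat => /eqP.
Qed.

Lemma mpoly_nonzero_eval (K : numFieldType) n (p : mpoly.mpoly n K) :
  p != 0 -> exists xi, mpoly.meval xi p != 0.
Proof.
elim: n p => [|n ih] p p0.
  exists (fun=> 0); apply: contraNneq p0 => h.
  by rewrite -(mpoly0E p) h rmorph0.
have s0 : split_var ord0 p != 0.
  by apply: contraNneq p0 => h; rewrite -(split_varK ord0 p) h rmorph0.
have [|xi hxi] := ih (lead_coef (split_var ord0 p)); first by rewrite lead_coef_eq0.
have [|t ht] := @nonroot_exists K (map_poly (mpoly.meval xi) (split_var ord0 p)).
  by apply: contraNneq hxi => h; rewrite -coef_map h coef0.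
by exists (insert_var ord0 xi t); rewrite -meval_split_var.
Qed.

(** * General members of a pencil of matrices *)

Section Pencil.
Context {K : numFieldType} {n : nat} (a0 : 'I_n.+1).

Lemma deriv_mpoly_neq0 (f : {poly mpoly.mpoly n K}) : (1 < size f)%N -> f^`() != 0.
Proof.
case sf: (size f) => [|[|k]] // _; apply: contraNneq (_ : lead_coef f != 0) => [h|]; last first.
  by rewrite lead_coef_eq0 -size_poly_gt0 sf.
have /eqP := congr1 (fun g : {poly _} => g`_k) h; rewrite coef_deriv coef0 -mulr_natl.
rewrite -(rmorph_nat (@mpoly.mpolyC n K)) mulf_eq0 lead_coefE sf /= => /orP[|//].
move=> /eqP h1; have := congr1 (mpoly.meval (fun=> 0)) h1.
by rewrite mpoly.mevalC rmorph0 => /eqP; rewrite pnatr_eq0.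
Qed.

(** A repeated factor over the field of fractions gives, by Gauss, a repeated
    prime factor of positive degree. *)
Lemma separable_split_var (P : mpoly.mpoly n.+1 K) : P != 0 ->
  no_multiple_components P -> coprimep (split_var a0 P) (split_var a0 P)^`().
Proof.
move=> P0 hP; set f := split_var a0 P.
have f0 : f != 0.
  by apply: contraNneq P0 => h; rewrite -(split_varK a0 P) -/f h rmorph0.
suff : separable_poly f by rewrite unlock.
apply/separable_polyP; split; last by move=> u _; exact: deriv_mpoly_neq0.
apply/poly_square_freeP => u su; apply/negP => /Pdiv.Idomain.dvdpP [[c w] /= c0 E].
rewrite -mul_polyC in E.
have cP0 : c%:P != 0 by rewrite polyC_eq0.
have u0 : u != 0.
  apply: contraNneq f0 => u0; apply/eqP; apply: (mulfI cP0).
  by rewrite E u0 expr0n mulr0 mulr0.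
have [v [s [vu hs uE]]] := factorial_poly (@factorial_mpoly K n) u0.
(* A prime factor g of positive degree of the repeated factor u. *)
have [g gs sg] : exists2 g, g \in s & (1 < size g)%N.
  apply: contrapT => h; case/negP: su; apply/eqP.
  have : (size u <= 1)%N; last by rewrite -size_poly_gt0 in u0; case: (size u) u0 => [|[]].
  rewrite uE; move: vu; rewrite poly_unitE => /andP[/eqP sv _].
  have /size1_polyC -> : (size v <= 1)%N by rewrite sv.
  apply: leq_trans (size_polyMleq _ _) _; rewrite size_polyC.
  have : (size (\prod_(p <- s) p)%R <= 1)%N.
    rewrite big_seq; elim/big_ind: _ => [|x y hx hy|x xs]; first by rewrite size_poly1.
      by apply: leq_trans (size_polyMleq _ _) _; move: hx hy; lia.
    by rewrite leqNgt; apply/negP => ?; apply: h; exists x.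
  by move: (size _) => j; case: (_ != _) => /=; lia.
have hg := hs _ gs; have [g0 gu hM] := hg.
(* As g does not divide the constant c, its square divides f and not only c f. *)
have gc : ~ divides g c%:P.
  move=> [d dE]; have d0 : d != 0 by apply: contraNneq cP0 => d0; rewrite dE d0 mul0r.
  have := congr1 (fun q : {poly _} => size q) dE; rewrite size_mul // size_polyC c0.
  by rewrite -size_poly_gt0 in d0; move: d0 sg; lia.
have [k kE] : divides (g * g) (c%:P * f).
  rewrite E uE (perm_big _ (perm_to_rem gs)) big_cons /=.
  by exists (w * (v * \prod_(y <- rem g s) y) ^+ 2); rewrite !expr2; ring.
have [|/gc //|[f1 f1E]] := hM c%:P f; first by exists (k * g); rewrite kE mulrA.
have [|/gc //|[h hE]] := hM c%:P f1.
  by exists k; apply: (mulIf g0); rewrite -mulrA -f1E kE mulrA.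
have hj : prime_element (join_var a0 g) :=
  @prime_rmorph _ _ (join_var a0) (split_var a0) (join_varK a0) (split_varK a0) g hg.
apply: (hP (join_var a0 g) (join_var a0 h)).
  by split=> [|a b]; [case: hj|exact: prime_irreducible].
rewrite -[P](split_varK a0) -/f f1E hE -(rmorphXn (join_var a0)) -(rmorphM (join_var a0)).
by congr (join_var a0 _); rewrite expr2; ring.
Qed.

(** Coprimality with the derivative is a Bezout relation with a nonzero constant
    term d in the other variables, which persists where d does not vanish. *)
Lemma general_separable (P : mpoly.mpoly n.+1 K) : P != 0 -> no_multiple_components P ->
  exists xi, separable_poly (map_poly (mpoly.meval xi) (split_var a0 P)).
Proof.
move=> P0 /(separable_split_var P0) /Pdiv.Idomain.Bezout_coprimepP [[u v] /=].
move=> /eqpP [[c d] /= /andP[c0 d0] E].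
have [xi hxi] := mpoly_nonzero_eval d0; exists xi.
rewrite unlock deriv_map; apply/Pdiv.Idomain.Bezout_coprimepP.
exists (map_poly (mpoly.meval xi) (c%:P * u), map_poly (mpoly.meval xi) (c%:P * v)) => /=.
rewrite -!rmorphM -rmorphD /= -!mulrA -mulrDr mul_polyC E -mul_polyC mulr1 /= map_polyC /=.
by rewrite -size_poly_eq1 size_polyC hxi.
Qed.

End Pencil.

Lemma meval_pencil_det (K : numFieldType) k r (G : 'I_k -> 'M[K]_r) xi :
  mpoly.meval xi (pencil_det G) = \det (\sum_i xi i *: G i).
Proof.
rewrite -det_map_mx map_mx_sum; congr (\det _); apply: eq_bigr => i _.
apply/matrixP => p q; rewrite !mxE /=.
by rewrite (rmorphM (mpoly.meval xi)) /= mpoly.mevalXU mpoly.mevalC.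
Qed.

Lemma poly_eq_horner (K : numFieldType) (p q : {poly K}) : (forall t, p.[t] = q.[t]) -> p = q.
Proof.
move=> h; apply/eqP; rewrite -subr_eq0; apply: contrapT => /negP /nonroot_exists [t].
by rewrite hornerD hornerN h subrr eqxx.
Qed.

Lemma horner_char_poly (K : fieldType) r (Q : 'M[K]_r) t : (char_poly Q).[t] = \det (t%:M - Q).
Proof.
rewrite -[LHS]/(horner_eval t _) -det_map_mx; congr (\det _).
apply/matrixP => i j; rewrite !mxE /= /horner_eval hornerD hornerN hornerC.
by rewrite hornerMn hornerX.
Qed.

(** Applying a polynomial in Q that vanishes at all eigenvalues but one
    isolates the corresponding coefficient of a linear relation. *)
Lemma eigenvectors_free (K : fieldType) r k (Q : 'M[K]_r) (y : 'I_k -> 'rV[K]_r) (mu : 'I_k -> K) :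
  (forall p, y p != 0) -> (forall p, y p *m Q = mu p *: y p) -> injective mu ->
  row_free (\matrix_p y p).
Proof.
move=> y0 yQ muI; rewrite -kermx_eq0; apply/eqP/row_matrixP => i.
rewrite row0; set c := row i _.
have c0 : \sum_p c 0 p *: y p = 0.
  have : c *m \matrix_p y p = 0 by rewrite -row_mul mulmx_ker row0.
  by rewrite mulmx_sum_row; under eq_bigr => p _ do rewrite rowK.
have cg (g : {poly K}) : \sum_p (c 0 p * g.[mu p]) *: y p = 0.
  elim/poly_ind: g => [|g a ih].
    by apply: big1 => p _; rewrite horner0 mulr0 scale0r.
  have := congr1 (mulmx^~ Q) ih; rewrite mul0mx mulmx_suml => h.
  transitivity (\sum_p (c 0 p * g.[mu p]) *: y p *m Q + a *: \sum_p c 0 p *: y p).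
    rewrite scaler_sumr -big_split /=.
    apply: eq_bigr => p _ /=.
    by rewrite -scalemxAl yQ !scalerA -scalerDl hornerMXaddC; congr (_ *: _); ring.
  by rewrite h c0 scaler0 addr0.
apply/rowP => p; rewrite [RHS]mxE; have := cg (\prod_(q | q != p) ('X - (mu q)%:P)).
rewrite (bigD1 p) //= [X in _ + X]big1 ?addr0 => [|q qp].
  move/eqP; rewrite scaler_eq0 (negPf (y0 p)) orbF mulf_eq0 => /orP[/eqP //|].
  rewrite horner_prod => /eqP h; have : \prod_(q | q != p) (mu p - mu q) != 0.
    by apply/prodf_neq0 => q qp; rewrite subr_eq0 (inj_eq muI) eq_sym.
  by move=> /negP[]; rewrite -h; apply/eqP/eq_bigr => q _; rewrite hornerXsubC.
rewrite horner_prod (bigD1 q) //= hornerXsubC subrr mul0r mulr0 scale0r //.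
Qed.

(** With the variable a0 distinguished, the determinant of the pencil is, up to a
    constant, the characteristic polynomial of a quotient of matrices. *)
Theorem pencil_eigenvectors (K : numClosedFieldType) n r (G : 'I_n -> 'M[K]_r) a0 :
  \det (G a0) != 0 -> no_multiple_components (pencil_det G) ->
  exists (xi : 'I_n -> K) (mu : 'I_r -> K) (V : 'M[K]_r),
  [/\ injective mu, V \in unitmx &
      forall p, row p V *m (\sum_a xi a *: G a) = mu p *: (row p V *m G a0)].
Proof.
case: n G a0 => [|n] G a0 G0 hG; first by case: a0 {G0}.
have P0 : pencil_det G != 0.
  apply: contraNneq G0 => h.
  have <- : mpoly.meval (fun i => (i == a0)%:R) (pencil_det G) = \det (G a0).
    rewrite meval_pencil_det (bigD1 a0) //= eqxx scale1r big1 ?addr0 // => i ia.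
    by rewrite (negPf ia) scale0r.
  by rewrite h rmorph0.
have [xi' sep] := @general_separable K n a0 _ P0 hG.
(* The coefficient of G a0 is the eigenvalue, so it is taken to be 0 in xi. *)
pose xi := insert_var a0 xi' 0; pose Mx := \sum_a xi a *: G a.
have G0u : G a0 \in unitmx by rewrite unitmxE unitfE.
pose Q := - (Mx *m invmx (G a0)).
have fE : map_poly (mpoly.meval xi') (split_var a0 (pencil_det G)) = (\det (G a0))%:P * char_poly Q.
  apply: poly_eq_horner => t; rewrite meval_split_var meval_pencil_det hornerM hornerC.
  rewrite horner_char_poly mulrC -det_mulmx; congr (\det _).
  rewrite /Q opprK mulmxDl mulmxKV // mul_scalar_mx /Mx.
  rewrite (bigD1 a0) //= [in RHS](bigD1 a0) //= /xi /insert_var unlift_none scale0r add0r.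
  congr (_ + _); apply: eq_bigr => i ia; case: unliftP => // h; by rewrite h eqxx in ia.
move: sep; rewrite fE separable_mul => {fE}/and3P[_ sepQ _].
have [s sE] := closed_field_poly_normal (char_poly Q).
move: (sE); rewrite (monicP (char_poly_monic Q)) scale1r => sE'.
have su : uniq s by rewrite -separable_prod_XsubC -sE'.
have ss : size s = r.
  have := size_char_poly Q; rewrite sE' size_prod_XsubC; by move=> [].
pose mu (p : 'I_r) := nth 0 s p.
have muI : injective mu.
  by move=> p q /eqP; rewrite nth_uniq ?ss // => /eqP; exact: val_inj.
have ev p : exists v : 'rV_r, v *m Q = mu p *: v /\ v != 0.
  have : eigenvalue Q (mu p).
    by rewrite eigenvalue_root_char sE' root_prod_XsubC mem_nth // ss.
  by case/eigenvalueP => v h1 h2; exists v.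
have [y hy] := choice ev.
exists xi, (fun p => - mu p), (\matrix_p y p); split.
- by move=> p q /oppr_inj /muI.
- by rewrite -row_free_unit; apply: (@eigenvectors_free _ _ _ Q y mu) => // p; case: (hy p).
move=> p; rewrite rowK -/Mx; have [h _] := hy p.
rewrite scaleNr scalemxAl -h /Q mulmxN mulNmx opprK !mulmxA mulmxKV //.
Qed.

(** * Torses in a moving frame *)

Section Product.
Context {R : realType}.
Local Notation C := R[i].

Lemma differentiable_entry (V : normedModType C) m n (f : V -> 'M[C]_(m, n)) x i j :
  differentiable f x -> differentiable (fun y => f y i j) x.
Proof. by move=> df; exact: (differentiable_comp df (differentiable_coord (f x) i j)). Qed.

Lemma derivable_entry (V : normedModType C) m n (f : V -> 'M[C]_(m, n)) x v i j :
  differentiable f x -> derivable (fun y => f y i j) x v.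
Proof. by move=> /(differentiable_entry i j); exact: diff_derivable. Qed.

Lemma mulmx_entry (V : normedModType C) m n p (f : V -> 'M[C]_(m, n)) (g : V -> 'M[C]_(n, p)) i j :
  (fun y => (f y *m g y) i j) = \sum_k ((fun y => f y i k) * (fun y => g y k j)).
Proof. by apply/funext => y; rewrite fct_sumE mxE. Qed.

Lemma differentiable_mulmx (V : normedModType C) m n p (f : V -> 'M[C]_(m, n))
    (g : V -> 'M[C]_(n, p)) x :
  differentiable f x -> differentiable g x -> differentiable (fun y => f y *m g y) x.
Proof.
move=> df dg; apply: differentiable_mx => i j; rewrite mulmx_entry.
by apply: differentiable_sum => k; apply: differentiableM; exact: differentiable_entry.
Qed.

Lemma derive_mulmx (V : normedModType C) m n p (f : V -> 'M[C]_(m, n))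
    (g : V -> 'M[C]_(n, p)) x v :
  differentiable f x -> differentiable g x ->
  'D_v (fun y => f y *m g y) x = 'D_v f x *m g x + f x *m 'D_v g x.
Proof.
move=> df dg; apply/matrixP => i j.
rewrite derive_coord; last exact: differentiable_mulmx.
rewrite mulmx_entry derive_sum => [|k]; last first.
  by apply: derivableM; exact: derivable_entry.
rewrite !mxE -big_split; apply: eq_bigr => k _ /=.
rewrite deriveM; [|exact: derivable_entry|exact: derivable_entry].
rewrite (@derive_coord _ _ _ _ _ _ v i k df) (@derive_coord _ _ _ _ _ _ v k j dg) addrC.
by congr (_ + _); exact: mulrC.
Qed.

Lemma derive_cstmul (V : normedModType C) m n p (a : 'M[C]_(m, n)) (g : V -> 'M[C]_(n, p)) x v :
  differentiable g x -> 'D_v (fun y => a *m g y) x = a *m 'D_v g x.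
Proof.
move=> dg; have dc : differentiable (fun _ : V => a) x := differentiable_cst a x.
by rewrite (derive_mulmx v dc dg) derive_cst mul0mx add0r.
Qed.

Lemma derive_eq_on (V W : normedModType C) (f g : V -> W) x v (U : set V) :
  open U -> U x -> (forall z, U z -> f z = g z) -> 'D_v f x = 'D_v g x.
Proof.
move=> oU Ux h; apply: near_eq_derive; apply: filterS h _.
exact: open_nbhs_nbhs.
Qed.

Lemma differentiable_col_mx (V : normedModType C) m1 m2 n (f : V -> 'M[C]_(m1, n))
    (g : V -> 'M[C]_(m2, n)) x :
  differentiable f x -> differentiable g x -> differentiable (fun y => col_mx (f y) (g y)) x.
Proof.
move=> df dg; apply: differentiable_mx => i j; case: (split_ordP i) => k ->.
  rewrite (_ : (fun _ => _) = (fun y => f y k j)); first exact: differentiable_entry.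
  by apply/funext => y; rewrite col_mxEu.
rewrite (_ : (fun _ => _) = (fun y => g y k j)); first exact: differentiable_entry.
by apply/funext => y; rewrite col_mxEd.
Qed.

Lemma derive_col_mx (V : normedModType C) m1 m2 n (f : V -> 'M[C]_(m1, n))
    (g : V -> 'M[C]_(m2, n)) x v :
  differentiable f x -> differentiable g x ->
  'D_v (fun y => col_mx (f y) (g y)) x = col_mx ('D_v f x) ('D_v g x).
Proof.
move=> df dg; apply/matrixP => i j.
rewrite derive_coord; last exact: differentiable_col_mx.
case: (split_ordP i) => k ->.
  rewrite (_ : (fun _ => _) = (fun y => f y k j)) ?col_mxEu -?derive_coord //.
  by apply/funext => y; rewrite col_mxEu.
rewrite (_ : (fun _ => _) = (fun y => g y k j)) ?col_mxEd -?derive_coord //.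
by apply/funext => y; rewrite col_mxEd.
Qed.

End Product.

Section Torse.
Context {R : realType}.
Local Notation C := R[i].

(** Along the curve the plane Z H moves inside the span of itself and of the
    point z H; that span is the tangent subspace. *)
Lemma torse_of_frame l N (S : set 'rV[C]_1) (Z : 'M[C]_(l.+1, N.+1))
    (z : 'rV[C]_1 -> 'rV[C]_N.+1) (H : 'rV[C]_1 -> 'M[C]_N.+1) :
  open S -> row_free Z -> (forall s, S s -> differentiable H s) ->
  (forall s, S s -> differentiable z s) -> (forall s, S s -> H s \in unitmx) ->
  (forall s, S s -> row_free (col_mx Z (z s))) ->
  (forall s, S s -> exists (al : 'M[C]_l.+1) (be : 'cV[C]_l.+1), be != 0 /\
     Z *m 'D_(delta_mx 0 0) H s = (al *m Z + be *m z s) *m H s) ->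
  (forall s, S s ->
    ~~ ('D_(delta_mx 0 0) (fun s => z s *m H s) s <= col_mx Z (z s) *m H s)%MS) ->
  torse S (fun s => Z *m H s).
Proof.
move=> oS fZ dH dz uH fK ZH nK; exists (fun s => col_mx (Z *m H s) (z s *m H s)).
have dA s : S s -> differentiable (fun s => Z *m H s) s.
  by move=> Ss; apply: differentiable_mulmx (dH s Ss); exact: (differentiable_cst Z).
have dw s : S s -> differentiable (fun s => z s *m H s) s.
  by move=> Ss; apply: differentiable_mulmx; [exact: dz|exact: dH].
have TE s : col_mx (Z *m H s) (z s *m H s) = col_mx Z (z s) *m H s by rewrite mul_col_mx.
have fH s : S s -> row_free (H s) by move=> /uH; rewrite -row_free_unit.
have rK s : S s -> \rank (col_mx Z (z s) *m H s) = (l.+1 + 1)%N.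
  by move=> Ss; rewrite mxrankMfree ?fH //; exact/eqP/fK.
(* The tangent subspace at any point of the plane lies in the span, and equals it
   where x times be is not 0. *)
have tE s x al be : S s ->
    Z *m 'D_(delta_mx 0 0) H s = (al *m Z + be *m z s) *m H s ->
    tangent_space (fun s => Z *m H s) s x =
    block_mx 1%:M 0 (x *m al) (x *m be) *m (col_mx Z (z s) *m H s).
  move=> Ss hE; rewrite -TE /tangent_space mul_block_col mul1mx mul0mx addr0; congr (col_mx _ _).
  rewrite -!mulmxA -mulmxDr !mulmxA -mulmxDl -hE.
  apply/row_matrixP => q; rewrite rowK [q]ord1 derive_cstmul; last exact: dH.
  by apply/rowP => j; rewrite [RHS]mxE.
split=> //.
- by move=> s Ss; apply: differentiable_col_mx; [exact: dA|exact: dw].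
- by move=> s Ss; rewrite /row_free mxrankMfree ?fH.
- move=> s Ss; have [al [be [be0 hE]]] := ZH s Ss; have [i bi] : exists i, be i 0 != 0.
    apply: contrapT => /forallNP h; case/negP: be0; apply/eqP/colP => i.
    by have /negP := h i; rewrite negbK mxE => /eqP.
  exists (delta_mx 0 i); rewrite /smooth_point (tE s _ al be) // eqmxMfull ?rK //.
  rewrite row_full_unit unitmxE det_lblock det1 mul1r det_mx11 unitfE.
  by rewrite -rowE mxE.
- move=> s x Ss hx; have [al [be [be0 hE]]] := ZH s Ss; rewrite TE (tE s x al be) //.
  have sub : (block_mx 1%:M 0 (x *m al) (x *m be) *m (col_mx Z (z s) *m H s)
    <= col_mx Z (z s) *m H s)%MS by exact: submxMl.
  by rewrite -(mxrank_leqif_eq sub) rK // -(tE s x al be) // hx.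
- move=> s Ss; rewrite rank_rV; case: eqP => // h; case/negP: (nK s Ss).
  have : row 0 (gauss_differential (fun s => col_mx (Z *m H s) (z s *m H s)) s) = 0.
    by rewrite h row0.
  rewrite rowK => /eqP; rewrite mxvec_eq0 TE derive_col_mx; [|exact: dA|exact: dw].
  rewrite mul_col_mx col_mx_eq0 => /andP[_].
  by rewrite submxE.
Qed.

End Torse.

(** * The structure equations of a frame *)

Lemma adjugate_product (K : comNzRingType) n (X Y Z G F : 'M[K]_n) e : G *m F = e%:M ->
  e *: (X *m Z) = (X *m G) *m (Y *m G + F *m Z) - (X *m G) *m (Y *m G).
Proof.
move=> h; rewrite mulmxDr addrAC subrr add0r -mulmxA (mulmxA G) h mul_scalar_mx.
by rewrite -scalemxAr.
Qed.

Lemma entry_relation (K : comNzRingType) m n (X Y Z : 'M[K]_(m, n)) e i j :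
  e *: X = Y - Z -> Y i j = 0 -> e * - X i j = Z i j.
Proof.
move=> h y0; have := congr1 (fun T : 'M[K]_(m, n) => T i j) h.
by rewrite !mxE y0 add0r mulrN => ->; rewrite opprK.
Qed.

Section Frames.
Context {R : realType} {l r c : nat}.
Local Notation C := R[i].
Local Notation d := (l.+1 + r + c)%N.

Definition sel_gen : 'M[C]_(l.+1, d) := row_mx (row_mx 1%:M 0) 0.
Definition sel_tan : 'M[C]_(l.+1 + r, d) := row_mx 1%:M 0.
Definition sel_mid : 'M[C]_(r, d) := row_mx (row_mx 0 1%:M) 0.

Definition idxI (i : 'I_l.+1) : 'I_d := lshift c (lshift r i).
Definition idxP (p : 'I_r) : 'I_d := lshift c (rshift l.+1 p).
Definition idxA (a : 'I_c) : 'I_d := rshift (l.+1 + r) a.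

Lemma sel_gen_mul n (X : 'M[C]_(d, n)) i k : (sel_gen *m X) i k = X (idxI i) k.
Proof.
rewrite /sel_gen -[in LHS](vsubmxK X) -[X in col_mx X _]vsubmxK mul_row_col mul0mx addr0.
by rewrite mul_row_col mul1mx mul0mx addr0 !mxE.
Qed.

Variables (M : set 'rV[C]_r) (F : 'rV[C]_r -> 'M[C]_d).

Lemma generatorE u : @generator _ r l c (l + r + c) F u = sel_gen *m F u.
Proof.
rewrite /generator /sel_gen -[X in _ = _ *m X]vsubmxK.
rewrite -[X in col_mx X _]vsubmxK mul_row_col mul0mx addr0 mul_row_col.
by rewrite mul1mx mul0mx addr0.
Qed.

Lemma tangent_subspaceE u : @tangent_subspace _ r l c (l + r + c) F u = sel_tan *m F u.
Proof.
by rewrite /tangent_subspace /sel_tan -[X in _ = _ *m X]vsubmxK mul_row_col mul1mx mul0mx addr0.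
Qed.

(** The matrix of the connection along the q-th coordinate direction, multiplied
    by the determinant of the frame: this makes its entries polynomials in those
    of F and of its derivatives. *)
Definition conn u q : 'M[C]_d := 'D_(delta_mx 0 q) F u *m \adj (F u).

(** The transposes of the C_i, and the B^alpha, for the coframe du^q, with the
    same factor det F. *)
Definition matC u (i : 'I_l.+1) : 'M[C]_r := \matrix_(q, p) conn u q (idxI i) (idxP p).
Definition matB u (a : 'I_c) : 'M[C]_r := \matrix_(q, p) conn u q (idxP p) (idxA a).

Lemma matCE u i q p : matC u i q p = conn u q (idxI i) (idxP p).
Proof. by rewrite mxE. Qed.

Lemma matBE u a q p : matB u a q p = conn u q (idxP p) (idxA a).
Proof. by rewrite mxE. Qed.

Hypotheses (oM : open M) (sF : smooth M F) (uF : forall u, M u -> F u \in unitmx).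

Lemma frame_diff u : M u -> differentiable F u.
Proof. by case: (sF 1%N) => h _ /h. Qed.

Lemma frame_diff2 u v : M u -> differentiable ('D_v F) u.
Proof. by case: (sF 2%N) => _ /(_ v) [h _] /h. Qed.

Lemma frame_c11 u : M u -> c11mx u F.
Proof. by move=> Mu; apply: class_C_c11 oM Mu (sF 2%N). Qed.

Lemma frame_c11_derive u v : M u -> c11mx u ('D_v F).
Proof. by move=> Mu; case: (sF 3%N) => _ /(_ v); exact: class_C_c11 oM Mu. Qed.

Lemma conn_c11 u q : M u -> c11mx u (conn^~ q).
Proof.
by move=> Mu; apply: c11mx_mul; [exact: frame_c11_derive|exact/c11mx_adj/frame_c11].
Qed.

Lemma adj_diff u : M u -> differentiable (fun u => \adj (F u)) u.
Proof.
move=> Mu; have [e e0 he] := c11mx_diff (c11mx_adj (frame_c11 Mu)).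
by apply: he; rewrite subrr nr0.
Qed.

Lemma matC_c11 u i : M u -> c11mx u (matC^~ i).
Proof.
move=> Mu q p; rewrite (_ : (fun _ => _) = (fun x => conn x q (idxI i) (idxP p))).
  exact: conn_c11.
by apply/funext => x; rewrite mxE.
Qed.

Lemma matB_c11 u a : M u -> c11mx u (matB^~ a).
Proof.
move=> Mu q p; rewrite (_ : (fun _ => _) = (fun x => conn x q (idxP p) (idxA a))).
  exact: conn_c11.
by apply/funext => x; rewrite mxE.
Qed.

Lemma det_frame u : M u -> \det (F u) != 0.
Proof. by move/uF; rewrite unitmxE unitfE. Qed.

(** Off the diagonal, the product of the frame with its adjugate is constant. *)
Lemma derive_frame_adj u v b a : M u -> b != a ->
  'D_v (fun u => F u *m \adj (F u)) u b a = 0.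
Proof.
move=> Mu ba; rewrite derive_coord; last first.
  by apply: differentiable_mulmx; [exact: frame_diff|exact: adj_diff].
rewrite (_ : (fun _ => _) = cst 0) ?derive_cst //.
by apply/funext => x; rewrite mul_mx_adj mxE (negPf ba).
Qed.

Section Integrability.
Hypothesis conn0 : forall u q i a, M u -> conn u q (idxI i) (idxA a) = 0.

(** Differentiating omega_i^alpha = 0 along the s-th direction.  In terms of
    exterior derivatives, 0 = d omega_i^alpha is the sum of the products
    omega_i^b omega_b^alpha; the second derivative of F is the part that is
    symmetric in q and s. *)
Lemma conn_mul u q s i a : M u ->
  (conn u q *m conn u s) (idxI i) (idxA a) =
  \det (F u) * ('D_(delta_mx 0 s) ('D_(delta_mx 0 q) F) u *m \adj (F u)) (idxI i) (idxA a).
Proof.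
move=> Mu; set W := fun u => \adj (F u).
have dW : differentiable W u by exact: adj_diff.
have h0 : 'D_(delta_mx 0 s) (conn^~ q) u (idxI i) (idxA a) = 0.
  rewrite derive_coord; last by apply: differentiable_mulmx => //; exact: frame_diff2.
  by rewrite (derive_eq_on (g := cst 0) _ oM Mu) ?derive_cst // => z Mz; exact: conn0.
move: h0; rewrite derive_mulmx //; last exact: frame_diff2.
have := derive_mulmx (delta_mx 0 s) (frame_diff Mu) dW.
set D := 'D_(delta_mx 0 s) _ u => DE.
have hD : (conn u q *m D) (idxI i) (idxA a) = 0.
  rewrite mxE big1 // => b _; have [->|ba] := eqVneq b (idxA a); first by rewrite conn0 // mul0r.
  by rewrite /D derive_frame_adj ?mulr0.
have h1 : \det (F u) *: ('D_(delta_mx 0 q) F u *m 'D_(delta_mx 0 s) W u) =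
    conn u q *m D - conn u q *m conn u s.
  by rewrite DE; exact/adjugate_product/mul_adj_mx.
rewrite mxE => /eqP; rewrite addr_eq0 => /eqP ->.
by rewrite (entry_relation h1 hD).
Qed.

Lemma conn_mul_sym u q s i a : M u ->
  (conn u q *m conn u s) (idxI i) (idxA a) = (conn u s *m conn u q) (idxI i) (idxA a).
Proof.
move=> Mu; apply: etrans (conn_mul q s i a Mu) _; apply: etrans _ (esym (conn_mul s q i a Mu)).
have h : 'D_(delta_mx 0 s) ('D_(delta_mx 0 q) F) u = 'D_(delta_mx 0 q) ('D_(delta_mx 0 s) F) u.
  exact: (derive_sym oM Mu frame_diff (frame_diff2 _ Mu) (frame_diff2 _ Mu)).
exact: (congr1 (fun X : 'M[C]_d => \det (F u) * (X *m \adj (F u)) (idxI i) (idxA a)) h).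
Qed.

Lemma conn_mulE u q s i a : M u ->
  (conn u q *m conn u s) (idxI i) (idxA a) = (matC u i *m (matB u a)^T) q s.
Proof.
move=> Mu; rewrite [LHS]mxE [RHS]mxE big_split_ord /=.
rewrite [X in _ + X = _]big1 ?addr0 => [|b _]; last first.
  by rewrite [X in X * _](conn0 _ _ _ Mu) mul0r.
rewrite big_split_ord /= [X in X + _ = _]big1 ?add0r => [|b _]; last first.
  by rewrite [X in _ * X](conn0 _ _ _ Mu) mulr0.
apply: eq_bigr => p _; have -> : (matB u a)^T p s = matB u a s p by rewrite mxE.
by rewrite matCE matBE.
Qed.

(** The matrices H_i^alpha of the second fundamental forms are symmetric: since
    omega_i^alpha = 0, only the indices of A_(l+1), ..., A_n contribute to the
    product of the connection matrices. *)
Lemma matC_matB_sym u i a : M u -> matC u i *m (matB u a)^T = matB u a *m (matC u i)^T.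
Proof.
move=> Mu; apply/matrixP => q s; rewrite -conn_mulE // conn_mul_sym // conn_mulE //.
by rewrite -[in RHS](trmxK (matB u a)) -trmx_mul [in RHS]mxE.
Qed.

End Integrability.

Section Comparison.
Variable Theta : 'rV[C]_r -> 'M[C]_r.

Lemma pinv_frame u : M u -> pinvmx (F u) = (\det (F u))^-1 *: \adj (F u).
Proof.
move=> Mu; have fF : row_free (F u) by rewrite row_free_unit uF.
have h := mulmxVp fF.
have d0 := det_frame Mu.
have := congr1 (mulmx (\adj (F u))) h; rewrite mulmxA mul_adj_mx mulmx1 mul_scalar_mx => <-.
by rewrite scalerA mulVf // scale1r.
Qed.

Lemma connectionE u q : M u -> @connection _ r l c (l + r + c) F u (dual_vector Theta u q) =
  (\det (F u))^-1 *: \sum_s invmx (Theta u) q s *: conn u s.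
Proof.
move=> Mu; rewrite /connection pinv_frame // derive_sumdir; last exact: frame_diff.
rewrite -scalemxAr mulmx_suml; congr (_ *: _); apply: eq_bigr => s _.
by rewrite -scalemxAl mxE.
Qed.

Lemma mxCE u i : M u -> @mxC _ r l c (l + r + c) F Theta u i =
  (\det (F u))^-1 *: (invmx (Theta u) *m matC u i)^T.
Proof.
move=> Mu; apply/matrixP => p q; rewrite mxE connectionE // !mxE summxE; congr (_ * _).
by apply: eq_bigr => s _; rewrite !mxE.
Qed.

Lemma mxBE u a : M u -> @mxB _ r l c (l + r + c) F Theta u a =
  (\det (F u))^-1 *: (invmx (Theta u) *m matB u a).
Proof.
move=> Mu; apply/matrixP => q p; rewrite mxE connectionE // !mxE summxE; congr (_ * _).
by apply: eq_bigr => s _; rewrite !mxE.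
Qed.

End Comparison.

(** A point of L and its displacement x + t x' are both smooth points for a
    general t, so that all of the differential of A stays in T_L. *)
Lemma conn0_of_gauss :
  @degenerate_gauss _ r l (l + r + c) M (@generator _ r l c (l + r + c) F)
    (@tangent_subspace _ r l c (l + r + c) F) ->
  forall u q i a, M u -> conn u q (idxI i) (idxA a) = 0.
Proof.
move=> X u q i a Mu; have [x0 hx0] := dg_smooth X Mu.
pose A := @generator _ r l c (l + r + c) F.
pose D x : 'M[C]_(r, (l + r + c).+1) := \matrix_(q < r) (x *m 'D_(delta_mx 0 q) A u).
pose G := \adj (F u).
have tan0 x : smooth_point A u x -> (D x *m G) q (idxA a) = 0.
  move=> hx; have /eqmxP h := dg_gauss X Mu hx.
  have : (D x <= sel_tan *m F u)%MS.
    rewrite -tangent_subspaceE -h; apply: submx_trans (addsmxSr (A u) (D x)) _.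
    by rewrite addsmxE.
  move=> /submxP [Y ->]; rewrite -!mulmxA mul_mx_adj mulmxA /sel_tan mul_mx_row mulmx0.
  by rewrite mul_mx_scalar mxE row_mxEr mxE mulr0.
have lin x y t : (D (x + t *: y) *m G) q (idxA a) =
    (D x *m G) q (idxA a) + t * (D y *m G) q (idxA a).
  have -> : D (x + t *: y) = D x + t *: D y.
    by apply/row_matrixP => s; rewrite !(linearD, linearZ) /= !rowK mulmxDl scalemxAl.
  by rewrite mulmxDl -scalemxAl [LHS]mxE [X in _ + X = _]mxE.
pose y : 'rV[C]_l.+1 := delta_mx 0 i.
have [t t0 ht] : exists2 t, t != 0 & smooth_point A u (x0 + t *: y).
  have /row_freeP [B hB] : row_free (tangent_space A u x0) by exact/eqP.
  pose Y : 'M[C]_(l.+1 + r) := col_mx 0 (D y) *m B.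
  (* With t = 1/s, the point x0 + t y is smooth unless s is a root of the
     characteristic polynomial of - Y. *)
  have [|s] := @nonroot_exists _ ('X * char_poly (- Y)).
    by rewrite mulf_neq0 ?polyX_eq0 // monic_neq0 ?char_poly_monic.
  rewrite hornerM hornerX mulf_eq0 negb_or => /andP[s0 sY].
  exists s^-1; first by rewrite invr_eq0.
  apply/eqP; apply/row_freeP.
  have E : tangent_space A u (x0 + s^-1 *: y) = tangent_space A u x0 + s^-1 *: col_mx 0 (D y).
    rewrite /tangent_space scale_col_mx add_col_mx scaler0 addr0; congr (col_mx _ _).
    by apply/row_matrixP => q'; rewrite !(linearD, linearZ) /= !rowK mulmxDl scalemxAl.
  move: sY; rewrite horner_char_poly opprK -unitfE -unitmxE => uY.
  exists (B *m (s *: invmx (s%:M + Y))).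
  rewrite mulmxA E mulmxDl hB -scalemxAl -/Y -scalemxAr scalemxAl scalerDr scalerA.
  by rewrite divff // scale1r scalemx1 mulmxV.
have := tan0 _ ht; rewrite lin tan0 // add0r => /eqP; rewrite mulf_eq0 (negPf t0) /=.
move=> /eqP <-; rewrite [LHS]mxE [RHS]mxE; apply: eq_bigr => k _; congr (_ * _).
rewrite mxE /y -rowE [RHS]mxE /A (_ : @generator _ r l c (l + r + c) F = fun z => sel_gen *m F z).
  by rewrite derive_cstmul ?sel_gen_mul //; exact: frame_diff.
by apply/funext => z; exact: generatorE.
Qed.

End Frames.

(** * Torse directions *)

(** The right kernel of Bx - mu_p B0 is a line on which y_p B0 is injective:
    for q != p, y_q B0 vanishes on it. *)
Lemma pencil_kernel (K : fieldType) r (B0 Bx : 'M[K]_r) (y : 'I_r -> 'rV[K]_r)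
    (mu : 'I_r -> K) p (z : 'rV[K]_r) :
  B0 \in unitmx -> row_free (\matrix_q y q) ->
  (forall q, y q *m Bx = mu q *: (y q *m B0)) -> (forall q, q != p -> mu q != mu p) ->
  Bx *m z^T = mu p *: (B0 *m z^T) -> y p *m B0 *m z^T = 0 -> z = 0.
Proof.
move=> uB fy hy hmu hz hp.
have h q : y q *m B0 *m z^T = 0.
  have [->//|qp] := eqVneq q p.
  have : (mu q - mu p) *: (y q *m B0 *m z^T) = 0.
    by rewrite scalerBl scalemxAl -hy -!mulmxA hz -scalemxAr subrr.
  by move/eqP; rewrite scaler_eq0 subr_eq0 (negPf (hmu q qp)) => /eqP.
rewrite row_free_unit in fy.
have : (\matrix_q y q *m B0) *m z^T = 0.
  by apply/row_matrixP => q; rewrite !row_mul rowK row0 h.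
move=> /(congr1 (mulmx (invmx (\matrix_q y q *m B0)))).
rewrite mulKmx ?mulmx0; last by rewrite unitmx_mul fy.
by move=> /(congr1 trmx); rewrite trmxK trmx0.
Qed.

Lemma derive_comp (R : realType) a (V W : normedModType R[i]) (f : 'rV[R[i]]_a -> V)
    (g : V -> W) x v :
  differentiable f x -> differentiable g (f x) ->
  differentiable (g \o f) x /\ 'D_v (g \o f) x = 'D_('D_v f x) g (f x).
Proof.
move=> df dg; have dgf := differentiable_comp df dg; split=> //.
by rewrite (deriveE v dgf) (diff_comp df dg) /= -(deriveE v df) -deriveE.
Qed.

Section Pointwise.
Context {R : realType} {l r c : nat}.
Local Notation C := R[i].
Local Notation d := (l.+1 + r + c)%N.
Variables (M : set 'rV[C]_r) (F : 'rV[C]_r -> 'M[C]_d).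
Hypotheses (oM : open M) (sF : smooth M F) (uF : forall u, M u -> F u \in unitmx).
Hypothesis conn0 : forall u q i a, M u -> conn F u q (idxI i) (idxA a) = 0.

Definition conn_dir u (v : 'rV[C]_r) : 'M[C]_d := \sum_q v 0 q *: conn F u q.

Lemma conn_dirE u v : M u -> conn_dir u v = 'D_v F u *m \adj (F u).
Proof.
move=> Mu; rewrite derive_sumdir; last exact: (frame_diff sF Mu).
by rewrite mulmx_suml; apply: eq_bigr => q _; rewrite scalemxAl.
Qed.

Lemma conn_dirC u v i p : conn_dir u v (idxI i) (idxP p) = (v *m matC F u i) 0 p.
Proof.
rewrite [RHS]mxE summxE; apply: eq_bigr => q _.
by rewrite matCE [LHS]mxE.
Qed.

Lemma conn_dirB u v a p : conn_dir u v (idxP p) (idxA a) = (v *m matB F u a) 0 p.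
Proof.
rewrite [RHS]mxE summxE; apply: eq_bigr => q _.
by rewrite matBE [LHS]mxE.
Qed.

Lemma conn_dir0 u v i a : M u -> conn_dir u v (idxI i) (idxA a) = 0.
Proof.
move=> Mu; rewrite summxE big1 // => q _; rewrite mxE.
by rewrite [X in _ * X](conn0 q i a Mu) mulr0.
Qed.

Lemma mul_sel_gen n (X : 'M[C]_(n, l.+1)) : X *m sel_gen = row_mx (row_mx X 0) 0 :> 'M[C]_(n, d).
Proof. by rewrite /sel_gen !mul_mx_row mulmx1 !mulmx0. Qed.

Lemma mul_sel_mid n (X : 'M[C]_(n, r)) : X *m sel_mid = row_mx (row_mx 0 X) 0 :> 'M[C]_(n, d).
Proof. by rewrite /sel_mid !mul_mx_row mulmx1 !mulmx0. Qed.

Lemma sel_split : col_mx sel_gen sel_mid = sel_tan :> 'M[C]_(l.+1 + r, d).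
Proof.
rewrite /sel_gen /sel_mid /sel_tan -[col_mx _ _]/(block_mx _ _ _ _) block_mxEh.
by rewrite -[X in row_mx X _]/(block_mx _ _ _ _) -scalar_mx_block col_mx0.
Qed.

Lemma sel_gen_free : row_free (sel_gen : 'M[C]_(l.+1, d)).
Proof.
apply/row_freeP; exists (col_mx (col_mx 1%:M 0) 0).
by rewrite /sel_gen mul_row_col mul0mx addr0 mul_row_col mul0mx addr0 mulmx1.
Qed.

Lemma sel_free (z : 'rV[C]_r) : z != 0 -> row_free (col_mx sel_gen (z *m sel_mid) : 'M[C]_(_, d)).
Proof.
move=> z0; have -> : col_mx sel_gen (z *m sel_mid) = block_mx 1%:M 0 0 z *m sel_tan :> 'M[C]_(_, d).
  by rewrite -sel_split mul_block_col mul1mx !mul0mx addr0 add0r.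
rewrite /row_free mxrankMfree; first by rewrite rank_diag_block_mx mxrank1 rank_rV z0.
by apply/row_freeP; exists (col_mx 1%:M 0); rewrite mul_row_col mulmx1 mul0mx addr0.
Qed.

(** Modulo L, the derivatives of the A_i along v are the points of T_L with
    coordinates v C_i, divided by det F. *)
Lemma generator_motion u (v z : 'rV[C]_r) (lam : 'cV[C]_l.+1) : M u ->
  (forall i, v *m matC F u i = lam i 0 *: z) -> lam != 0 ->
  exists (al : 'M[C]_l.+1) (be : 'cV[C]_l.+1), be != 0 /\
    sel_gen *m 'D_v F u = (al *m sel_gen + be *m (z *m sel_mid)) *m F u.
Proof.
move=> Mu hz lam0; have d0 := det_frame uF Mu; set e := \det (F u) in d0.
pose al : 'M[C]_l.+1 := \matrix_(i, j) conn_dir u v (idxI i) (idxI j).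
have E : sel_gen *m conn_dir u v = al *m sel_gen + lam *m (z *m sel_mid).
  rewrite mulmxA mul_sel_gen mul_sel_mid add_row_mx add_row_mx !addr0 add0r.
  apply/matrixP => i k; rewrite sel_gen_mul; case: (split_ordP k) => j ->.
    rewrite row_mxEl; case: (split_ordP j) => j' ->; first by rewrite row_mxEl mxE.
    rewrite row_mxEr -[LHS]/(conn_dir u v (idxI i) (idxP j')) conn_dirC hz !mxE big_ord1.
    by [].
  by rewrite row_mxEr mxE -[LHS]/(conn_dir u v (idxI i) (idxA j)) conn_dir0.
exists (e^-1 *: al), (e^-1 *: lam); split.
  by rewrite scaler_eq0 invr_eq0 (negPf d0).
have h : conn_dir u v *m F u = e *: 'D_v F u.
  by rewrite conn_dirE // -mulmxA mul_adj_mx mul_mx_scalar.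
have -> : 'D_v F u = e^-1 *: (conn_dir u v *m F u) by rewrite h scalerA mulVf // scale1r.
by rewrite -[LHS]scalemxAr [X in _ *: X]mulmxA E -!scalemxAl -scalerDr -scalemxAl.
Qed.

(** The component along A_alpha of the derivative of the point z^p A_p. *)
Lemma point_motion u (v : 'rV[C]_r) (z : 'rV[C]_r -> 'rV[C]_r) a : M u -> differentiable z u ->
  ('D_v (fun x => z x *m sel_mid *m F x) u *m \adj (F u)) 0 (idxA a) =
  (v *m matB F u a *m (z u)^T) 0 0.
Proof.
move=> Mu dz; have dF := frame_diff sF Mu.
have dm : differentiable (fun x => z x *m sel_mid : 'rV[C]_d) u.
  by apply: differentiable_mulmx dz _; exact: (differentiable_cst (sel_mid : 'M[C]_(r, d))).
have Dm : 'D_v (fun x => z x *m sel_mid : 'rV[C]_d) u = 'D_v z u *m sel_mid.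
  have dc : differentiable (fun _ : 'rV[C]_r => sel_mid : 'M[C]_(r, d)) u := differentiable_cst _ _.
  by rewrite (derive_mulmx v dz dc) derive_cst mulmx0 addr0.
rewrite (derive_mulmx v dm dF) Dm mulmxDl -(mulmxA _ (F u)) mul_mx_adj.
rewrite -(mulmxA _ ('D_v F u)) -conn_dirE // mxE.
rewrite [X in X + _](_ : _ = 0) ?add0r; last first.
  by rewrite mul_mx_scalar mul_sel_mid mxE row_mxEr mxE mulr0.
rewrite mul_sel_mid mxE [RHS]mxE big_split_ord /= [X in _ + X = _]big1 ?addr0 => [|b _]; last first.
  by rewrite row_mxEr mxE mul0r.
rewrite big_split_ord /= [X in X + _ = _]big1 ?add0r => [|b _]; last first.
  by rewrite row_mxEl row_mxEl mxE mul0r.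
apply: eq_bigr => p _; rewrite row_mxEl row_mxEr mulrC; congr (_ * _); last by rewrite mxE.
exact: conn_dirB.
Qed.

Lemma not_in_span u (z : 'rV[C]_r) (w : 'rV[C]_d) a :
  (w *m \adj (F u)) 0 (idxA a) != 0 ->
  ~~ (w <= col_mx sel_gen (z *m sel_mid) *m F u)%MS.
Proof.
apply: contraNN => /submxP [Y ->]; rewrite -!mulmxA mul_mx_adj mulmxA mul_mx_scalar mxE.
rewrite -[Y]hsubmxK mul_row_col mulmxA mul_sel_gen mul_sel_mid mxE.
by rewrite !row_mxEr !mxE addr0 mulr0.
Qed.

(** The second fundamental forms being symmetric, v C_i lies in the right kernel
    of the pencil when v lies in its left kernel. *)
Lemma pencil_symmetric u i (v : 'rV[C]_r) (xi : 'I_c -> C) a0 mu : M u ->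
  v *m (\sum_a xi a *: matB F u a) = mu *: (v *m matB F u a0) ->
  (\sum_a xi a *: matB F u a) *m (v *m matC F u i)^T =
  mu *: (matB F u a0 *m (v *m matC F u i)^T).
Proof.
move=> Mu h; have sym a : matB F u a *m (v *m matC F u i)^T = matC F u i *m (v *m matB F u a)^T.
  by rewrite !trmx_mul !mulmxA (matC_matB_sym oM sF conn0 i a Mu).
have -> : (\sum_a xi a *: matB F u a) *m (v *m matC F u i)^T =
    matC F u i *m (v *m (\sum_a xi a *: matB F u a))^T.
  rewrite mulmx_suml mulmx_sumr [X in _ = _ *m X]linear_sum mulmx_sumr; apply: eq_bigr => a _.
  by rewrite -scalemxAl sym -scalemxAr [X in _ = _ *m X]linearZ /= -scalemxAr.
by rewrite h sym linearZ /= -scalemxAr.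
Qed.

End Pointwise.

Section Torses.
Context {R : realType} {l r c : nat}.
Local Notation C := R[i].
Local Notation d := (l.+1 + r + c)%N.
Variables (M : set 'rV[C]_r) (F : 'rV[C]_r -> 'M[C]_d).
Hypotheses (oM : open M) (sF : smooth M F) (uF : forall u, M u -> F u \in unitmx).
Variable Theta : 'rV[C]_r -> 'M[C]_r.
Hypothesis uTheta : forall u, M u -> Theta u \in unitmx.

Definition pencil_at u (xi : 'I_c -> C) := \sum_a xi a *: matB F u a.

(** What regularity and the focus hypercone provide at one generator, in a form
    that persists at the neighbouring ones. *)
Definition torse_directions (u : 'rV[C]_r) i0 a0 (xi : 'I_c -> C) (v : 'I_r -> 'rV[C]_r)
    (mu : 'I_r -> C) : Prop :=
  [/\ matC F u i0 \in unitmx, matB F u a0 \in unitmx, forall p, v p != 0,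
      forall p, v p *m pencil_at u xi = mu p *: (v p *m matB F u a0) & injective mu].

(** The pencil has r distinct eigenvalues at u0; then it does so near u0, with
    eigenvectors that depend on u with the regularity of the frame. *)
Lemma torse_directions_exist u0 : M u0 ->
  @regular_system _ r l c (l + r + c) F Theta u0 ->
  no_multiple_components (@focus_hypercone _ r l c (l + r + c) F Theta u0) ->
  exists i0 a0 xi (y : 'I_r -> 'rV[C]_r -> 'rV[C]_r) (mu : 'I_r -> 'rV[C]_r -> C) (e : R),
  [/\ 0 < e, forall p, c11mx u0 (y p) & forall u, nr (u - u0) < e ->
    M u /\ torse_directions u i0 a0 xi (y^~ u) (mu^~ u)].
Proof.
move=> Mu0 [i0 [a0 reg]] cof.
move: reg; rewrite det_mulmx mulf_eq0 negb_or => /andP[dB dC].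
have [xi [mu [V [muI uV hV]]]] := pencil_eigenvectors dB cof.
have d0 := det_frame uF Mu0; have uT := uTheta Mu0.
have {}dC : \det (matC F u0 i0) != 0.
  apply: contraNneq dC => h; rewrite (mxCE sF uF Theta i0 Mu0) detZ det_tr.
  by rewrite (det_mulmx (invmx _)) h !mulr0.
have {}dB : \det (matB F u0 a0) != 0.
  apply: contraNneq dB => h; rewrite (mxBE sF uF Theta a0 Mu0) detZ.
  by rewrite (det_mulmx (invmx _)) h !mulr0.
exists i0, a0, xi.
pose W := V *m invmx (Theta u0).
have uW : W \in unitmx by rewrite unitmx_mul uV unitmx_inv.
have hW p : row p W *m pencil_at u0 xi = mu p *: (row p W *m matB F u0 a0).
  have := hV p; under eq_bigr => a _ do rewrite (mxBE sF uF Theta a Mu0) scalerA mulrC -scalerA.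
  rewrite -scaler_sumr (mxBE sF uF Theta a0 Mu0) -!scalemxAr scalerA mulrC -scalerA.
  move=> /(scalerI (invr_neq0 d0)) h.
  rewrite /W row_mul -!mulmxA -h; congr (_ *m _); rewrite mulmx_sumr; apply: eq_bigr => a _.
  by rewrite -scalemxAr.
(* The adjugate, in place of the inverse, multiplies the eigenvalues by the
   determinant of B^a0. *)
pose Q u := pencil_at u xi *m \adj (matB F u a0).
have cQ : c11mx u0 Q.
  apply: c11mx_mul; last exact/c11mx_adj/(matB_c11 oM sF).
  move=> i j; rewrite (_ : (fun _ => _) = fun x => \sum_a xi a * matB F x a i j).
    by apply: c11_sum => a; apply: c11M; [exact: c11_cst|exact: (matB_c11 oM sF a Mu0)].
  by apply/funext => x; rewrite summxE; apply: eq_bigr => a _; rewrite mxE.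
pose nu p := mu p * \det (matB F u0 a0).
have [||y [lam [e1 [e10 hy]]]] := eigen_fields (mu := nu) cQ uW.
- by move=> p q /(mulIf dB) /muI.
- move=> p; rewrite /Q mulmxA hW -scalemxAl -mulmxA mul_mx_adj mul_mx_scalar scalerA.
  by [].
have cB := matB_c11 oM sF a0 Mu0; have cC := matC_c11 oM sF i0 Mu0.
have [e2 e20 h2] := c11_neq0 (c11_det cB) dB.
have [e3 e30 h3] := c11_neq0 (c11_det cC) dC.
have [e4 e40 h4] : exists2 e : R, 0 < e & forall u, nr (u - u0) < e -> M u.
  by have /nbhs_nr [e e0 he] := open_nbhs_nbhs (conj oM Mu0); exists e.
have [||e5 e50 h5] := @finite_nearness R 'I_r (fun p e => forall u, nr (u - u0) < e -> y p u != 0).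
- by move=> p a b _ ab h u hu; apply: h; exact: lt_le_trans ab.
- move=> p; have [cy y0 _ _] := hy p.
  have [j yj] : exists j, y p u0 0 j != 0.
    apply: contrapT => /forallNP h; have : row p W = 0.
      by rewrite -y0; apply/rowP => j; have /negP := h j; rewrite negbK mxE => /eqP.
    move/eqP; apply/negP; apply: contraTneq uW => W0.
    rewrite -row_free_unit; apply/negP => /row_freeP [X hX].
    have := congr1 (row p) hX; rewrite row_mul W0 mul0mx => /rowP /(_ p).
    by rewrite !mxE eqxx => /eqP; rewrite eq_sym oner_eq0.
  have [e e0 he] := c11_neq0 (cy 0 j) yj; exists e => // u hu.
  by apply: contraNneq (he u hu) => ->; rewrite mxE.
exists y, (fun p u => lam p u / \det (matB F u a0)).
exists (Num.min e1 (Num.min e2 (Num.min e3 (Num.min e4 e5)))); split.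
- by rewrite !lt_min e10 e20 e30 e40.
- by move=> p; case: (hy p).
move=> u; rewrite !lt_min => /and5P[k1 k2 k3 k4 k5]; split; first exact: h4.
have dBu := h2 u k2; split.
- by rewrite unitmxE unitfE h3.
- by rewrite unitmxE unitfE.
- by move=> p; exact: h5.
- move=> p; have [_ _ /(_ u k1) h _] := hy p.
  have := congr1 (mulmx^~ (matB F u a0)) h; rewrite /Q !mulmxA -mulmxA mul_adj_mx mul_mx_scalar.
  rewrite -scalemxAl => h'; apply: (scalerI dBu); rewrite h' scalerA mulrCA divff ?mulr1 //.
- move=> p q /(mulIf (invr_neq0 dBu)) h; apply/eqP; apply: contraT => pq.
  by have [_ _ _ /(_ q u k1 pq)] := hy p; rewrite h eqxx.
Qed.

Hypothesis conn0 : forall u q i a, M u -> conn F u q (idxI i) (idxA a) = 0.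

Section AtGenerator.
Variables (u : 'rV[C]_r) (i0 : 'I_l.+1) (a0 : 'I_c) (xi : 'I_c -> C).
Variables (v : 'I_r -> 'rV[C]_r) (mu : 'I_r -> C).
Hypotheses (Mu : M u) (hv : torse_directions u i0 a0 xi v mu).

Lemma directions_free : row_free (\matrix_p v p).
Proof.
case: hv => _ uB v0 vE muI.
apply: (@eigenvectors_free _ _ _ (pencil_at u xi *m invmx (matB F u a0)) v mu) => // p.
by rewrite mulmxA vE -scalemxAl mulmxK.
Qed.

Lemma direction_kernel p i : pencil_at u xi *m (v p *m matC F u i)^T =
  mu p *: (matB F u a0 *m (v p *m matC F u i)^T).
Proof. by case: hv => _ _ _ vE _; apply: (pencil_symmetric oM sF conn0). Qed.

Lemma kernel0 p (z : 'rV[C]_r) :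
  pencil_at u xi *m z^T = mu p *: (matB F u a0 *m z^T) ->
  (v p *m matB F u a0 *m z^T) 0 0 = 0 -> z = 0.
Proof.
case: hv => _ uB _ vE muI hz h; apply: (pencil_kernel uB directions_free vE _ hz).
  by move=> q; apply: contraNneq => /muI ->.
by rewrite [LHS]mx11_scalar h raddf0.
Qed.

Lemma direction_point p : v p *m matC F u i0 != 0.
Proof.
case: hv => uC _ v0 _ _; apply: contraNneq (v0 p) => h.
by rewrite -(mulmxK uC (v p)) h mul0mx.
Qed.

(** The derivative of the point (v C_i0)^p A_p leaves T_L in the direction of
    A_a0. *)
Lemma direction_bent p : (v p *m matB F u a0 *m (v p *m matC F u i0)^T) 0 0 != 0.
Proof.
by apply: contraNneq (direction_point p) => /(kernel0 (direction_kernel p i0)) ->.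
Qed.

(** All the v C_i lie in the kernel of the pencil, which is spanned by v C_i0. *)
Lemma direction_proportional p : exists2 lam : 'cV[C]_l.+1, lam != 0 &
  forall i, v p *m matC F u i = lam i 0 *: (v p *m matC F u i0).
Proof.
pose g (z : 'rV[C]_r) := (v p *m matB F u a0 *m z^T) 0 0; pose z i := v p *m matC F u i.
have gz0 : g (z i0) != 0 by exact: direction_bent.
exists (\col_i (g (z i) / g (z i0))).
  apply/negP => /eqP /colP /(_ i0); rewrite !mxE divff // => /eqP.
  by rewrite oner_eq0.
move=> i; rewrite mxE -/(z i) -/(z i0); set t := _ / _.
apply/eqP; rewrite -subr_eq0; apply/eqP; apply: (@kernel0 p).
  rewrite linearB /= linearZ /= !mulmxBr -!scalemxAr /z !direction_kernel.
  by rewrite scalerBr !scalerA [t * _]mulrC.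
rewrite linearB /= linearZ /= mulmxBr -scalemxAr [LHS]mxE [X in _ + X]mxE [X in _ - X]mxE.
by rewrite -/(g (z i)) -/(g (z i0)) /t divfK ?subrr.
Qed.

End AtGenerator.

(** Along an integral curve of the eigenvector field y p, the generator and the
    point (v C_i0)^p A_p, where v = y p, span the tangent subspace. *)
Lemma torse_along (S : set 'rV[C]_1) (g : 'rV[C]_1 -> 'rV[C]_r) i0 a0 xi
    (y : 'I_r -> 'rV[C]_r -> 'rV[C]_r) mu p :
  open S -> (forall s, S s -> differentiable g s) ->
  (forall s, S s -> 'D_(delta_mx 0 0) g s = y p (g s)) ->
  (forall s, S s -> differentiable (y p) (g s)) ->
  (forall s, S s -> M (g s) /\ torse_directions (g s) i0 a0 xi (y^~ (g s)) (mu^~ (g s))) ->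
  @torse _ l (l + r + c) S (fun s => sel_gen *m F (g s)).
Proof.
move=> oS dg g'E dy hg.
pose z u := y p u *m matC F u i0.
have dz s : S s -> differentiable z (g s).
  move=> Ss; have [Ms _] := hg s Ss; apply: differentiable_mulmx; first exact: dy.
  have [e e0 he] := c11mx_diff (matC_c11 oM sF i0 Ms).
  by apply: he; rewrite subrr nr0.
have dzm s : S s -> differentiable (fun u => z u *m sel_mid : 'rV[C]_d) (g s).
  move=> Ss; apply: differentiable_mulmx (dz s Ss) _.
  exact: (differentiable_cst (sel_mid : 'M[C]_(r, d))).
have dF s : S s -> differentiable F (g s) by case/hg => Ms _; exact: (frame_diff sF Ms).
apply: (@torse_of_frame R l (l + r + c) S sel_gen (fun s => z (g s) *m sel_mid)
  (fun s => F (g s))) => //.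
- exact: sel_gen_free.
- by move=> s Ss; have [] := derive_comp (delta_mx 0 0) (dg s Ss) (dF s Ss).
- by move=> s Ss; have [] := derive_comp (delta_mx 0 0) (dg s Ss) (dzm s Ss).
- by move=> s /hg [Ms _]; exact: uF.
- by move=> s /hg [Ms hs]; apply: sel_free; exact: (direction_point hs).
- move=> s Ss; have [Ms hs] := hg s Ss.
  have E := (derive_comp (delta_mx 0 0) (dg s Ss) (dF s Ss)).2; rewrite (g'E s Ss) in E.
  have [lam lam0 hlam] := direction_proportional Ms hs p.
  have [al [be [be0 h]]] := generator_motion sF uF conn0 Ms hlam lam0.
  exists al, be; split; first exact: be0.
  exact: (eq_ind_r (fun w : 'M[C]_d => sel_gen *m w = _) h E).
- move=> s Ss; have [Ms hs] := hg s Ss.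
  have dzF : differentiable (fun u => z u *m sel_mid *m F u) (g s).
    by apply: differentiable_mulmx; [exact: dzm|exact: dF].
  have E := (derive_comp (delta_mx 0 0) (dg s Ss) dzF).2; rewrite (g'E s Ss) in E.
  apply: (eq_ind_r (fun w : 'rV[C]_d =>
    ~~ (w <= col_mx sel_gen (z (g s) *m sel_mid) *m F (g s))%MS) _ E).
  apply: (@not_in_span R l r c F (g s) _ _ a0).
  by rewrite (point_motion sF (y p (g s)) a0 Ms (dz s Ss)) (direction_bent Ms hs).
Qed.

End Torses.

(** Near u0, the integral curves of the r eigenvector fields; these are
    independent wherever they are defined, having distinct eigenvalues. *)
Lemma foliated_of_regular (R : realType) (l r c : nat) (M : set 'rV[R[i]]_r.+1)
    (F : 'rV[R[i]]_r.+1 -> 'M[R[i]]_(l.+1 + r.+1 + c)) (Theta : 'rV[R[i]]_r.+1 -> 'M[R[i]]_r.+1) :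
  smooth M F -> (forall u, M u -> F u \in unitmx) ->
  (forall u, M u -> Theta u \in unitmx) ->
  @degenerate_gauss _ r.+1 l (l + r.+1 + c) M (@generator _ r.+1 l c (l + r.+1 + c) F)
    (@tangent_subspace _ r.+1 l c (l + r.+1 + c) F) ->
  (forall u, M u -> @regular_system _ r.+1 l c (l + r.+1 + c) F Theta u) ->
  (forall u, M u ->
    no_multiple_components (@focus_hypercone _ r.+1 l c (l + r.+1 + c) F Theta u)) ->
  @foliated_by_torses _ r.+1 l (l + r.+1 + c) M (@generator _ r.+1 l c (l + r.+1 + c) F).
Proof.
move=> sF uF uT X reg cof u0 Mu0.
have oM := dg_open X; have conn0 := conn0_of_gauss sF X.
have [i0 [a0 [xi [y [mu [e0 [e00 cy he0]]]]]]] :=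
  torse_directions_exist oM sF uF uT Mu0 (reg u0 Mu0) (cof u0 Mu0).
have [||e1 e10 he1] := @finite_nearness R 'I_r.+1 (fun p e =>
  forall u, nr (u - u0) < e -> differentiable (y p) u).
- by move=> p a b _ ab h u hu; apply: h; exact: lt_le_trans ab.
- by move=> p; exact: c11mx_diff.
pose e := Num.min e0 e1; have e_gt0 : 0 < e by rewrite lt_min e00.
pose B := [set u : 'rV[R[i]]_r.+1 | nr (u - u0) < e].
have hB u : B u -> M u /\ torse_directions F u i0 a0 xi (y^~ u) (mu^~ u).
  by rewrite /B /= lt_min => /andP[h _]; exact: he0.
have dB u p : B u -> differentiable (y p) u by rewrite /B /= lt_min => /andP[_ h]; exact: he1.
have y0 p : y p u0 != 0.
  by have [|_ [_ _ h _ _]] := hB u0; [rewrite /B /= subrr nr0|exact: h].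
have /choice [f hf] : forall p, exists t : set 'rV[R[i]]_1 * set 'rV[R[i]]_r *
    ('rV[R[i]]_(1 + r) -> 'rV[R[i]]_r.+1),
    foliation_chart (r := r.+1) B u0 t.1.1 t.1.2 t.2 /\
    forall z, box (r := r.+1) t.1.1 t.1.2 z -> leaf_direction (r := r.+1) t.2 z = y p (t.2 z).
  move=> p; have [S [W [Phi h]]] := foliation_of_field (cy p) (y0 p) e_gt0 (fun u hu => hu : B u).
  by exists (S, W, Phi).
exists (fun p => (f p).1.1), (fun p => (f p).1.2), (fun p => (f p).2); split.
- move=> p; have [[] ? ? ? ? sub ? ? ? ? _] := hf p; split=> //.
  by apply: subset_trans sub _ => u /hB [].
- move=> p w Ww; have [ch dir] := hf p.
  set Phi := (f p).2; set S := (f p).1.1.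
  pose line (s : 'rV[R[i]]_1) : 'rV[R[i]]_(1 + r) := row_mx s w.
  have lineE : line = fun s => row_mx 0 w + s *m row_mx 1%:M 0.
    by apply/funext => s; rewrite mul_mx_row mulmx1 mulmx0 add_row_mx add0r addr0.
  have Sbox s : S s -> box (r := r.+1) S (f p).1.2 (line s).
    by move=> Ss; split; rewrite /= ?row_mxKl ?row_mxKr.
  have line' s : differentiable line s /\ 'D_(delta_mx 0 0) line s = delta_mx 0 (lshift r ord0).
    have ds : differentiable (id : 'rV[R[i]]_1 -> _) s by exact: ex_diff.
    rewrite lineE; have [h1 h2] := derive_affine (row_mx 0 w) (row_mx 1%:M 0) ds.
    split=> //; rewrite h2 derive_id mul_mx_row mulmx1 mulmx0.
    apply/rowP => j; case: (split_ordP j) => k ->; rewrite ?row_mxEl ?row_mxEr !mxE.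
      by rewrite ord1.
    by rewrite eq_rlshift.
  have hPhi s : S s -> B (Phi (line s)).
    by move=> /Sbox bs; apply: (fc_sub ch); exists (line s).
  have comp s (Ss : S s) := derive_comp (delta_mx 0 0) (line' s).1 (fc_diff ch (Sbox s Ss)).
  rewrite (_ : (fun s => _) = fun s => sel_gen *m F ((Phi \o line) s)); last first.
    by apply/funext => s; exact: generatorE.
  apply: (@torse_along R l r.+1 c M F oM sF uF conn0 S (Phi \o line) i0 a0 xi y mu p).
  + exact: fc_openS ch.
  + by move=> s Ss; case: (comp s Ss).
  + move=> s Ss; case: (comp s Ss) => _ ->; rewrite (line' s).2.
    exact: (dir _ (Sbox s Ss)).
  + by move=> s Ss; apply: dB; exact: hPhi.
  + by move=> s Ss; apply: hB; exact: hPhi.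
- move=> z bz zE; set u := (f ord0).2 (z ord0).
  have Bu : B u by have [ch _] := hf ord0; apply: (fc_sub ch); exists (z ord0).
  have [Mu hu] := hB u Bu.
  rewrite (_ : (\matrix_p _) = \matrix_p y p u); first exact: (directions_free hu).
  apply/row_matrixP => p; rewrite !rowK; have [_ dir] := hf p.
  by rewrite dir // /u (zE p ord0).
Qed.

Theorem theorem2 (R : realType) (n N r l m : nat)
    (hr : (2 <= r < n)%N) (hl : l = (n - r)%N) (hnN : (n <= N)%N)
    (M : set 'rV[R[i]]_r)
    (F : 'rV[R[i]]_r -> 'M[R[i]]_(l.+1 + r + (N - n), N.+1))
    (Theta : 'rV[R[i]]_r -> 'M[R[i]]_r)
    (F_smooth : smooth M F)
    (F_frame : forall u, M u -> row_free (F u))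
    (Theta_basis : forall u, M u -> Theta u \in unitmx)
    (X_degenerate : degenerate_gauss M (generator F) (tangent_subspace F))
    (X_regular : forall u, M u -> regular_system F Theta u)
    (hm : forall u x, M u -> smooth_point (generator F) u x ->
      number_of_forms F Theta u x = m)
    (hl1 : (1 <= l)%N) (hm2 : (2 <= m)%N)
    (focal : forall u, M u ->
      no_multiple_components (focus_hypersurface F Theta u))
    (cofocal : forall u, M u ->
      no_multiple_components (focus_hypercone F Theta u)) :
  foliated_by_torses M (generator F).
Proof.
have NE : N = (l + r + (N - n))%N by move: hr; lia.
clear hm hl1 hm2 focal.
(* With N = l + r + c, the frame is a square matrix. *)
move: (N - n)%N NE F F_smooth F_frame X_degenerate X_regular cofocal => c NE.
subst N; clear hnN hl.
case: r hr M Theta Theta_basis => [|r] // _ M Theta uT F sF fF X reg cof.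
apply: foliated_of_regular sF _ uT X reg cof.
by move=> u Mu; rewrite -row_free_unit; exact: fF.
Qed.
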